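(* Let $\mathbb{F}\in\{\mathbb{R},\mathbb{C}\}$, $A\in\mathbb{F}^{m\times n}$, $x_0\in\mathbb{F}^n$ with $S=\mathrm{supp}\,x_0$ and $\#S=K$, $\epsilon\in\mathbb{F}^m$, $b=Ax_0+\epsilon$. Suppose $A$ is $K$-feasible and $\beta_{2K}>1/\sqrt2$. If $$|x_{0,j}|>\Big(\frac{1}{2\beta_{2K}^2-1}+\frac{1}{\beta_K}\Big)\|\epsilon\|_2\quad\text{for all }j\in S,$$ then the oracle solution $x'=x_S$ is a global minimizer of $\mathcal{K}_K$ and of $\mathcal{K}_{K,reg}$. Moreover, if $A$ is strictly $K$-feasible, then $\mathcal{K}_{K,reg}$ has no local minimizers other than $x'$.
   Context: Columns of $A$ are $a_1,\dots,a_n$, $\|A\|_{\infty,col}=\max_i\|a_i\|_2$. $A$ is $K$-feasible if $\|A\|_{\infty,col}\le1$ and every subset of $n-K$ columns contains two distinct columns with $\|a_i-a_j\|_2^2\le2$; strictly $K$-feasible if every such subset contains two distinct columns with $\|a_i-a_j\|_2^2<2$. $\mathrm{card}(x)$ is the number of nonzero entries, $P_K=\{x:\mathrm{card}(x)\le K\}$, $\iota_{P_K}$ its indicator function; $\beta_k=\inf\{\|Ax\|_2/\|x\|_2:x\ne0,\ \mathrm{card}(x)\le k\}$. $\mathcal{Q}_2(\iota_{P_K})$ is the function such that $\mathcal{Q}_2(\iota_{P_K})(x)+\|x\|^2$ is the lower semicontinuous convex envelope of $\iota_{P_K}(x)+\|x\|^2$; explicitly, with $\tilde x$ the entries of $x$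 sorted so that $|\tilde x_j|$ is non-increasing, $\mathcal{Q}_2(\iota_{P_K})(x)=\frac{1}{k_*}\big(\sum_{j>K-k_*}|\tilde x_j|\big)^2-\sum_{j>K-k_*}|\tilde x_j|^2$, where $k_*$ is the largest $k\in\{1,\dots,K\}$ with $\sum_{j>K-k}|\tilde x_j|-k|\tilde x_{K+1-k}|\ge0$. $\mathcal{K}_K(x)=\iota_{P_K}(x)+\|Ax-b\|_2^2$, $\mathcal{K}_{K,reg}(x)=\mathcal{Q}_2(\iota_{P_K})(x)+\|Ax-b\|_2^2$. $A_S$ is $A$ with columns outside $S$ set to zero; the oracle solution is $x_S=(A_S^*A_S)^\dagger A_S^*b$ ($\dagger$ Moore–Penrose inverse, $A^*$ conjugate transpose). *)

(* Defs.v *)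
From HB Require Import structures.
From mathcomp Require Import all_boot all_order all_algebra.
From mathcomp Require Import boolp classical_sets reals constructive_ereal.
From mathcomp Require Import complex.
Set Implicit Arguments. Unset Strict Implicit. Unset Printing Implicit Defensive.
Import Order.TTheory GRing.Theory Num.Theory.
Local Open Scope ring_scope.

(* The scalar field F is R or C = R[i]; in both cases the data of the
   scalar field used below is: the field F, the modulus nrm : F -> R
   and the conjugation cj : F -> F. *)
Section Defs.
Variables (R : realType) (F : comRingType) (nrm : F -> R) (cj : F -> F).

Definition norm2 k (v : 'cV[F]_k) : R :=
  Num.sqrt (\sum_(i < k) nrm (v i 0) ^+ 2).

Definition adj m n (A : 'M[F]_(m, n)) : 'M[F]_(n, m) :=
  \matrix_(i, j) cj (A j i).

Definition supp n (x : 'cV[F]_n) : {set 'I_n} := [set i | x i 0 != 0].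
Definition card n (x : 'cV[F]_n) : nat := #|supp x|.

Definition colnorm_inf m n (A : 'M[F]_(m, n)) : R :=
  \big[Num.max/0]_(i < n) norm2 (col i A).

Definition K_feasible m n (A : 'M[F]_(m, n)) (K : nat) : Prop :=
  colnorm_inf A <= 1 /\
  forall T : {set 'I_n}, #|T| = (n - K)%N ->
    exists i j, [/\ i \in T, j \in T, i != j &
                    norm2 (col i A - col j A) ^+ 2 <= 2].

Definition strictly_K_feasible m n (A : 'M[F]_(m, n)) (K : nat) : Prop :=
  colnorm_inf A <= 1 /\
  forall T : {set 'I_n}, #|T| = (n - K)%N ->
    exists i j, [/\ i \in T, j \in T, i != j &
                    norm2 (col i A - col j A) ^+ 2 < 2].

Definition beta m n (A : 'M[F]_(m, n)) (k : nat) : R :=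
  inf [set r : R | exists x : 'cV[F]_n,
         [/\ x != 0, (card x <= k)%N & r = norm2 (A *m x) / norm2 x]].

(* magnitudes |x_j| sorted non-increasingly: s`_(j-1) = |x~_j| *)
Definition sorted_abs n (x : 'cV[F]_n) : seq R :=
  sort (fun a b : R => b <= a) [seq nrm (x i 0) | i <- enum 'I_n].

(* sum_{j > K-k} |x~_j| (1-indexed), i.e. 0-indexed indices >= K-k *)
Definition tail_sum n (x : 'cV[F]_n) (K k : nat) : R :=
  \sum_((K - k)%N <= j < n) (sorted_abs x)`_j.
Definition tail_sum2 n (x : 'cV[F]_n) (K k : nat) : R :=
  \sum_((K - k)%N <= j < n) (sorted_abs x)`_j ^+ 2.

Definition kstar n (x : 'cV[F]_n) (K : nat) : nat :=
  \max_(1 <= k < K.+1 | 0 <= tail_sum x K k - k%:R * (sorted_abs x)`_(K - k))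
     k.

Definition Q2 n (K : nat) (x : 'cV[F]_n) : R :=
  let k := kstar x K in
  (k%:R)^-1 * tail_sum x K k ^+ 2 - tail_sum2 x K k.

Definition KK m n (A : 'M[F]_(m, n)) (b : 'cV[F]_m) (K : nat)
  (x : 'cV[F]_n) : \bar R :=
  if (card x <= K)%N then (norm2 (A *m x - b) ^+ 2)%:E else +oo%E.

Definition KKreg m n (A : 'M[F]_(m, n)) (b : 'cV[F]_m) (K : nat)
  (x : 'cV[F]_n) : R :=
  Q2 K x + norm2 (A *m x - b) ^+ 2.

Definition restr_cols m n (A : 'M[F]_(m, n)) (S : {set 'I_n}) : 'M[F]_(m, n) :=
  \matrix_(i, j) if j \in S then A i j else 0.

Definition is_pinv m n (M : 'M[F]_(m, n)) (X : 'M[F]_(n, m)) : Prop :=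
  [/\ M *m X *m M = M, X *m M *m X = X,
      adj (M *m X) = M *m X & adj (X *m M) = X *m M].

End Defs.

Definition global_min_e (R : realType) (T : Type) (f : T -> \bar R) (x : T) :=
  forall y, (f x <= f y)%E.
Definition global_min (R : realType) (T : Type) (f : T -> R) (x : T) :=
  forall y, f x <= f y.
Definition local_min (R : realType) (F : comRingType) (nrm : F -> R) n
  (f : 'cV[F]_n -> R) (x : 'cV[F]_n) :=
  exists2 d : R, 0 < d & forall y, norm2 nrm (y - x) < d -> f x <= f y.

Definition thm57_statement (R : realType) (F : comRingType) (nrm : F -> R)
  (cj : F -> F) : Prop :=
  forall (m n K : nat) (A : 'M[F]_(m, n)) (x0 : 'cV[F]_n) (S : {set 'I_n})
         (eps b : 'cV[F]_m),
    S = supp x0 -> #|S| = K -> b = A *m x0 + eps ->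
    K_feasible nrm A K ->
    (Num.sqrt 2)^-1 < beta nrm A (K.*2) ->
    (forall j, j \in S ->
      nrm (x0 j 0) > ((2 * beta nrm A (K.*2) ^+ 2 - 1)^-1
                      + (beta nrm A K)^-1) * norm2 nrm eps) ->
    forall X : 'M[F]_n,
      is_pinv cj (adj cj (restr_cols A S) *m restr_cols A S) X ->
      let x' := X *m adj cj (restr_cols A S) *m b in
      [/\ global_min_e (KK nrm A b K) x',
          global_min (KKreg nrm A b K) x' &
          (strictly_K_feasible nrm A K ->
             forall y, local_min nrm (KKreg nrm A b K) y -> y = x')].

(* Main.v *)
(* Let u be the oracle solution, r = b - A u, and let x be a local minimizer of
   K_reg. Q_2(x) + |x|^2 is the minimum of sum |x_i|^2 / th_i over weights th in
   [0, 1] with sum th <= K. If card x > K, the optimal weights are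
   th_i = min(1, |x_i| / xi): let P = {th = 1}, and call i a tie if 0 < th_i < 1.
   Perturbing x together with its weights gives first-order conditions on
   A^*(Ax - b), and the second-order condition |c|^2 <= |A(c)|^2 for sum-zero c
   on the ties.

   Compare x - u with vectors y - u in which the fractional weights of the ties
   outside S are rounded so that y - u is 2K-sparse: the bound
   |A(y - u)|^2 >= beta_2K^2 |y - u|^2, averaged over a suitable rounding,
   contradicts the first-order conditions and the gap on |u_j|. When the ties
   outside S have total weight tau >= 4/3, pipage rounding is used (the second-order
   condition makes the relevant quadratic concave along exchange directions, and a
   Bessel-type inequality bounds the number of ties by 2K); for smaller tau the ties
   are split into at most two groups and each group is replaced by a single randomly
   chosen tie. If card x <= K the same comparison without ties gives x = u.

   Hence u is the only local minimizer of K_reg. A global minimizer exists by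
   compactness, so it is u, and K_reg <= K with equality on P_K. *)
Require Import Defs.
From HB Require Import structures.
From mathcomp Require Import all_boot all_order all_algebra.
From mathcomp Require Import zify ring lra.
From mathcomp Require topology normedtype derive.
Set Implicit Arguments. Unset Strict Implicit. Unset Printing Implicit Defensive.
Import Order.TTheory GRing.Theory Num.Theory.
Local Open Scope ring_scope.

(** * Real inequalities closing the roundings *)

(** A local minimizer may have far more than [2K] nonzero entries, while the lower bound on [A]
    controls only [2K]-sparse vectors; this is what forces the rounding. If the ties of a group are
    replaced by one tie, drawn with probability proportional to its weight, the mean is kept and the
    energy grows by a variance, which [|e_i - e_j|^2 <= 3 - kap] keeps small. Most roundings also
    stretch the ties by [3/2]: along the ties the energy has slope [2 (T - tau + Xt)] at the
    minimizer, nonpositive up to noise since [T <= tau], so overshooting gains a first-order term.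
    The gap on [|u_j|] is used only in the form [om2 (1 + 2 kap) < kap^2 m2]. The tight spot is room
    for a single tie, where one random tie has too large a variance if [kap] is small, [tau] is near
    1 and the weights are spread out. If [P \ S] is nonempty, one coordinate of [S \ P] is then
    deleted to make room for a second tie, and the result is averaged over that coordinate. If
    [P \ S] is empty, then [K = 1], and two further quadratic inequalities that are special to this
    case close it. *)

(* Dictionary (all lengths divided by xi): kap = 2 beta_2K^2 - 1; tau and T are
   the sums of th and th^2 over the ties outside S, N their number; p0 = #(P \ S),
   PP = |x|^2 on P \ S; U = |x - u|^2 on S \ P; m2 = min_S |u_j|^2;
   om2 = |r|^2; Xt and Xp are <r, A x> restricted to the ties outside S and to P \ S;
   zeta is <A(x - u), A(x - u)_(S \ P)>; chi is the sum of th (1 - th) on S \ P;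
   rho = |A x_ties|^2. *)
Section Scalar.
Variable R : realFieldType.

Lemma le_amgm (x a b : R) : 0 <= a -> 0 <= b -> x ^+ 2 <= 4 * a * b -> x <= a + b.
Proof.
move=> a0 b0 h; have [//|lt] := lerP x (a + b).
have : (a + b) ^+ 2 < x ^+ 2 by rewrite ltr_pXn2r // ?nnegrE; lra.
have : 0 <= (a - b) ^+ 2 by apply: sqr_ge0.
nra.
Qed.

(** Cauchy-Schwarz for the noise, with [om2] eliminated by the gap condition and the product split
    by AM-GM. The free parameter [d] is the share of [kap * tau * m2] that is spent on the noise. *)
Lemma noise_le (c d kap tau T m2 om2 Xt : R) :
  0 < kap -> 0 < tau -> 0 <= T -> 0 <= m2 -> 0 < d -> 0 <= c ->
  om2 * (1 + 2 * kap) <= kap ^+ 2 * m2 -> Xt ^+ 2 <= om2 * T ->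
  c * Xt <= d * kap * tau * m2 + c ^+ 2 * kap * (T / tau) / (4 * d * (1 + 2 * kap)).
Proof.
move=> k0 t0 T0 m0 d0 c0 ho hX.
have k1 : 0 < 1 + 2 * kap by lra.
apply: le_amgm.
- by rewrite !mulr_ge0 // ltW.
- by rewrite !mulr_ge0 ?invr_ge0 ?mulr_ge0 ?sqr_ge0 // ltW.
have -> : 4 * (d * kap * tau * m2) * (c ^+ 2 * kap * (T / tau) / (4 * d * (1 + 2 * kap))) =
  c ^+ 2 * ((kap ^+ 2 * m2 / (1 + 2 * kap)) * T) by field; rewrite !lt0r_neq0.
rewrite exprMn; apply: ler_wpM2l; first exact: sqr_ge0.
apply: le_trans hX _; apply: ler_wpM2r => //.
by rewrite ler_pdivlMr.
Qed.

(** The coefficient [(1 + kap) / 2] of [U] is spent in two parts: [U / 2] absorbs the same term in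
    the bound on [zeta], and [kap / 2 * U] is traded for [m2]. The latter cancels the [p0 * m2] of
    [Xp] and leaves [tau * m2] to pay for the noise. *)
Lemma budget_le (kap p0 PP tau chi U m2 zeta Xp : R) :
  0 < kap -> kap <= 1 -> 0 <= chi -> p0 <= PP ->
  (p0 + tau) * m2 - chi <= U -> zeta <= (p0 + tau - chi) / 2 + U / 2 ->
  Xp <= kap / 2 * (PP + p0 * m2) ->
  zeta + Xp - (1 + kap) / 2 * (PP + U) <= tau / 2 - kap / 2 * tau * m2.
Proof.
move=> k0 k1 c0 pp hU hz hp.
have: 0 <= kap*(U - (p0 + tau) * m2 + chi) by apply: mulr_ge0; lra.
have: 0 <= (1-kap)*chi by apply: mulr_ge0; lra.
lra.
Qed.

(** Apart from noise and multiples of [kap] the bound is [1/2 - 3/8 * tau] in the first alternative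
    and [1 - 3/8 * tau] in the second, whence the thresholds [4/3] and [8/3]. *)
Lemma pipage_bound_neg (kap tau T m2 om2 Xt Gb B : R) :
  0 < kap -> kap <= 1 -> 4/3 <= tau -> 0 < m2 ->
  0 <= T -> T <= tau -> om2 * (1 + 2 * kap) <= kap ^+ 2 * m2 ->
  Xt ^+ 2 <= om2 * T ->
  B <= tau / 2 - kap / 2 * tau * m2 ->
  (Gb <= (1 - kap) / 4) || ((8/3 <= tau) && (Gb <= 1/2)) ->
  B + 2 * Xt + 2 * Gb + tau / 4 - (1 + kap) / 2 * (9 / 4 * tau) < 0.
Proof.
move=> k0 k1 t0 m0 T0 Tt ho hX hB hG.
have tp : 0 < tau by lra.
have := @noise_le 2 (1/2) kap tau T m2 om2 Xt k0 tp T0 (ltW m0).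
move=> /(_ ltac:(lra) ltac:(lra) ho hX).
set z := (X in _ <= _ + X); have hz : z < 2 * kap.
  rewrite /z ltr_pdivrMr; last by lra.
  have : T / tau <= 1 by rewrite ler_pdivrMr //; lra.
  move=> h; have : kap * (T / tau) <= kap * 1 by rewrite ler_wpM2l // ltW.
  have : 0 < kap * kap by apply: mulr_gt0.
  lra.
move=> hn.
case/orP: hG => [hG|/andP[t1 hG]].
  have : 0 <= kap * (tau - 4/3) by apply: mulr_ge0; lra.
  lra.
have : 0 <= kap * (tau - 8/3) by apply: mulr_ge0; lra.
lra.
Qed.

(** [Y] is the sum of the squared group masses. A rounding with stretch [3/2] leaves [2 * T + Y / 4
    + (3 - kap) * (Y - T) - 9/8 * (1 + kap) * Y], which equals the two [1 - kap] terms on the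
    left. *)
Lemma single_group_bound (kap tau T Y m2 om2 Xt B : R) :
  0 < kap -> kap <= 1 -> 0 < tau -> 0 < m2 ->
  0 <= T -> om2 * (1 + 2 * kap) <= kap ^+ 2 * m2 ->
  Xt ^+ 2 <= om2 * T -> B <= tau / 2 - kap / 2 * tau * m2 ->
  B + 2 * Xt - 2 * tau + (9/8) * (1 - kap) * Y + (1 - kap) * (Y - T) <=
  - (3/2) * tau + (17/8) * (1 - kap) * Y - (1 - kap) * T + 2 * kap * (T / tau) / (1 + 2 * kap).
Proof.
move=> k0 k1 tp m0 T0 ho hX hB.
have := @noise_le 2 (1/2) kap tau T m2 om2 Xt k0 tp T0 (ltW m0).
move=> /(_ ltac:(lra) ltac:(lra) ho hX).
set z := (X in _ <= _ + X); have -> : z = 2 * kap * (T / tau) / (1 + 2 * kap).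
  by rewrite /z; field; rewrite !lt0r_neq0 //; lra.
lra.
Qed.

Lemma single_group_neg (kap tau T : R) :
  0 < kap -> kap <= 1 -> 0 < tau -> tau <= 1 -> 0 <= T -> T <= tau ^+ 2 ->
  [|| 3/10 <= kap, tau <= 7/10 | 2/3 * tau ^+ 2 <= T] ->
  - (3/2) * tau + (17/8) * (1 - kap) * tau ^+ 2 - (1 - kap) * T + 2 * kap * (T / tau) / (1 + 2 * kap) < 0.
Proof.
move=> k0 k1 t0 t1 T0 T1 hc.
have k3 : 0 < 1 + 2 * kap by lra.
set a := T / tau; have aE : T = a * tau by rewrite /a divfK // lt0r_neq0.
have a0 : 0 <= a by rewrite /a divr_ge0 // ltW.
have a1 : a <= tau by rewrite -(@ler_pM2r _ tau) // -aE -expr2.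
set c := 2 * kap / (1 + 2 * kap).
have cE : c * (1 + 2 * kap) = 2 * kap by rewrite /c divfK // lt0r_neq0.
have c0 : 0 < c by rewrite /c divr_gt0 //; lra.
have c2 : c < 1 by rewrite /c ltr_pdivrMr //; lra.
have -> : 2 * kap * a / (1 + 2 * kap) = c * a by rewrite /c; ring.
rewrite aE.
have H (p : R) : 0 <= p -> p <= 1 -> a = p * tau ->
   [|| 3/10 <= kap, tau <= 7/10 | 2/3 <= p] ->
  -(3/2) + (17/8) * (1 - kap) * tau - (1 - kap) * a + c * p < 0.
  move=> p0 p1 aE' hh; rewrite aE'.
  (* After division by [tau] the claim is affine in [p]: [E0] settles the end [p = 0], [E1] the end
     [p = 1], and [E2] the left end [2/3] of the third alternative. *)
  have E0 : - (3/2) + (1 - kap) * tau * (17/8) < 0 \/ 2/3 <= p.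
    case/or3P: hh => h; [left|left|by right].
      have : (1 - kap) * tau <= 7/10 * 1 by apply: ler_pM; lra.
      lra.
    have : (1 - kap) * tau <= 1 * (7/10) by apply: ler_pM; lra.
    lra.
  have kt : (1 - kap) * tau <= (1 - kap) by rewrite ler_piMr //; lra.
  have kt0 : 0 <= (1 - kap) * tau by apply: mulr_ge0; lra.
  have E1 : - (3/2) + (9/8) * (1 - kap) + c < 0.
    have : (- (3/2) + (9/8) * (1 - kap) + c) * (1 + 2 * kap) < 0.
      have : 0 < kap * kap by apply: mulr_gt0.
      have : 0 <= (kap - 1/6) ^+ 2 by apply: sqr_ge0.
      move: cE; lra.
    by rewrite pmulr_llt0.
  case: E0 => [E0|E0].
    nra.
  have E2 : - (3/2) + (35/24) * (1 - kap) + 2/3 * c < 0.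
    have : (- (3/2) + (35/24) * (1 - kap) + 2/3 * c) * (1 + 2 * kap) < 0.
      have : 0 < kap * kap by apply: mulr_gt0.
      move: cE; lra.
    by rewrite pmulr_llt0.
  nra.
set p := a / tau.
have aE2 : a = p * tau by rewrite /p divfK // lt0r_neq0.
have p0 : 0 <= p by rewrite /p divr_ge0 // ltW.
have p1 : p <= 1 by rewrite /p ler_pdivrMr // mul1r.
have hc' : [|| 3/10 <= kap, tau <= 7/10 | 2/3 <= p].
  case/or3P: hc => h; rewrite ?h ?orbT //.
  by rewrite /p /a !ler_pdivlMr // -mulrA -expr2 h !orbT.
have := H p p0 p1 aE2 hc'.
rewrite -(@pmulr_llt0 _ tau) // => hh.
have cp : c * a = c * p * tau by rewrite {1}aE2 mulrA.
lra.
Qed.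

(** A tie with at least [2/3] of the mass forms a group alone, so [Y - T] is at most
    [(tau - th) ^+ 2] and no stretch is used. What has to be seen is [tau - 2 * Y + T >= 0]. *)
Lemma dominant_group_neg (kap tau T Y m2 om2 Xt B th : R) :
  0 < kap -> kap <= 1 -> 0 < tau -> tau <= 4/3 -> 0 < m2 ->
  0 <= T -> T <= tau ^+ 2 -> om2 * (1 + 2 * kap) <= kap ^+ 2 * m2 ->
  Xt ^+ 2 <= om2 * T -> B <= tau / 2 - kap / 2 * tau * m2 ->
  2/3 * tau <= th -> th <= 1 -> th <= tau -> th ^+ 2 <= T -> Y = th ^+ 2 + (tau - th) ^+ 2 ->
  B + T - tau + Xt + (3 - kap) / 2 * (Y - T) - (1 + kap) / 2 * Y < 0.
Proof.
move=> k0 k1 tp t1 m0 T0 T1 ho hX hB h1 h2 h3 h4 hY.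
have := @noise_le 1 (1/2) kap tau T m2 om2 Xt k0 tp T0 (ltW m0).
move=> /(_ ltac:(lra) ltac:(lra) ho hX).
set z := (X in _ <= _ + X); have hz : z < kap / 2 * tau.
  have Ta : T / tau <= tau by rewrite ler_pdivrMr // -expr2.
  have -> : z = kap / 2 * (T / tau) / (1 + 2 * kap).
    by rewrite /z; field; rewrite !lt0r_neq0 //; lra.
  rewrite ltr_pdivrMr; last by lra.
  have : kap * (T / tau) <= kap * tau by rewrite ler_wpM2l // ltW.
  have : 0 < kap * tau * kap by rewrite !mulr_gt0.
  lra.
move=> hn.
have : 0 <= (1 - kap) * (tau - 2 * Y + T).
  apply: mulr_ge0; first lra.
  rewrite hY; nra.
lra.
Qed.

Lemma balanced_groups_neg (kap tau T Y m2 om2 Xt B : R) :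
  0 < kap -> kap <= 1 -> 0 < tau -> tau <= 4/3 -> 0 < m2 ->
  0 <= T -> T <= 2/3 * tau ^+ 2 -> om2 * (1 + 2 * kap) <= kap ^+ 2 * m2 ->
  Xt ^+ 2 <= om2 * T -> B <= tau / 2 - kap / 2 * tau * m2 ->
  Y <= tau ^+ 2 / 2 + T / 4 ->
  B + 2 * Xt - 2 * tau + (9/8) * (1 - kap) * Y + (1 - kap) * (Y - T) < 0.
Proof.
move=> k0 k1 tp t1 m0 T0 T1 ho hX hB hY.
apply: le_lt_trans (single_group_bound Y k0 k1 tp m0 T0 ho hX hB) _.
have Ta : T / tau <= 2/3 * tau by rewrite ler_pdivrMr //; move: T1; rewrite expr2; lra.
have Ta0 : 0 <= T / tau by rewrite divr_ge0 // ltW.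
have : 2 * kap * (T / tau) / (1 + 2 * kap) <= 2 * kap * (T / tau).
  rewrite ler_pdivrMr; last by lra.
  apply: ler_peMr; first by apply: mulr_ge0 => //; lra.
  lra.
have : kap * (T / tau) <= kap * (2/3 * tau) by rewrite ler_wpM2l // ltW.
have : (1 - kap) * Y <= (1 - kap) * (tau ^+ 2 / 2 + T / 4) by rewrite ler_wpM2l //; lra.
have : (1 - kap) * tau ^+ 2 <= (1 - kap) * (4/3 * tau).
  have : tau ^+ 2 <= 4/3 * tau by rewrite expr2 ler_wpM2r // ltW.
  move=> ?; rewrite ler_wpM2l //; lra.
have : 0 <= (1 - kap) * T by rewrite mulr_ge0 //; lra.
have : 0 < kap * tau by rewrite mulr_gt0.
lra.
Qed.

(* Together with [pipage_ineq] this excludes more than 2K ties. *)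
Lemma many_ties_neg (kap tau p0 PP chi U m2 zeta Xp Xt om2 Gb N T : R) :
  0 < kap -> kap <= 1 -> 0 < m2 -> 0 <= chi -> 0 <= p0 -> p0 <= PP ->
  0 <= T -> T <= tau ->
  (p0 + tau) * m2 - chi <= U -> zeta <= (p0 + tau - chi) + U / 4 ->
  om2 * (1 + 2 * kap) <= kap ^+ 2 * m2 ->  Xt ^+ 2 <= om2 * T ->
  N - tau <= zeta - Xp - Xt + om2 ->
  (4/3 <= tau) || ((7/10 <= tau) && (1 <= p0)) ->
  2 * Gb + 3/2 * p0 + 17/8 * tau - N <= 0 ->
  zeta + Xp + 2 * Xt + 2 * Gb + tau / 4 - (1 + kap) / 2 * (PP + 9 / 4 * tau + U) < 0.
Proof.
move=> k0 k1 m0 c0 p00 pp T0 Tt hU hz ho hX hB hc hN.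
have tp : 0 < tau by case/orP: hc => [|/andP[]]; lra.
have hk: 0 <= kap*(U - (p0 + tau) * m2 + chi) by apply: mulr_ge0; lra.
have hk1: 0 <= (2-kap)*chi by apply: mulr_ge0; lra.
have hk4 : 0 <= kap * (PP - p0) by rewrite mulr_ge0 //; lra.
have km : 0 < kap * m2 by rewrite mulr_gt0.
suff : Xt + om2 - (9/8) * kap * tau - kap / 2 * tau * m2 - kap / 2 * p0 - kap / 2 * p0 * m2 < 0 by lra.
have om3 : om2 <= kap * m2 / 3.
  have h3 : 0 < 1 + 2 * kap by lra.
  rewrite -(@ler_pM2r _ (1 + 2 * kap)) //; apply: le_trans ho _.
  have : 0 <= kap * m2 * (1 - kap) by apply: mulr_ge0; lra.
  lra.
have Ta : T / tau <= 1 by rewrite ler_pdivrMr //; lra.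
have := @noise_le 1 (1/4) kap tau T m2 om2 Xt k0 tp T0 (ltW m0).
move=> /(_ ltac:(lra) ltac:(lra) ho hX).
set z := (X in _ <= _ + X); have hz' : z <= kap.
  have -> : z = kap * (T / tau) / (1 + 2 * kap).
    by rewrite /z; field; rewrite !lt0r_neq0 //; lra.
  rewrite ler_pdivrMr; last by lra.
  have : kap * (T / tau) <= kap * 1 by rewrite ler_wpM2l // ltW.
  have : 0 < kap * kap by rewrite !mulr_gt0.
  lra.
move=> hn.
case/orP: hc => [h43|/andP[h7 h1]].
  have : 0 <= kap * m2 * (tau - 4/3) by rewrite mulr_ge0 //; lra.
  have : 0 <= kap * (tau - 4/3) by rewrite mulr_ge0 //; lra.
  have : 0 <= kap * m2 * p0 by rewrite mulr_ge0 //; lra.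
  have : 0 <= kap * p0 by rewrite mulr_ge0 //; lra.
  lra.
have : 0 <= kap * m2 * (tau - 7/10) by rewrite mulr_ge0 //; lra.
have : 0 <= kap * (tau - 7/10) by rewrite mulr_ge0 //; lra.
have : 0 <= kap * m2 * (p0 - 1) by rewrite mulr_ge0 //; lra.
have : 0 <= kap * (p0 - 1) by rewrite mulr_ge0 //; lra.
lra.
Qed.

(** The case [K = 1] with [P] empty. The last three inequalities are the stretched rounding to one
    tie, the bound [U] on the energy once all ties are deleted and only the index of [S] is left,
    and [|A v - (3/2) r|^2 >= 0] for [v = (2/3) lin th + (1/3) d]. *)
Lemma one_sparse_false (kap tau T U m2 zeta X om2 rho gain : R) :
  0 < kap -> kap <= 3/10 -> 7/10 <= tau -> tau <= 1 -> 0 <= U -> 0 <= m2 ->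
  0 <= T -> T <= tau ^+ 2 ->
  om2 * (1 + 2 * kap) <= kap ^+ 2 * m2 ->
  tau * m2 <= U + tau * (1 - tau) -> zeta ^+ 2 <= tau ^+ 2 * U ->
  rho + gain <= tau ^+ 2 -> gain <= (3 - kap) / 2 * (tau ^+ 2 - T) ->
  (1 + kap) / 2 * (9/4 * tau ^+ 2 + U) <=
     (T - tau + zeta + X) + (T - tau + X) + rho / 4 + 9/4 * gain ->
  (T - tau + zeta + X) - 2 * (T - tau + X) + rho <= U ->
  0 <= (4/9) * rho + (4/9) * (T - tau + X) + (1/9) * (T - tau + zeta + X) - 3 * X + (9/4) * om2 ->
  False.
Proof.
move=> k0 k1 t0 t1 U0 m0 T0 T1 ho hm hz ha hb h1 h2 h3.
(* [10 * h1 + 2 * h2 + 9 * h3]: with these multipliers the noise term [X] cancels, and [ha] and [hb]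
   remove [rho] and [gain]. *)
have e1 : 0 <= (20 + 1/4) * (1 - kap) * tau ^+ 2 - 27 * tau + 9 * zeta - (3 + 5 * kap) * U
   + 9 * kap * T + (20 + 1/4) * om2 by lra.
have l0 : 0 < 3 - kap / 2 by lra.
have e2 : 9 * zeta <= (3 - kap / 2) * U + (27/4 + 13/10 * kap) * tau ^+ 2.
  apply: le_amgm; [by apply: mulr_ge0; lra|by apply: mulr_ge0; [lra|apply: sqr_ge0]|].
  rewrite exprMn; apply: (@le_trans _ _ (81 * (tau ^+ 2 * U))); first by lra.
  have : 0 <= tau ^+ 2 * U by rewrite mulr_ge0 ?sqr_ge0.
  have : 0 <= (4 * (3 - kap / 2) * (27/4 + 13/10 * kap) - 81) by nra.
  move=> a b; have := mulr_ge0 a b; lra.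
have e3 : om2 <= (3/16) * kap * m2.
  have h : 0 < 1 + 2 * kap by lra.
  rewrite -(@ler_pM2r _ (1 + 2 * kap)) //; apply: le_trans ho _.
  have : 0 <= kap * m2 * (3/10 - kap) by rewrite ?mulr_ge0 //; lra.
  lra.
have e4 : 0 <= kap * (tau - 7/10) * m2 by rewrite ?mulr_ge0 //; lra.
have e5 : 0 <= kap * (U + tau * (1 - tau) - tau * m2) by rewrite ?mulr_ge0 //; lra.
have e6 : 0 <= kap * (tau ^+ 2 - T) by rewrite ?mulr_ge0 //; lra.
have e7 : 0 < kap * tau ^+ 2 by rewrite mulr_gt0 // exprn_gt0 //; lra.
have e8 : 0 <= (3/10 - kap) * (tau * (1 - tau)) by rewrite ?mulr_ge0 //; lra.
have e9 : 0 <= tau * (1 - tau) by rewrite ?mulr_ge0 //; lra.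
have e10 : 0 <= kap * U by rewrite ?mulr_ge0 //; lra.
lra.
Qed.

(** [(3 * tau - 1) / 4] is the multiple of [kap * m2] left over in [room_one_false]. The factor
    [1 - tau / 2] is chosen because [tau ^+ 2 <= (3 * tau - 1) * (1 - tau / 2)] on [[7/10, 1]]. *)
Lemma room_one_noise (kap tau T m2 om2 Xt p : R) :
  0 < kap -> 7/10 <= tau -> tau <= 1 -> 0 <= m2 -> 0 <= p ->
  om2 * (1 + 2 * kap) <= kap ^+ 2 * m2 -> Xt ^+ 2 <= om2 * T -> T = p * tau ^+ 2 ->
  5/2 * Xt <= (3 * tau - 1) / 4 * kap * m2 + 25/4 * (25/36 * kap + 1/72) * p * (1 - tau / 2).
Proof.
move=> k0 t0 t1 m0 p0 ho hX TE.
have km : 0 <= kap * m2 by rewrite mulr_ge0 // ltW.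
(* The tangent at [kap = 1/10] of the concave function [kap / (1 + 2 * kap)]; it makes the noise
   bound affine in [kap]. *)
have om3 : om2 <= kap * m2 * (25/36 * kap + 1/72).
  have h : 0 < 1 + 2 * kap by lra.
  rewrite -(@ler_pM2r _ (1 + 2 * kap)) //; apply: le_trans ho _.
  have : 0 <= kap * m2 * (1 - 10 * kap) ^+ 2 by rewrite mulr_ge0 // sqr_ge0.
  lra.
apply: le_amgm.
- by rewrite -mulrA mulr_ge0 //; lra.
- by apply: mulr_ge0; [apply: mulr_ge0 => //; lra|lra].
have -> : (5/2 * Xt) ^+ 2 = 25/4 * Xt ^+ 2 by field.
apply: (@le_trans _ _ (25/4 * (kap * m2 * (25/36 * kap + 1/72) * T))).
  rewrite ler_wpM2l //; first lra.
  by apply: le_trans hX _; rewrite ler_wpM2r // TE mulr_ge0 // sqr_ge0.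
have -> : 4 * ((3 * tau - 1) / 4 * kap * m2) * (25 / 4 * (25/36 * kap + 1/72) * p * (1 - tau / 2)) =
   25/4 * (kap * m2 * (25/36 * kap + 1/72) * (p * ((3 * tau - 1) * (1 - tau / 2)))) by field.
rewrite TE ler_wpM2l //; first lra.
rewrite ler_wpM2l //; first by rewrite mulr_ge0 //; lra.
rewrite ler_wpM2l //.
have : 0 <= (1 - tau) * (3/2 * tau - 1) by rewrite mulr_ge0 //; lra.
have : 0 <= tau * (1 - tau) by rewrite mulr_ge0 //; lra.
lra.
Qed.

(* affine in [kap] and in [p]: only the four corners matter *)
Lemma room_one_poly_neg (kap tau p : R) :
  0 <= kap -> kap <= 3/10 -> 7/10 <= tau -> tau <= 1 -> 0 <= p -> p <= 2/3 ->
  2 * (p * tau ^+ 2) - 2 * tau + tau ^+ 2 / 4 + 35/32 * (tau ^+ 2 - (1 + kap) / 2 * (p * tau ^+ 2))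
    + 29/64 * (3 - kap) * (tau ^+ 2 - p * tau ^+ 2) - 9/8 * (1 + kap) * tau ^+ 2
    + (p * tau ^+ 2 - tau - (3 - kap) / 2 * (p * tau ^+ 2) + (1 - kap) * (tau ^+ 2 / 2 + 5/16 * (p * tau ^+ 2))) / 2
    + 2/3 * tau - 1/12 + 25/4 * (25/36 * kap + 1/72) * p * (1 - tau / 2) < 0.
Proof.
move=> k0 k1 t0 t1 p0 p1.
pose f (k q : R) := 2 * (q * tau ^+ 2) - 2 * tau + tau ^+ 2 / 4 + 35/32 * (tau ^+ 2 - (1 + k) / 2 * (q * tau ^+ 2))
    + 29/64 * (3 - k) * (tau ^+ 2 - q * tau ^+ 2) - 9/8 * (1 + k) * tau ^+ 2
    + (q * tau ^+ 2 - tau - (3 - k) / 2 * (q * tau ^+ 2) + (1 - k) * (tau ^+ 2 / 2 + 5/16 * (q * tau ^+ 2))) / 2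
    + 2/3 * tau - 1/12 + 25/4 * (25/36 * k + 1/72) * q * (1 - tau / 2).
rewrite -[X in X < 0]/(f kap p).
have fE : f kap p / 5 = (3/10 - kap) * (2/3 - p) * f 0 0 + (3/10 - kap) * p * f 0 (2/3)
   + kap * (2/3 - p) * f (3/10) 0 + kap * p * f (3/10) (2/3).
  by rewrite /f; field.
have [f00 f01 f10 f11] : [/\ f 0 0 < - (1/100), f 0 (2/3) < - (1/100), f (3/10) 0 < - (1/100) & f (3/10) (2/3) < - (1/100)].
  have t2 : 0 <= (1 - tau) * (tau - 7/10) by rewrite mulr_ge0 //; lra.
  have t3 : 0 <= (1 - tau) ^+ 2 by rewrite sqr_ge0.
  by split; rewrite /f; clear fE f; lra.
move: fE f00 f01 f10 f11; clearbody f; clear t0 t1.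
move: (f kap p) (f 0 0) (f 0 (2/3)) (f (3/10) 0) (f (3/10) (2/3)) => F a b c d FE ha hb hc hd.
have ca : (3/10 - kap) * (2/3 - p) * a <= (3/10 - kap) * (2/3 - p) * - (1/100).
  by rewrite ler_wpM2l ?(ltW ha) // mulr_ge0; lra.
have cb : (3/10 - kap) * p * b <= (3/10 - kap) * p * - (1/100).
  by rewrite ler_wpM2l ?(ltW hb) // mulr_ge0; lra.
have pair_weight : kap * (2/3 - p) * c <= kap * (2/3 - p) * - (1/100).
  by rewrite ler_wpM2l ?(ltW hc) // mulr_ge0; lra.
have cd : kap * p * d <= kap * p * - (1/100).
  by rewrite ler_wpM2l ?(ltW hd) // mulr_ge0; lra.
lra.
Qed.

(** Here [n] is [p0]. The last two inequalities are the stretched rounding to one tie, and the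
    rounding to two ties with one coordinate of [S \ P] deleted, summed over the [n + 1] choices of
    that coordinate. *)
Lemma room_one_false (n kap tau T U m2 zeta chi Xp Xt PP om2 rho gain gain2 Y : R) :
  1 <= n -> 0 < kap -> kap <= 3/10 -> 7/10 <= tau -> tau <= 1 -> 0 <= m2 ->
  0 <= T -> T <= 2/3 * tau ^+ 2 ->
  om2 * (1 + 2 * kap) <= kap ^+ 2 * m2 -> Xt ^+ 2 <= om2 * T ->
  0 <= chi -> n <= PP -> (n + tau) * m2 - chi <= U ->
  zeta ^+ 2 <= (n + tau - chi) * U -> 0 <= n + tau - chi -> 0 <= U ->
  Xp <= kap / 2 * (PP + n * m2) ->
  rho + gain <= tau ^+ 2 -> gain <= (3 - kap) / 2 * (tau ^+ 2 - T) ->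
  (1 + kap) / 2 * T <= rho ->
  gain2 <= (3 - kap) / 2 * (Y - T) -> Y <= tau ^+ 2 / 2 + 5/16 * T ->
  (1 + kap) / 2 * (PP + 9/4 * tau ^+ 2 + U) <=
     (T - tau + zeta + Xp + Xt) + (T - tau + Xt) + rho / 4 + 9/4 * gain ->
  (1 + kap) / 2 * ((n + 1) * (PP + Y + U) - U) <=
     (n + 1) * (T - tau + zeta + Xp + Xt + gain2) - 2 * zeta + U ->
  False.
Proof.
move=> n1 k0 k1 t0 t1 m0 T0 T1 ho hX c0 hP hU hz hc U0 hXp ha hb hr hg hY h1 h2.
have np : 0 < n + 1 by lra.
set i := (n + 1)^-1.
have i0 : 0 < i by rewrite invr_gt0.
have iE : i * (n + 1) = 1 by rewrite mulVf // lt0r_neq0.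
have i1 : i <= 1/2 by rewrite /i -(@ler_pM2r _ (n + 1)) // iE; lra.
clearbody i.
have {}h2 : (1 + kap) / 2 * (PP + Y + U - i * U) <= T - tau + zeta + Xp + Xt + gain2 - 2 * (i * zeta) + i * U.
  rewrite -(@ler_pM2r _ (n + 1)) //.
  have -> : (1 + kap) / 2 * (PP + Y + U - i * U) * (n + 1) = (1 + kap) / 2 * ((n + 1) * (PP + Y + U) - (i * (n + 1)) * U) by ring.
  have -> : (T - tau + zeta + Xp + Xt + gain2 - 2 * (i * zeta) + i * U) * (n + 1) =
    (n + 1) * (T - tau + zeta + Xp + Xt + gain2) - 2 * (i * (n + 1) * zeta) + i * (n + 1) * U by ring.
  by rewrite iE !mul1r.
(* [h1] plus half of [h2]. Of the [9/4] of [gain], [1/4] goes with [rho / 4] into [ha], [35/32] is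
   bounded by [ha] and [hr], and [29/32] by [hb]. *)
have e1 : 0 <= 2 * T - 2 * tau + tau ^+ 2 / 4 + 35/32 * (tau ^+ 2 - (1 + kap) / 2 * T)
    + 29/64 * (3 - kap) * (tau ^+ 2 - T) - 9/8 * (1 + kap) * tau ^+ 2
    + (T - tau + (3 - kap) / 2 * (Y - T) - (1 + kap) / 2 * Y) / 2
    + 3/2 * Xp + 5/2 * Xt + (3/2 - i) * zeta - 3/4 * (1 + kap) * PP
    - 3/4 * (1 + kap) * U + (3 + kap) / 4 * (i * U) by lra.
(* The coefficient of [U] is [- (3/4 - 3/4 * i) - (3/4 - i / 4) * kap]: the first part pays for
   [zeta] here, the second buys [m2] in [e3]. *)
have e2 : (3/2 - i) * zeta <= (3/4 - 3/4 * i) * U + (2/3 * (tau - chi) - 1/12 + 3/4 * n).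
  have E1 : 3/2 - i = i * (3 * n + 1) / 2 by move: iE; lra.
  have E2 : 3/4 - 3/4 * i = 3/4 * (i * n) by move: iE; lra.
  have B0 : 0 <= 2/3 * (tau - chi) - 1/12 + 3/4 * n by lra.
  have i00 := ltW i0.
  rewrite E1 E2; apply: le_amgm => //; first by rewrite ?mulr_ge0 //; lra.
  have -> : (i * (3 * n + 1) / 2 * zeta) ^+ 2 = i ^+ 2 / 4 * ((3 * n + 1) ^+ 2 * zeta ^+ 2) by field.
  have -> : 4 * (3 / 4 * (i * n) * U) * (2 / 3 * (tau - chi) - 1 / 12 + 3 / 4 * n) =
    i ^+ 2 / 4 * (n * (n + 1) * (8 * (tau - chi) - 1 + 9 * n) * U).
    transitivity (i * (i * (n + 1)) / 4 * (n * (8 * (tau - chi) - 1 + 9 * n) * U)).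
      by rewrite iE; field.
    by field.
  apply: ler_wpM2l; first by rewrite divr_ge0 ?sqr_ge0.
  apply: (@le_trans _ _ ((3 * n + 1) ^+ 2 * ((n + tau - chi) * U))).
    by rewrite ler_wpM2l // sqr_ge0.
  rewrite mulrA ler_wpM2r // -subr_ge0.
  have : 0 <= 2 * n * (n - 1) - (tau - chi) * (n - 1) ^+ 2.
    have h : 0 <= (n - 1) * (n - 1) * (1 - (tau - chi)) by rewrite ?mulr_ge0 //; lra.
    have h' : 0 <= (n - 1) * (n + 1) by rewrite ?mulr_ge0 //; lra.
    lra.
  lra.
have e3 : 0 <= (3/4 - i / 4) * kap * (U - (n + tau) * m2 + chi).
  rewrite !mulr_ge0 //; lra.
set p := T / tau ^+ 2.
have tp : 0 < tau by lra.
have TE : T = p * tau ^+ 2 by rewrite /p divfK // expf_neq0 // lt0r_neq0.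
have p0 : 0 <= p by rewrite /p divr_ge0 // sqr_ge0.
have p1 : p <= 2/3 by rewrite /p ler_pdivrMr // exprn_gt0.
have e4 : 5/2 * Xt <= (3 * tau - 1) / 4 * kap * m2 + 25/4 * (25/36 * kap + 1/72) * p * (1 - tau / 2).
  exact: (room_one_noise k0 t0 t1 m0 p0 ho hX TE).
have e5 : 0 <= kap * m2 * (i * (1 - tau)) by rewrite ?mulr_ge0 //; lra.
have e6 : 0 <= (2/3 - (3/4 - i / 4) * kap) * chi.
  rewrite mulr_ge0 //.
  have : (3/4 - i / 4) * kap <= 1 * (3/10) by apply: ler_pM; lra.
  lra.
have e7 : 0 <= (1 - kap) * (tau ^+ 2 / 2 + 5/16 * T - Y) by rewrite mulr_ge0 //; lra.
have e8 : kap * m2 * (i * (n + 1)) = kap * m2 by rewrite iE mulr1.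
have e9 : 0 <= 2 * T - 2 * tau + tau ^+ 2 / 4 + 35/32 * (tau ^+ 2 - (1 + kap) / 2 * T)
    + 29/64 * (3 - kap) * (tau ^+ 2 - T) - 9/8 * (1 + kap) * tau ^+ 2
    + (T - tau - (3 - kap) / 2 * T + (1 - kap) * (tau ^+ 2 / 2 + 5/16 * T)) / 2
    + 2/3 * tau - 1/12 + 25/4 * (25/36 * kap + 1/72) * p * (1 - tau / 2) by lra.
have := room_one_poly_neg (ltW k0) k1 t0 t1 p0 p1.
rewrite -TE; lra.
Qed.
End Scalar.

(** * Pipage rounding *)

Section Pipage.
Variables (R : realFieldType) (N : nat).
Implicit Types (y l : 'I_N -> R) (C : 'I_N -> 'I_N -> R).

Definition quad l C y := \sum_i l i * y i + \sum_i \sum_(j | j != i) C i j * y i * y j.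
Definition frac y := [set i | (0 < y i) && (y i < 1)].
Definition shift y (i j : 'I_N) (t : R) := fun x => y x + t * ((x == i)%:R - (x == j)%:R).

Lemma sum_shift (F : 'I_N -> R) i j : \sum_x F x * ((x == i)%:R - (x == j)%:R) = F i - F j.
Proof.
under eq_bigr do rewrite mulrBr.
rewrite sumrB (bigD1 i) //= eqxx mulr1 big1 ?addr0; last by move=> x /negPf->; rewrite mulr0.
by congr (_ - _); rewrite (bigD1 j) //= eqxx mulr1 big1 ?addr0 // => x /negPf->; rewrite mulr0.
Qed.

Lemma sum_shift0 (i j : 'I_N) : \sum_x ((x == i)%:R - (x == j)%:R : R) = 0.
Proof.
rewrite -[RHS](subrr 1) -(sum_shift (fun=> 1) i j).
by apply: eq_bigr => x _; rewrite mul1r.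
Qed.

Lemma sum_two (F : 'I_N -> R) i j : i != j ->
  (forall x, x != i -> x != j -> F x = 0) -> \sum_x F x = F i + F j.
Proof.
move=> ij F0; rewrite (bigD1 i) //=; congr (_ + _).
by rewrite (bigD1 j) 1?eq_sym //= big1 ?addr0 // => x /andP[]; apply: F0.
Qed.

Lemma quad_shift l C y i j : (forall a b, C a b = C b a) -> i != j ->
  exists b, forall t, quad l C (shift y i j t) = quad l C y + b * t - 2 * C i j * t ^+ 2.
Proof.
move=> Cs ij; pose s x : R := (x == i)%:R - (x == j)%:R.
exists ((l i - l j) + \sum_x \sum_(z | z != x) C x z * (y x * s z + s x * y z)) => t.
rewrite /quad /shift.
have -> : \sum_x l x * (y x + t * s x) = \sum_x l x * y x + (l i - l j) * t.
  rewrite -(sum_shift l) mulr_suml -big_split /=; apply: eq_bigr => x _; rewrite /s; ring.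
have -> : \sum_x \sum_(z | z != x) C x z * (y x + t * s x) * (y z + t * s z) =
   \sum_x \sum_(z | z != x) C x z * y x * y z
   + (\sum_x \sum_(z | z != x) C x z * (y x * s z + s x * y z)) * t
   + (\sum_x \sum_(z | z != x) C x z * (s x * s z)) * t ^+ 2.
  rewrite !mulr_suml -!big_split; apply: eq_bigr => x _.
  rewrite !mulr_suml -!big_split; apply: eq_bigr => z _ /=; ring.
have -> : \sum_x \sum_(z | z != x) C x z * (s x * s z) = - 2 * C i j.
  have sz x : x != i -> x != j -> s x = 0 by move=> /negPf a /negPf b; rewrite /s a b subrr.
  have si : s i = 1 by rewrite /s eqxx (negPf ij) subr0.
  have sj : s j = -1 by rewrite /s eqxx eq_sym (negPf ij) sub0r.
  rewrite (sum_two ij); last first.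
    by move=> x xi xj; rewrite big1 // => z _; rewrite sz // mul0r mulr0.
  rewrite (bigD1 j) 1?eq_sym //= big1 ?addr0; last first.
    by move=> x /andP[xi xj]; rewrite (sz x) // !mulr0.
  rewrite (bigD1 i) //= big1 ?addr0; last first.
    by move=> x /andP[xj xi]; rewrite (sz x) // !mulr0.
  by rewrite si sj (Cs j i); ring.
ring.
Qed.

(* [quad] is concave along [e_i - e_j], so mass can be moved between two fractional
   coordinates until one of them becomes 0 or 1. *)
Lemma pipage l C y (tau : R) : (forall a b, C a b = C b a) -> (forall a b, a != b -> 0 <= C a b) ->
  (forall i, 0 <= y i <= 1) -> \sum_i y i = tau ->
  exists z, [/\ forall i, 0 <= z i <= 1, \sum_i z i = tau, (#|frac z| <= 1)%N & quad l C z <= quad l C y].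
Proof.
move=> Cs C0; have [m] := ubnP #|frac y|; elim: m y => // m IHm y ltm y01 sy.
have [?|] := leqP #|frac y| 1; first by exists y.
case/card_gt1P => i [j [fi fj ij]].
move: fi fj; rewrite !inE => /andP[i0 i1] /andP[j0 j1].
have [b hb] := @quad_shift l C y i j Cs ij.
(* The sign of [t] makes the linear term nonpositive; its size is the first at which one of the two
   coordinates reaches 0 or 1. *)
have [t [tq t01 tf]] : exists t, [/\ b * t <= 0, (0 <= y i + t <= 1) && (0 <= y j - t <= 1) &
     [|| y i + t == 0, y i + t == 1, y j - t == 0 | y j - t == 1]].
  have [b0|b0] := lerP b 0.
    have [h|h] := leP (1 - y i) (y j).
      exists (1 - y i); split; [|lra|].
        by rewrite mulr_le0_ge0 //; lra.
      by apply/or4P; apply: Or42; apply/eqP; lra.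
    exists (y j); split; [|lra|].
      by rewrite mulr_le0_ge0 //; lra.
    by apply/or4P; apply: Or43; apply/eqP; lra.
  have [h|h] := leP (1 - y j) (y i).
    exists (y j - 1); split; [|lra|].
      by rewrite mulr_ge0_le0 //; lra.
    by apply/or4P; apply: Or44; apply/eqP; lra.
  exists (- y i); split; [|lra|].
    by rewrite mulr_ge0_le0 //; lra.
  by apply/or4P; apply: Or41; apply/eqP; lra.
have [tqi tqj] : y i + t = shift y i j t i /\ y j - t = shift y i j t j.
  by rewrite /shift !eqxx [j == i]eq_sym (negPf ij) subr0 sub0r mulr1 mulrN1.
have so x : x != i -> x != j -> shift y i j t x = y x.
  by move=> /negPf a /negPf c; rewrite /shift a c subrr mulr0 addr0.
have /IHm : (#|frac (shift y i j t)| < m)%N.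
  rewrite -ltnS (leq_trans _ ltm) // ltnS; apply: proper_card; apply/properP; split.
    apply/subsetP => x; rewrite !inE.
    have [->|xi] := eqVneq x i; first by rewrite i0 i1.
    have [->|xj] := eqVneq x j; first by rewrite j0 j1.
    by rewrite so.
  case/or4P: tf => /eqP h; [exists i|exists i|exists j|exists j]; rewrite !inE ?i0 ?i1 ?j0 ?j1 // -?tqi -?tqj h ?ltxx ?andbF //.
case=> [x||z [z01 sz fz qz]].
- have [->|xi] := eqVneq x i; first by rewrite -tqi; case/andP: t01.
  have [->|xj] := eqVneq x j; first by rewrite -tqj; case/andP: t01.
  by rewrite so.
- rewrite /shift big_split /= sy -mulr_sumr.
  by rewrite sum_shift0 mulr0 addr0.
exists z; split=> //; apply: le_trans qz _; rewrite hb.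
have := C0 i j ij => c0; have := mulr_ge0 c0 (sqr_ge0 t); lra.
Qed.
End Pipage.

(** * Semidefinite forms and the rounding of a group to one tie *)

Section Form.
Variables (R : realFieldType) (W : lmodType R) (g : W -> W -> R).
Hypothesis gC : forall x y, g x y = g y x.
Hypothesis gD : forall x y z, g (x + y) z = g x z + g y z.
Hypothesis gZ : forall a x z, g (a *: x) z = a * g x z.
Hypothesis g_ge0 : forall x, 0 <= g x x.

Lemma gDr x y z : g x (y + z) = g x y + g x z.
Proof. by rewrite gC gD ![g _ x]gC. Qed.
Lemma gZr a x z : g x (a *: z) = a * g x z.
Proof. by rewrite gC gZ gC. Qed.
Lemma g0l z : g 0 z = 0.
Proof. by rewrite -(scale0r 0) gZ mul0r. Qed.
Lemma gNl x z : g (- x) z = - g x z.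
Proof. by rewrite -scaleN1r gZ mulN1r. Qed.
Lemma gNr x z : g x (- z) = - g x z.
Proof. by rewrite gC gNl gC. Qed.
Lemma g_suml (I : Type) (r : seq I) (P : pred I) (F : I -> W) z :
  g (\sum_(i <- r | P i) F i) z = \sum_(i <- r | P i) g (F i) z.
Proof. by elim/big_rec2: _ => [|i a b _ <-]; rewrite ?g0l // gD. Qed.
Lemma g_sumr (I : Type) (r : seq I) (P : pred I) (F : I -> W) z :
  g z (\sum_(i <- r | P i) F i) = \sum_(i <- r | P i) g z (F i).
Proof. by rewrite gC g_suml; apply: eq_bigr => i _; rewrite gC. Qed.

Definition sqn v := g v v.
Lemma nqD x y : sqn (x + y) = sqn x + 2 * g x y + sqn y.
Proof. rewrite /sqn gD !gDr (gC y x); ring. Qed.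
Lemma nqZ a x : sqn (a *: x) = a ^+ 2 * sqn x.
Proof. by rewrite /sqn gZ gZr mulrA. Qed.
Lemma nqB x y : sqn (x - y) = sqn x - 2 * g x y + sqn y.
Proof. by rewrite nqD gNr /sqn gNl gNr opprK mulrN. Qed.

Variables (N : nat) (e : 'I_N -> W).
Definition lincomb (c : 'I_N -> R) := \sum_i c i *: e i.

Lemma g_lin c z : g z (lincomb c) = \sum_i c i * g z (e i).
Proof. by rewrite g_sumr; apply: eq_bigr => i _; rewrite gZr. Qed.
Lemma nq_lin c : sqn (lincomb c) = \sum_i \sum_j c i * c j * g (e i) (e j).
Proof.
rewrite /sqn g_suml; apply: eq_bigr => i _; rewrite gZ g_lin mulr_sumr.
by apply: eq_bigr => j _; rewrite mulrA.
Qed.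
Lemma linZ a c : lincomb (fun i => a * c i) = a *: lincomb c.
Proof. by rewrite /lincomb scaler_sumr; apply: eq_bigr => i _; rewrite scalerA. Qed.
Lemma linB a c : lincomb (fun i => a i - c i) = lincomb a - lincomb c.
Proof. by rewrite /lincomb -sumrB; apply: eq_bigr => i _; rewrite scalerBl. Qed.
Lemma linD a c : lincomb (fun i => a i + c i) = lincomb a + lincomb c.
Proof. by rewrite /lincomb -big_split; apply: eq_bigr => i _; rewrite scalerDl. Qed.
Lemma eq_lin a c : a =1 c -> lincomb a = lincomb c.
Proof. by move=> h; apply: eq_bigr => i _; rewrite h. Qed.
Lemma lin1 i : lincomb (fun j => (j == i)%:R) = e i.
Proof.
rewrite /lincomb (bigD1 i) //= eqxx scale1r big1 ?addr0 // => j /negPf->.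
by rewrite scale0r.
Qed.

Section Group.
Variables (B : {set 'I_N}) (th : 'I_N -> R).
Hypothesis th0 : forall i, i \in B -> 0 < th i.
Let gam := \sum_(i in B) th i.
Let sq := \sum_(i in B) th i ^+ 2.
Definition linG := \sum_(i in B) th i *: e i.
(** [gam ^+ 2] times the variance of [e i] when [i] is drawn from [B] with probability
    [th i / gam]. *)
Definition gain := gam * (\sum_(i in B) th i * sqn (e i)) - sqn linG.

Lemma gainE : gain = 1/2 * \sum_(i in B) \sum_(j in B) th i * th j * sqn (e i - e j).
Proof.
have E i j : th i * th j * sqn (e i - e j) =
  th j * (th i * sqn (e i)) + th i * (th j * sqn (e j)) - 2 * (th i * th j * g (e i) (e j)).
  rewrite nqB; ring.
have S1 : \sum_(i in B) \sum_(j in B) th j * (th i * sqn (e i)) = gam * (\sum_(i in B) th i * sqn (e i)).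
  by rewrite mulr_sumr; apply: eq_bigr => i _; rewrite mulr_suml.
have S2 : \sum_(i in B) \sum_(j in B) th i * (th j * sqn (e j)) = gam * (\sum_(i in B) th i * sqn (e i)).
  by rewrite mulr_suml; apply: eq_bigr => i _; rewrite mulr_sumr.
have S3 : \sum_(i in B) \sum_(j in B) 2 * (th i * th j * g (e i) (e j)) = 2 * sqn linG.
  rewrite /sqn /linG g_suml mulr_sumr; apply: eq_bigr => i _.
  rewrite g_sumr mulr_sumr; apply: eq_bigr => j _; rewrite gZ gZr; ring.
transitivity (1/2 * (gam * (\sum_(i in B) th i * sqn (e i)) + gam * (\sum_(i in B) th i * sqn (e i)) - 2 * sqn linG)).
  by rewrite /gain; field.
apply: (congr1 (fun z => 1/2 * z)); rewrite -{1}S1 -S2 -S3 -big_split -sumrB; apply: eq_bigr => i _.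
by rewrite -big_split -sumrB; apply: eq_bigr => j _; rewrite E.
Qed.

(** A variance is half the mean squared distance of two independent draws, and only draws with
    [i != j] contribute. *)
Lemma gain_le c : (forall i j, i \in B -> j \in B -> i != j -> sqn (e i - e j) <= c) ->
  gain <= c / 2 * (gam ^+ 2 - sq).
Proof.
move=> hc.
have -> : gam ^+ 2 - sq = \sum_(i in B) \sum_(j in B | j != i) th i * th j.
  rewrite expr2 mulr_suml -sumrB; apply: eq_bigr => i iB.
  by rewrite mulr_sumr (bigD1 i) //= expr2 addrC addrK.
rewrite gainE.
suff : \sum_(i in B) \sum_(j in B) th i * th j * sqn (e i - e j) <=
       c * (\sum_(i in B) \sum_(j in B | j != i) th i * th j) by lra.
rewrite mulr_sumr; apply: ler_sum => i iB; rewrite (bigD1 i) //= subrr [sqn 0]g0l mulr0 add0r.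
rewrite mulr_sumr; apply: ler_sum => j /andP[jB ji]; rewrite [c * _]mulrC.
apply: ler_wpM2l; last by rewrite hc // eq_sym.
by rewrite mulr_ge0 // ltW // th0.
Qed.

Lemma gain_nq : (forall i, i \in B -> sqn (e i) <= 1) -> sqn linG + gain <= gam ^+ 2.
Proof.
move=> h; rewrite /gain addrC subrK expr2 ler_wpM2l //.
  by apply: sumr_ge0 => i /th0/ltW.
by apply: ler_sum => i iB; rewrite ler_piMr ?h // ltW // th0.
Qed.

(** For [i] drawn with probability [th i / gam] the right side is the mean of the left side, so some
    [i] does not exceed it. *)
Lemma round1 b0 s : 0 < gam ->
  exists2 i, i \in B & sqn (b0 + (s * gam) *: e i) <= sqn (b0 + s *: linG) + s ^+ 2 * gain.
Proof.
move=> g0; pose X := sqn (b0 + s *: linG) + s ^+ 2 * gain; rewrite -/X.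
have [/existsP[i /andP[iB h]]|/existsPn h] := boolP [exists i, (i \in B) && (sqn (b0 + (s * gam) *: e i) <= X)].
  by exists i.
have E : \sum_(i in B) th i * (sqn (b0 + (s * gam) *: e i) - X) = 0.
  have -> : \sum_(i in B) th i * (sqn (b0 + (s * gam) *: e i) - X) =
     gam * (sqn b0 - X) + 2 * s * gam * g b0 linG + s ^+ 2 * gam ^+ 2 * \sum_(i in B) th i * sqn (e i).
    have -> : gam * (sqn b0 - X) = \sum_(i in B) th i * (sqn b0 - X) by rewrite mulr_suml.
    have -> : g b0 linG = \sum_(i in B) th i * g b0 (e i).
      by rewrite g_sumr; apply: eq_bigr => i _; rewrite gZr.
    rewrite [2 * s * gam * _]mulr_sumr [s ^+ 2 * gam ^+ 2 * _]mulr_sumr -!big_split; apply: eq_bigr => i _ /=.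
    rewrite nqD nqZ !gZr; ring.
  rewrite /X /gain nqD nqZ gZr; ring.
have Bn : exists i, i \in B.
  apply/existsP; apply: contraLR g0 => /existsPn h'.
  by rewrite /gam big_pred0 ?ltxx // => i; apply/negbTE.
case: Bn => i0 i0B.
suff : 0 < \sum_(i in B) th i * (sqn (b0 + (s * gam) *: e i) - X) by rewrite E ltxx.
have pos i : i \in B -> 0 < th i * (sqn (b0 + (s * gam) *: e i) - X).
  move=> iB; rewrite mulr_gt0 ?th0 // subr_gt0 ltNge.
  by have := h i; rewrite iB.
rewrite (bigD1 i0) //= ltr_wpDr ?pos // sumr_ge0 // => i /andP[iB _]; exact/ltW/pos.
Qed.
End Group.

(** * Consequences of the second-order condition *)

Section Second.
Variables (th : 'I_N -> R) (kap : R).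
Hypothesis th01 : forall i, 0 <= th i <= 1.
Hypothesis so : forall c, \sum_i c i = 0 -> \sum_i c i ^+ 2 <= sqn (lincomb c).
Hypothesis ne1 : forall i, sqn (e i) <= 1.
Hypothesis ne0 : forall i, (1 + kap) / 2 <= sqn (e i).
Let tau := \sum_i th i.
Let T := \sum_i th i ^+ 2.
Let one := lincomb (fun=> 1).

(** Testing the second-order condition with the difference of two unit coordinates gives
    [|e_i - e_j|^2 >= 2], while both vectors have length at most 1. Hence for [y >= 0] the cross
    terms of [sqn (lincomb y)] only lower it. *)
Lemma second_pair i j : i != j -> g (e i) (e j) <= 0.
Proof.
move=> ij; have := so (c := fun x => (x == i)%:R - (x == j)%:R).
rewrite sum_shift0 => /(_ erefl); rewrite linB !lin1 nqB.
have -> : \sum_x ((x == i)%:R - (x == j)%:R : R) ^+ 2 = 2.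
  rewrite (sum_two ij); last by move=> x /negPf-> /negPf->; rewrite subrr expr0n.
  by rewrite !eqxx (negPf ij) [j == i]eq_sym (negPf ij) subr0 sub0r sqrrN expr1n.
by have := ne1 i; have := ne1 j; lra.
Qed.

Lemma nq_le_diag y : (forall i, 0 <= y i) -> sqn (lincomb y) <= \sum_i y i ^+ 2 * sqn (e i).
Proof.
move=> y0; rewrite nq_lin; apply: ler_sum => i _.
rewrite (bigD1 i) //= -expr2 gerDl sumr_le0 // => j ji.
by rewrite mulr_ge0_le0 ?mulr_ge0 // second_pair // eq_sym.
Qed.

Lemma nq_le_sq y : (forall i, 0 <= y i) -> sqn (lincomb y) <= \sum_i y i ^+ 2.
Proof.
move=> y0; apply: le_trans (nq_le_diag y0) _.
by apply: ler_sum => i _; rewrite ler_piMr // sqr_ge0.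
Qed.

Hypothesis N0 : (0 < N)%N.
Hypothesis kap0 : 0 <= kap.

Lemma one_vecE (c : 'I_N -> R) a : lincomb (fun x => c x - a) = lincomb c - a *: one.
Proof. by rewrite linB; congr (_ - _); rewrite /one -linZ; apply: eq_lin => i; rewrite mulr1. Qed.

(* The second-order condition applied to e_i + e_j - (2/N) 1 gives
   pair_weight i + pair_weight j + <e_i, e_j> >= 0. *)
Definition pair_weight i := (sqn (e i) - 1) / 2 + N%:R^-1 - 2 * g one (e i) / N%:R + sqn one / N%:R ^+ 2.
Let Nn : N%:R != 0 :> R. Proof. by rewrite pnatr_eq0 -lt0n. Qed.

Let sum_const (a : R) : \sum_(i < N) a = N%:R * a.
Proof. by rewrite sumr_const card_ord mulr_natl. Qed.

Lemma pair_weight_pair i j : i != j -> 0 <= pair_weight i + pair_weight j + g (e i) (e j).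
Proof.
move=> ij; pose c x : R := (x == i)%:R + (x == j)%:R.
have sc F : \sum_x F x * c x = F i + F j.
  rewrite (sum_two ij); last by move=> x /negPf xi /negPf xj; rewrite /c xi xj addr0 mulr0.
  by rewrite /c !eqxx (negPf ij) [j == i]eq_sym (negPf ij) addr0 add0r !mulr1.
have s1 : \sum_x c x = 2.
  by rewrite -[2]/(1 + 1) -(sc (fun=> 1)); apply: eq_bigr => x _; rewrite mul1r.
have s2 : \sum_x c x ^+ 2 = 2.
  have ci : c i = 1 by rewrite /c eqxx (negPf ij) addr0.
  have cj : c j = 1 by rewrite /c eqxx [j == i]eq_sym (negPf ij) add0r.
  by under eq_bigr do rewrite expr2; rewrite sc ci cj.
have := so (c := fun x => c x - 2 / N%:R).
rewrite sumrB s1 sum_const mulrC divfK // subrr => /(_ erefl).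
have -> : \sum_x (c x - 2 / N%:R) ^+ 2 = 2 - 4 / N%:R.
  transitivity (\sum_x (c x ^+ 2 - (4 / N%:R) * c x + 4 / N%:R ^+ 2)).
    by apply: eq_bigr => x _; field.
  by rewrite big_split sumrB -mulr_sumr s1 s2 sum_const /=; field.
have lc : lincomb c = e i + e j by rewrite /c linD !lin1.
rewrite one_vecE lc nqB nqD nqZ gZr gD ![g _ one]gC => h.
rewrite -(@pmulr_rge0 _ 2) //.
have := h; rewrite -subr_ge0; set L := (X in 0 <= X -> _).
suff -> : 2 * (pair_weight i + pair_weight j + g (e i) (e j)) = L by [].
by rewrite /L /pair_weight; field.
Qed.

(** The test vector behind [pair_weight_pair] with [j = i]; it even gives
    [4 * pair_weight i >= 2 * (1 - sqn (e i))]. *)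
Lemma pair_weight_ge0 i : 0 <= pair_weight i.
Proof.
have := so (c := fun x => 2 * (x == i)%:R - 2 / N%:R).
have s1 : \sum_x ((x == i)%:R : R) = 1.
  by rewrite (bigD1 i) //= eqxx big1 ?addr0 // => x /negPf->.
rewrite sumrB -mulr_sumr s1 sum_const [N%:R * _]mulrC divfK // mulr1 subrr => /(_ erefl).
have -> : \sum_x (2 * (x == i)%:R - 2 / N%:R : R) ^+ 2 = 4 - 4 / N%:R.
  transitivity (\sum_x ((4 - 8 / N%:R) * (x == i)%:R + 4 / N%:R ^+ 2 : R)).
    apply: eq_bigr => x _; case: (x == i) => /=; by field.
  rewrite big_split -mulr_sumr s1 sum_const /=; by field.
rewrite one_vecE linZ lin1 nqB !nqZ gZ gZr => h.
have := ne1 i => h1.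
suff : 0 <= 4 * pair_weight i - 2 * (1 - sqn (e i)) by lra.
move: h; rewrite -subr_ge0; set L := (X in 0 <= X -> _).
suff -> : 4 * pair_weight i - 2 * (1 - sqn (e i)) = L by [].
by rewrite /L /pair_weight [g one _]gC; field.
Qed.

Lemma pair_weight_sum : \sum_i pair_weight i <= 1 - sqn one / N%:R.
Proof.
have -> : \sum_i pair_weight i = (\sum_i sqn (e i) - N%:R) / 2 + 1 - sqn one / N%:R.
  have -> : \sum_i pair_weight i = \sum_i (sqn (e i) / 2 + (N%:R^-1 - 1/2 + sqn one / N%:R ^+ 2) - (2 / N%:R) * (1 * g one (e i))).
    by apply: eq_bigr => i _; rewrite /pair_weight; field.
  rewrite sumrB big_split /= -mulr_suml -mulr_sumr -g_lin sum_const -/one -/(sqn one); by field.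
have : \sum_i sqn (e i) <= \sum_(i < N) 1 by apply: ler_sum.
rewrite sum_const; lra.
Qed.

(** The cross terms of [sqn (lincomb z)] are nonpositive, the wrong sign for pipage rounding. Adding
    [pair_weight i + pair_weight j] makes them nonnegative and, on the hyperplane of sum [tau],
    changes the quadratic only by linear and diagonal terms. As [4 th (1 - th) <= 1], the price is
    at most the sum of the pair weights, hence at most [1 - sqn one / N]. *)
Lemma pipage_test b0 : exists z, [/\ forall i, 0 <= z i <= 1, \sum_i z i = tau, (#|frac z| <= 1)%N &
   sqn (b0 + (3/2) *: lincomb z) - (1 + kap) / 2 * (9/4 * \sum_i z i ^+ 2) <=
   sqn b0 + 3 * g b0 (lincomb th) + 2 * sqn (lincomb th) + 2 * (tau - T) + (1 - sqn one / N%:R)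
     + tau / 4 - (1 + kap) / 2 * (9/4 * tau)].
Proof.
(* The factor [(3/2)^2 = 9/4] is split as [2 + 1/4]: the [2] goes into the rounded quadratic, the
   [1/4] is bounded by the diagonal. [D] collects the diagonal coefficients; since [D i >= 0],
   [z i ^+ 2] may be replaced by [z i]. *)
pose D i : R := 9/4 * sqn (e i) + 4 * pair_weight i - 9/8 * (1 + kap).
have D0 i : 0 <= D i by rewrite /D; have := ne0 i; have := pair_weight_ge0 i; lra.
pose l i : R := 3 * g b0 (e i) + D i - 4 * tau * pair_weight i.
pose C i j : R := 2 * (pair_weight i + pair_weight j + g (e i) (e j)).
have offd (y : 'I_N -> R) : \sum_i y i = tau ->
   \sum_i \sum_(j | j != i) C i j * y i * y j =
   2 * sqn (lincomb y) - \sum_i y i ^+ 2 * (2 * sqn (e i) + 4 * pair_weight i) + 4 * tau * \sum_i pair_weight i * y i.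
  move=> sy; pose S := \sum_j pair_weight j * y j.
  transitivity (\sum_i (2 * (\sum_j y i * y j * g (e i) (e j)) - y i ^+ 2 * (2 * sqn (e i) + 4 * pair_weight i)
     + (2 * tau * (pair_weight i * y i) + 2 * S * y i))).
    apply: eq_bigr => i _.
    have -> : \sum_(j | j != i) C i j * y i * y j = \sum_j C i j * y i * y j - C i i * y i * y i.
      by rewrite [in RHS](bigD1 i) //= [in RHS]addrC addrK.
    have -> : \sum_j C i j * y i * y j = 2 * pair_weight i * y i * tau + 2 * y i * S + 2 * \sum_j y i * y j * g (e i) (e j).
      transitivity (\sum_j (2 * pair_weight i * y i * y j + 2 * y i * (pair_weight j * y j) + 2 * (y i * y j * g (e i) (e j)))).
        by apply: eq_bigr => j _; rewrite /C; ring.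
      by rewrite !big_split /= -!mulr_sumr sy.
    rewrite /C /sqn; ring.
  rewrite !big_split /= sumrN -!mulr_sumr sy -/S nq_lin; ring.
have [||z [z01 sz fz qz]] := @pipage R N l C th tau _ _ th01 erefl.
- by move=> a b; rewrite /C [g (e b) _]gC [pair_weight b + _]addrC.
- by move=> a b ab; rewrite /C mulr_ge0 // pair_weight_pair.
exists z; split=> //.
have quE (y : 'I_N -> R) : \sum_i y i = tau -> quad l C y = 3 * g b0 (lincomb y) + 2 * sqn (lincomb y) + \sum_i D i * y i
   - \sum_i y i ^+ 2 * (2 * sqn (e i) + 4 * pair_weight i).
  move=> sy; rewrite /quad offd // g_lin.
  have -> : \sum_i l i * y i = 3 * (\sum_i y i * g b0 (e i)) + \sum_i D i * y i - 4 * tau * (\sum_i pair_weight i * y i).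
    by rewrite [3 * _]mulr_sumr [4 * tau * _]mulr_sumr -big_split -sumrB; apply: eq_bigr => i _; rewrite /l /=; ring.
  ring.
move: qz; rewrite !quE // => qz.
have zz i : z i ^+ 2 <= z i by case/andP: (z01 i) => a b; rewrite expr2 ler_piMr.
have h1 : \sum_i D i * z i ^+ 2 <= \sum_i D i * z i by apply: ler_sum => i _; rewrite ler_wpM2l.
have h2 : sqn (lincomb z) <= \sum_i z i ^+ 2 * sqn (e i).
  by apply: nq_le_diag => i; case/andP: (z01 i).
have h3 : \sum_i D i * z i ^+ 2 = 9/4 * (\sum_i z i ^+ 2 * sqn (e i)) + 4 * (\sum_i z i ^+ 2 * pair_weight i) - 9/8 * (1 + kap) * \sum_i z i ^+ 2.
  by rewrite !mulr_sumr -big_split -sumrB; apply: eq_bigr => i _; rewrite /D /=; ring.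
have h4 (y : 'I_N -> R) : \sum_i y i ^+ 2 * (2 * sqn (e i) + 4 * pair_weight i) = 2 * (\sum_i y i ^+ 2 * sqn (e i)) + 4 * (\sum_i y i ^+ 2 * pair_weight i).
  by rewrite !mulr_sumr -big_split; apply: eq_bigr => i _ /=; ring.
have h5 : \sum_i D i * th i - \sum_i th i ^+ 2 * (2 * sqn (e i) + 4 * pair_weight i) <=
   2 * (tau - T) + (1 - sqn one / N%:R) + tau / 4 - (1 + kap) / 2 * (9 / 4 * tau).
  apply: (@le_trans _ _ (\sum_i (2 * (th i - th i ^+ 2) + pair_weight i + th i / 4 - (1 + kap) / 2 * (9/4) * th i))).
    rewrite -sumrB; apply: ler_sum => i _; rewrite /D.
    case/andP: (th01 i) => a b; have n1 := ne1 i; have c0 := pair_weight_ge0 i.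
    have : 0 <= (th i * (1 - th i)) * (1 - sqn (e i)) by rewrite !mulr_ge0 //; lra.
    have : 0 <= th i * (1 - sqn (e i)) by rewrite mulr_ge0 //; lra.
    have : 0 <= pair_weight i * (1 - 2 * th i) ^+ 2 by rewrite mulr_ge0 // sqr_ge0.
    lra.
  have -> : \sum_i (2 * (th i - th i ^+ 2) + pair_weight i + th i / 4 - (1 + kap) / 2 * (9 / 4) * th i) =
     2 * (tau - T) + \sum_i pair_weight i + tau / 4 - (1 + kap) / 2 * (9 / 4) * tau.
    transitivity (\sum_i 2 * (th i - th i ^+ 2) + \sum_i pair_weight i + \sum_i th i / 4 - \sum_i (1 + kap) / 2 * (9 / 4) * th i).
      by rewrite -!big_split -sumrB.
    by rewrite -!mulr_sumr -mulr_suml sumrB.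
  have := pair_weight_sum; lra.
rewrite nqD nqZ gZr.
move: qz h1 h2 h5; rewrite h3 !h4; lra.
Qed.
End Second.
End Form.

(** For a group of mass [G] the two squares add up to [tau^2 / 2 + (2 G - tau)^2 / 2]. In the
    lightest group with [2 G >= tau] every member weighs at least [2 G - tau], so the sum of the
    squared weights is at least [(2 G - tau) G]; a quarter of this suffices as soon as
    [G <= 2/3 tau]. *)
Lemma balanced_split (R : realFieldType) (N : nat) (th : 'I_N -> R) (tau : R) :
  (forall i, 0 < th i) -> \sum_i th i = tau -> (forall i, th i <= 2/3 * tau) ->
  exists B : {set 'I_N}, (\sum_(i in B) th i) ^+ 2 + (\sum_(i in ~: B) th i) ^+ 2 <=
    tau ^+ 2 / 2 + (\sum_i th i ^+ 2) / 4.
Proof.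
move=> t0 st tm.
pose G (B : {set 'I_N}) := \sum_(i in B) th i.
have GC B : G (~: B) = tau - G B.
  rewrite -st /G [X in _ = X - _](bigID (mem B)) /= addrAC subrr add0r.
  by apply: eq_bigl => i; rewrite inE.
have tau0 : 0 <= tau by rewrite -st sumr_ge0 // => i _; apply/ltW/t0.
have GT : tau <= 2 * G [set: 'I_N].
  by have := GC [set: 'I_N]; rewrite setCT /G big_set0; lra.
case: (@arg_minP _ R _ [set: 'I_N] (fun B => tau <= 2 * G B) G GT) => B hB minB.
exists B; rewrite -/(G B) -/(G (~: B)) GC.
have G1 i : i \in B -> G B = th i + G (B :\ i).
  by move=> iB; rewrite /G (big_setD1 i).
(* Once [i] is removed, either the remaining group or its complement carries half of the mass, and
   minimality applies to it. *)
have big i : i \in B -> 2 * G B - tau <= th i.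
  move=> iB; have e := G1 i iB; have ti := t0 i.
  have [h|h] := lerP tau (2 * G (B :\ i)); first by have := minB _ h; lra.
  have := minB (~: (B :\ i)); rewrite GC => mm.
  have := mm ltac:(lra); lra.
(* Two members already give [2 (2 G - tau) <= G]; a single one weighs at most [2/3 tau] by
   assumption. *)
have le23 : G B <= 2/3 * tau.
  have [//|lt] := lerP (G B) (2/3 * tau).
  have [B0|[i iB]] := set_0Vmem B; first by move: lt; rewrite B0 /G big_set0; lra.
  have e := G1 i iB.
  have [C0|[j jB]] := set_0Vmem (B :\ i).
    by move: lt; rewrite e C0 /G big_set0 addr0; have := tm i; lra.
  have jB' : j \in B by move: jB; rewrite !inE => /andP[].
  have := big i iB; have := big j jB'.
  have : th j <= G (B :\ i).
    by rewrite /G (big_setD1 j) //= ler_wpDr // sumr_ge0 // => x _; apply/ltW/t0.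
  lra.
have TB : (2 * G B - tau) * G B <= \sum_i th i ^+ 2.
  rewrite (bigID (mem B)) /= mulr_sumr ler_wpDr ?sumr_ge0 //; first by move=> i _; apply: sqr_ge0.
  by apply: ler_sum => i iB; rewrite expr2 ler_wpM2r ?big // ltW.
have : 0 <= (2 * G B - tau) * (2/3 * tau - G B) by rewrite mulr_ge0 //; lra.
move: TB; clear; nra.
Qed.

(** * The contradiction at a local minimizer with ties *)

(* [g v v'] is Re <A v, A v'> and [w v] is Re <r, A v>; [e i] are the unit vectors
   x_i / |x_i| at the ties outside S, [f j] the components of d = x - u on S \ P,
   with [h j] = |d_j| and weight [tl j]; k = K - #P and room = K - #(P \ S). *)
Section Core.
Variables (R : realFieldType) (W : lmodType R) (g : W -> W -> R) (w : W -> R).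
Hypothesis gC : forall x y, g x y = g y x.
Hypothesis gD : forall x y z, g (x + y) z = g x z + g y z.
Hypothesis gZ : forall a x z, g (a *: x) z = a * g x z.
Hypothesis g_ge0 : forall x, 0 <= g x x.
Hypothesis wD : forall x y, w (x + y) = w x + w y.
Hypothesis wZ : forall a x, w (a *: x) = a * w x.
Local Notation nq := (sqn g).

Variables (N M : nat) (e : 'I_N -> W) (f : 'I_M -> W) (d : W).
Variables (th : 'I_N -> R) (tl h : 'I_M -> R).
Variables (kap om2 m2 PP Xp : R) (p0 k room K : nat).
Local Notation lin := (lincomb e).
Let tau := \sum_i th i.
Let T := \sum_i th i ^+ 2.
Let U := \sum_j h j ^+ 2.
Let zeta := \sum_j g d (f j).
Let chi := \sum_j tl j * (1 - tl j).
Let Xt := w (lin th).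
Hypothesis kap0 : 0 < kap.
Hypothesis kap1 : kap <= 1.
Hypothesis m20 : 0 < m2.
Hypothesis hom : om2 * (1 + 2 * kap) <= kap ^+ 2 * m2.
Hypothesis wcs : forall v, w v ^+ 2 <= om2 * nq v.
Hypothesis th0 : forall i, 0 < th i.
Hypothesis th1 : forall i, th i <= 1.
Hypothesis tl01 : forall j, 0 <= tl j <= 1.
Hypothesis tauE : \sum_j tl j + tau = k%:R.
Hypothesis kr : (k <= room)%N.
Hypothesis p0r : (p0 + room)%N = K.
Hypothesis ME : M = (p0 + k)%N.
Hypothesis gde : forall i, g d (e i) = th i - 1 + w (e i).
Hypothesis gdf : forall j, `|g d (f j)| <= (1 - tl j) * h j.
Hypothesis h0 : forall j, 0 <= h j.
Hypothesis hm : forall j, (1 - tl j) * m2 - tl j * (1 - tl j) <= h j ^+ 2.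
Hypothesis gdd : nq d = T - tau + Xt + zeta + Xp.
Hypothesis wd : w d = Xp + Xt.
Hypothesis PP0 : p0%:R <= PP.
Hypothesis XpE : Xp <= kap / 2 * (PP + p0%:R * m2).
Hypothesis Xp1 : (0 < p0)%N -> Xp < kap / 2 * (PP + p0%:R * m2).
Hypothesis p00 : p0 = 0%N -> Xp = 0 /\ PP = 0.
Hypothesis so : forall c, \sum_i c i = 0 -> \sum_i c i ^+ 2 <= nq (lin c).
Hypothesis ne1 : forall i, nq (e i) <= 1.
Hypothesis nf : forall j, nq (f j) <= h j ^+ 2.
Hypothesis test : forall y, (#|[set i | y i != 0%R]| <= room)%N ->
  (1 + kap) / 2 * (PP + \sum_i y i ^+ 2 + U) <= nq (d + lin (fun i => (y i - th i)%R)).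
Hypothesis testD : forall j y, (#|[set i | y i != 0%R]| <= room.+1)%N ->
  (1 + kap) / 2 * (PP + \sum_i y i ^+ 2 + U - h j ^+ 2) <= nq (d + lin (fun i => (y i - th i)%R) - f j).
Hypothesis sparse : forall y, (#|[set i | y i != 0%R]| <= K.*2)%N ->
  (1 + kap) / 2 * (\sum_i y i ^+ 2) <= nq (lin y).
Hypothesis single : p0 = 0%N -> k = 1%N -> room = 1%N -> nq (d - lin th) <= U.
Hypothesis nontriv : (0 < N)%N \/ (0 < p0)%N.

Let th01 i : 0 <= th i <= 1. Proof. by rewrite ltW //= th1. Qed.
Let tau0 : 0 <= tau. Proof. by rewrite sumr_ge0 // => i _; apply/ltW/th0. Qed.
Let T0 : 0 <= T. Proof. by rewrite sumr_ge0 // => i _; apply: sqr_ge0. Qed.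
Let Tt : T <= tau.
Proof. by apply: ler_sum => i _; rewrite expr2 ler_piMr // ltW. Qed.
Let chi0 : 0 <= chi.
Proof. by rewrite sumr_ge0 // => j _; case/andP: (tl01 j) => a b; rewrite mulr_ge0 // subr_ge0. Qed.
Let U0 : 0 <= U. Proof. by rewrite sumr_ge0 // => i _; apply: sqr_ge0. Qed.
Let tauk : tau <= k%:R.
Proof. by rewrite -tauE lerDr sumr_ge0 // => j _; case/andP: (tl01 j). Qed.
Let csum : \sum_j (1 - tl j) = p0%:R + tau.
Proof.
rewrite sumrB sumr_const card_ord.
have -> : M%:R = p0%:R + k%:R :> R by rewrite ME natrD.
by rewrite -tauE; ring.
Qed.
Let csum2 : \sum_j (1 - tl j) ^+ 2 = p0%:R + tau - chi.
Proof. by rewrite -csum -sumrB; apply: eq_bigr => j _; ring. Qed.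
Let hU : (p0%:R + tau) * m2 - chi <= U.
Proof.
rewrite -csum mulr_suml -sumrB; apply: ler_sum => j _; exact: hm.
Qed.
Let zabs : `|zeta| <= \sum_j (1 - tl j) * h j.
Proof. by apply: le_trans (ler_norm_sum _ _ _) _; apply: ler_sum => j _; apply: gdf. Qed.
Let hzc c : 0 < c -> zeta <= c * (p0%:R + tau - chi) + U / (4 * c).
Proof.
move=> c0; apply: le_trans (ler_norm _) _; apply: le_trans zabs _.
rewrite -csum2 mulr_sumr mulr_suml -big_split; apply: ler_sum => j _ /=.
rewrite -subr_ge0.
have -> : c * (1 - tl j) ^+ 2 + h j ^+ 2 / (4 * c) - (1 - tl j) * h j =
  c * ((1 - tl j) - h j / (2 * c)) ^+ 2 by field; rewrite lt0r_neq0.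
by rewrite mulr_ge0 ?sqr_ge0 // ltW.
Qed.
Let hz2 : zeta ^+ 2 <= (p0%:R + tau - chi) * U.
Proof.
have S0 : 0 <= p0%:R + tau - chi by rewrite -csum2 sumr_ge0 // => j _; apply: sqr_ge0.
have [->|Z] := eqVneq zeta 0; first by rewrite expr0n /= mulr_ge0.
set a := p0%:R + tau - chi in S0 *.
have bnd c : 0 < c -> `|zeta| <= c * a + U / (4 * c).
  move=> c0; apply: le_trans zabs _.
  rewrite /a -csum2 mulr_sumr mulr_suml -big_split; apply: ler_sum => j _ /=.
  rewrite -subr_ge0.
  have -> : c * (1 - tl j) ^+ 2 + h j ^+ 2 / (4 * c) - (1 - tl j) * h j =
    c * ((1 - tl j) - h j / (2 * c)) ^+ 2 by field; rewrite lt0r_neq0.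
  by rewrite mulr_ge0 ?sqr_ge0 // ltW.
have z0 : 0 < `|zeta| by rewrite normr_gt0.
rewrite -[zeta ^+ 2]ger0_norm ?sqr_ge0 // normrX.
(* The best [c] is [|zeta| / (2 a)]; if [a = 0], a large [c] contradicts [zeta != 0]. *)
have [a0|a0] := ltrP 0 a; last first.
  have aE : a = 0 by apply: le_anti; rewrite a0 S0.
  have := bnd ((U + 1) / `|zeta|); rewrite aE mulr0 add0r.
  have u1 : 0 < U + 1 by rewrite ltr_wpDl.
  have p : 0 < (U + 1) / `|zeta| by apply: divr_gt0.
  move=> /(_ p); rewrite ler_pdivlMr; last by rewrite mulr_gt0.
  rewrite mulrCA [_ * (_ / _)]mulrC divfK ?lt0r_neq0 //; lra.
have := bnd (`|zeta| / (2 * a)); rewrite divr_gt0 ?mulr_gt0 // => /(_ isT) H.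
have E : `|zeta| / (2 * a) * a + U / (4 * (`|zeta| / (2 * a))) = `|zeta| / 2 + U * a / (2 * `|zeta|).
  by field; rewrite !lt0r_neq0.
move: H; rewrite E => H.
have : `|zeta| / 2 <= U * a / (2 * `|zeta|) by lra.
rewrite ler_pdivlMr ?mulr_gt0 //; rewrite expr2; lra.
Qed.
Let hXt : Xt ^+ 2 <= om2 * nq (lin th). Proof. exact: wcs. Qed.

Let Bse : zeta + Xp - (1 + kap) / 2 * (PP + U) <= tau / 2 - kap / 2 * tau * m2.
Proof.
apply: (@budget_le _ kap p0%:R PP tau chi U m2 zeta Xp) => //.
by have := @hzc (1/2) ltac:(lra); lra.
Qed.

(** With no tie outside [S] the vector [d] itself is tested, and [p0 > 0] makes the bound on [Xp]
    strict. *)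
Lemma core_no_ties : N = 0%N -> False.
Proof.
move=> N0; have pp : (0 < p0)%N by case: nontriv; rewrite ?N0.
have z0 (F : 'I_N -> R) : \sum_i F i = 0 by rewrite big1 // => i _; have := ltn_ord i; rewrite [X in (_ < X)%N]N0.
have l0 c : lin c = 0 by rewrite /lincomb big1 // => i _; have := ltn_ord i; rewrite [X in (_ < X)%N]N0.
have := @test (fun=> 0); rewrite l0 addr0 z0 => /(_ _).
have -> : #|[set i : 'I_N | (0 : R) != 0]| = 0%N by apply: eq_card0 => i; rewrite inE eqxx.
move=> /(_ isT); rewrite gdd.
have w0 : w 0 = 0 by rewrite -(scale0r 0) wZ mul0r.
have t0 : tau = 0 by apply: z0.
rewrite /Xt l0 w0 t0 [T]z0.
have := @hzc (1/2) ltac:(lra); have := Xp1 pp; have := hU; rewrite t0.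
rewrite add0r addr0 => hU'.
have : 0 <= (1 - kap) * chi by rewrite mulr_ge0 ?subr_ge0.
have : 0 <= kap * (U - p0%:R * m2 + chi) by rewrite mulr_ge0 ?(ltW kap0) //; lra.
have := PP0; lra.
Qed.

Hypothesis N0 : (0 < N)%N.
Let i0 := Ordinal N0.
Let taup : 0 < tau.
Proof. by rewrite /tau (bigD1 i0) //= ltr_wpDr ?th0 // sumr_ge0 // => i _; apply/ltW/th0. Qed.
Let k0 : (0 < k)%N.
Proof. by have := lt_le_trans taup tauk; rewrite ltr0n. Qed.
Let krK : (k <= K)%N. Proof. by rewrite -p0r (leq_trans kr) // leq_addl. Qed.
Let K0 : (0 < K)%N. Proof. exact: leq_trans krK. Qed.
Let K21 : (2 <= K.*2)%N. Proof. by rewrite (leq_double 1). Qed.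
Let ne0 i : (1 + kap) / 2 <= nq (e i).
Proof.
rewrite -(lin1 e i); have := @sparse (fun j => (j == i)%:R).
have -> : [set j : 'I_N | ((j == i)%:R : R) != 0] = [set i].
  by apply/setP => j; rewrite !inE; case: (j == i); rewrite ?eqxx ?oner_eq0.
rewrite cards1 => /(_ (ltnW K21)).
rewrite (bigD1 i) //= eqxx expr1n big1 ?addr0 ?mulr1 // => j /negPf->.
by rewrite expr0n.
Qed.
(** The sparsity bound for [e_i + e_j] together with the parallelogram identity. *)
Let npair i j : i != j -> nq (e i - e j) <= 3 - kap.
Proof.
move=> ij; pose c x : R := (x == i)%:R + (x == j)%:R.
have := @sparse c.
have -> : [set x | c x != 0] = [set i; j].
  apply/setP => x; rewrite !inE /c; have [->|] := eqVneq x i.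
    by rewrite (negPf ij) addr0 oner_eq0.
  by move=> _; rewrite add0r; case: (x == j); rewrite ?eqxx ?oner_eq0.
rewrite cards2 ij => /(_ K21).
have -> : lin c = e i + e j by rewrite /c linD !lin1.
rewrite (sum_two ij); last by move=> x /negPf xi /negPf xj; rewrite /c xi xj addr0 expr0n.
rewrite /c !eqxx (negPf ij) [j == i]eq_sym (negPf ij) addr0 add0r expr1n.
rewrite nqD // nqB //; have := ne1 i; have := ne1 j; lra.
Qed.
Let rho := nq (lin th).
Let rhoT : rho <= T.
Proof. by apply: (nq_le_sq gC gD gZ so ne1) => i; apply/ltW/th0. Qed.
Let hXT : Xt ^+ 2 <= om2 * T.
Proof.
apply: le_trans hXt _; apply: ler_wpM2l rhoT.
have := wcs (e i0); have := sqr_ge0 (w (e i0)) => a b.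
have := le_trans a b; rewrite pmulr_lge0 //; apply: lt_le_trans (ne0 i0).
by have := kap0; lra.
Qed.
Let gdt : g d (lin th) = T - tau + Xt.
Proof.
have wl c : w (lin c) = \sum_i c i * w (e i).
  rewrite /lincomb; elim/big_rec2: _ => [|i a b _ <-]; last by rewrite wD wZ.
  by rewrite -(scale0r 0) wZ mul0r.
rewrite g_lin // /Xt wl -sumrB -big_split; apply: eq_bigr => i _ /=.
rewrite gde; ring.
Qed.
Let Gb := (1 - nq (lin (fun=> 1)) / N%:R) / 2.

(** By [gde], the product of [A d - r] with the image of [e i] is [- (1 - th i)], and these images
    have nonpositive mutual products. Expanding [|A (d + lin ph) - r|^2 >= 0] then works as in
    Bessel's inequality. *)
Let bessel : N%:R - tau <= zeta - Xp - Xt + om2.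
Proof.
have w2 v : 2 * w v <= nq v + om2.
  have o0 : 0 <= om2.
    have := wcs (e i0); have := sqr_ge0 (w (e i0)) => a b.
    have := le_trans a b; rewrite pmulr_lge0 //; apply: lt_le_trans (ne0 i0).
    by have := kap0; lra.
  apply: le_amgm; rewrite ?exprMn //; first exact: g_ge0.
  have := wcs v; lra.
pose ph i := 1 - th i.
have p0' i : 0 <= ph i by rewrite /ph subr_ge0.
have := w2 (d + lin ph); rewrite wD nqD //.
have := nq_le_sq gC gD gZ so ne1 p0'.
have -> : \sum_i ph i ^+ 2 = N%:R - 2 * tau + T.
  have -> : N%:R = \sum_(i < N) 1 :> R by rewrite sumr_const card_ord.
  by rewrite /tau /T mulr_sumr -sumrB -big_split; apply: eq_bigr => i _; rewrite /ph /=; ring.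
have -> : g d (lin ph) = w (lin ph) - (N%:R - 2 * tau + T).
  have -> : N%:R = \sum_(i < N) 1 :> R by rewrite sumr_const card_ord.
  have wl c : w (lin c) = \sum_i c i * w (e i).
    rewrite /lincomb; elim/big_rec2: _ => [|i a b _ <-]; last by rewrite wD wZ.
    by rewrite -(scale0r 0) wZ mul0r.
  rewrite g_lin // wl /tau /T mulr_sumr -sumrB -big_split -sumrB; apply: eq_bigr => i _.
  rewrite gde /ph /=; ring.
rewrite gdd wd; lra.
Qed.

(** The pipage point has at most one fractional coordinate and total mass at most the integer [k],
    so it has at most [k <= room] nonzero entries and can be tested. *)
Lemma pipage_ineq : zeta + Xp + 2 * Xt + 2 * Gb + tau / 4 - (1 + kap) / 2 * (PP + 9 / 4 * tau + U) >= 0.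
Proof.
have [z [z01 sz fz]] := pipage_test gC gD gZ th01 so ne1 ne0 N0 (d - lin th).
have zk : (#|[set i | (3/2 * z i)%R != 0%R]| <= room)%N.
  apply: leq_trans kr.
  have eF : [set i | (3/2 * z i)%R != 0%R] = frac z :|: [set i | z i == 1].
    apply/setP => i; rewrite !inE mulf_eq0 negb_or [X in X && _](_ : _ = true) /=; last by apply/eqP => ?; lra.
    case/andP: (z01 i) => a b; rewrite (lt_neqAle 0) a andbT eq_sym.
    have [->|] := eqVneq (z i) 0; first by rewrite eq_sym oner_eq0.
    by rewrite lt_neqAle b andbT; case: (z i == 1).
  have s1 : \sum_i z i = \sum_(i in frac z) z i + #|[set i | z i == 1]|%:R.
    rewrite (bigID (mem (frac z))) /=; congr (_ + _).
    rewrite (bigID [pred i | z i == 1]) /= [X in _ + X]big1; last first.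
      move=> i; rewrite !inE => /andP[]; case/andP: (z01 i) => a b.
      rewrite !lt_neqAle a b !andbT negb_and !negbK => /orP[/eqP->//|/eqP->]; rewrite eqxx //.
    rewrite addr0 -sum1_card natr_sum; apply: congr_big => //.
      move=> i; rewrite !inE andb_idl // => /eqP->; rewrite ltxx andbF //.
    by move=> i; rewrite !inE => /andP[_ /eqP->].
  rewrite eF; apply: leq_trans (leq_card_setU _ _) _.
  move: fz; rewrite leq_eqVlt ltnS leqn0 => /orP[/cards1P[i fi]|]; last first.
    rewrite cards_eq0 => /eqP fi; rewrite fi cards0 add0n -(ler_nat R).
    by move: s1; rewrite fi big_set0 add0r sz => <-.
  rewrite fi cards1 add1n -(ltr_nat R); apply: lt_le_trans tauk.
  rewrite /tau -sz s1 fi big_set1 ltrDr.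
  by have := set11 i; rewrite -fi inE => /andP[].
have := @test (fun i => (3/2 * z i)%R) zk.
have -> : d + lin (fun i => (3/2 * z i - th i)%R) = d - lin th + (3/2) *: lin z.
  by rewrite linB linZ addrA addrAC.
have -> : \sum_i (3 / 2 * z i) ^+ 2 = 9/4 * \sum_i z i ^+ 2.
  by rewrite mulr_sumr; apply: eq_bigr => i _; field.
rewrite nqB // gdd -/rho gdt.
have -> : g (d - lin th) (lin th) = T - tau + Xt - rho by rewrite gD gNl // gdt.
rewrite /Gb -/tau -/T; lra.
Qed.

Let group_T (B : {set 'I_N}) : \sum_(i in B) th i ^+ 2 + \sum_(i in ~: B) th i ^+ 2 = T.
Proof. by rewrite /T [in RHS](bigID (mem B)) /=; congr (_ + _); apply: eq_bigl => i; rewrite inE. Qed.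
Let group_tau (B : {set 'I_N}) : \sum_(i in B) th i + \sum_(i in ~: B) th i = tau.
Proof. by rewrite /tau [in RHS](bigID (mem B)) /=; congr (_ + _); apply: eq_bigl => i; rewrite inE. Qed.
Let group_lin (B : {set 'I_N}) : linG e B th + linG e (~: B) th = lin th.
Proof. by rewrite /linG /lincomb [in RHS](bigID (mem B)) /=; congr (_ + _); apply: eq_bigl => i; rewrite inE. Qed.
Let gainB (B : {set 'I_N}) : gain g e B th <= (3 - kap) / 2 * ((\sum_(i in B) th i) ^+ 2 - \sum_(i in B) th i ^+ 2).
Proof. by apply: gain_le => // *; apply: npair. Qed.

(** The groups are rounded one after the other and their variances add. The bound on [rho + Gn] also
    uses that vectors from different groups have nonpositive product. *)
Lemma two_groups (B : {set 'I_N}) : exists Gn : R,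
  let Y := (\sum_(i in B) th i) ^+ 2 + (\sum_(i in ~: B) th i) ^+ 2 in
  [/\ Gn <= (3 - kap) / 2 * (Y - T), rho + Gn <= Y &
   forall b0 s, exists y, [/\ (#|[set i | y i != 0%R]| <= 2)%N, \sum_i y i ^+ 2 = s ^+ 2 * Y &
     nq (b0 + lin y) <= nq (b0 + s *: lin th) + s ^+ 2 * Gn]].
Proof.
exists (gain g e B th + gain g e (~: B) th); set g1 := \sum_(i in B) th i; set g2 := \sum_(i in ~: B) th i.
split.
- have := gainB B; have := gainB (~: B); rewrite -/g1 -/g2 -(group_T B); lra.
- have n1 := @gain_nq _ _ _ _ e B th (fun i _ => th0 i) (fun i _ => ne1 i).
  have n2 := @gain_nq _ _ _ _ e (~: B) th (fun i _ => th0 i) (fun i _ => ne1 i).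
  have cr : g (linG e B th) (linG e (~: B) th) <= 0.
    rewrite /linG g_suml //; apply: sumr_le0 => i iB; rewrite g_sumr //; apply: sumr_le0 => j jB.
    rewrite gZ gZr // mulrA mulr_ge0_le0 ?mulr_ge0 ?(ltW (th0 _)) //.
    apply: (second_pair gC gD gZ so ne1); apply: contraTneq jB => <-; rewrite inE iB //.
  rewrite /rho -(group_lin B) nqD //; move: n1 n2; rewrite -/g1 -/g2; lra.
- have half (A : {set 'I_N}) b0 s : exists y, [/\ (#|[set i | y i != 0%R]| <= 1)%N, (forall i, i \notin A -> y i = 0),
      \sum_i y i ^+ 2 = s ^+ 2 * (\sum_(i in A) th i) ^+ 2 &
      nq (b0 + lin y) <= nq (b0 + s *: linG e A th) + s ^+ 2 * gain g e A th].
    have [->|[a aA]] := set_0Vmem A.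
      have l0 : lin (fun=> 0) = 0 by rewrite /lincomb big1 // => i _; rewrite scale0r.
      exists (fun=> 0); split => //.
      - by rewrite eq_card0 // => i; rewrite inE eqxx.
      - by rewrite big1 ?big_set0 ?expr0n ?mulr0 // => i _; rewrite expr0n.
      - by rewrite l0 /gain /linG !big_set0 scaler0 addr0 /sqn g0l // mul0r subr0 mulr0 addr0.
    have gp : 0 < \sum_(i in A) th i.
      by rewrite (big_setD1 a) //= ltr_wpDr ?th0 // sumr_ge0 // => i _; apply/ltW/th0.
    have [i iA hi] := @round1 _ _ _ gC gD gZ _ e A th (fun i _ => th0 i) b0 s gp.
    exists (fun x => (s * \sum_(i in A) th i) * (x == i)%:R); split.
    - apply: leq_trans (_ : #|[set i]| <= 1)%N; last by rewrite cards1.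
      apply: subset_leq_card; apply/subsetP => x; rewrite !inE.
      by apply: contraR => /negPf->; rewrite mulr0.
    - by move=> x; case: eqP => [->|]; rewrite ?iA ?mulr0.
    - rewrite (bigD1 i) //= eqxx mulr1 [X in _ + X]big1 ?addr0 ?exprMn // => x /negPf->.
      by rewrite mulr0 expr0n.
    - by rewrite linZ lin1.
  move=> b0 s; have [y1 [c1 z1 q1 n1]] := half B (b0 + s *: linG e (~: B) th) s.
  have [y2 [c2 z2 q2 n2]] := half (~: B) (b0 + lin y1) s.
  exists (fun i => y1 i + y2 i); split.
  - apply: leq_trans (leq_add c1 c2); apply: leq_trans (leq_card_setU _ _).
    apply: subset_leq_card; apply/subsetP => i; rewrite !inE.
    by apply: contraR; rewrite negb_or !negbK => /andP[/eqP-> /eqP->]; rewrite addr0.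
  - rewrite mulrDr -q1 -q2 -big_split; apply: eq_bigr => i _ /=.
    have [iB|iB] := boolP (i \in B); first by rewrite (z2 i) ?inE ?iB // addr0 expr0n addr0.
    by rewrite (z1 i) // add0r expr0n add0r.
  - rewrite linD addrA; apply: le_trans n2 _.
    have n1' : nq (b0 + lin y1 + s *: linG e (~: B) th) <= nq (b0 + s *: lin th) + s ^+ 2 * gain g e B th.
      rewrite addrAC; move: n1.
      by rewrite -[b0 + _ + s *: linG e B th]addrA -scalerDr [linG e (~: B) th + _]addrC group_lin.
    lra.
Qed.

Let nqs s : nq (d - lin th + s *: lin th) = (T - tau + zeta + Xp + Xt) - 2 * (1 - s) * (T - tau + Xt) + (1 - s) ^+ 2 * rho.
Proof.
have -> : d - lin th + s *: lin th = d - (1 - s) *: lin th by rewrite scalerBl scale1r opprB addrA addrAC.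
rewrite nqB // nqZ // gZr // gdt gdd -/rho; ring.
Qed.

Lemma two_groups_test (B : {set 'I_N}) : (2 <= room)%N -> exists Gn : R,
  let Y := (\sum_(i in B) th i) ^+ 2 + (\sum_(i in ~: B) th i) ^+ 2 in
  [/\ Gn <= (3 - kap) / 2 * (Y - T), rho + Gn <= Y & forall s,
  (1 + kap) / 2 * (PP + s ^+ 2 * Y + U) <=
    (T - tau + zeta + Xp + Xt) - 2 * (1 - s) * (T - tau + Xt) + (1 - s) ^+ 2 * rho + s ^+ 2 * Gn].
Proof.
move=> r2; have [Gn [G1 G2 G3]] := two_groups B.
exists Gn; split=> // s; have [y [c q n]] := G3 (d - lin th) s.
have := test (leq_trans c r2); rewrite q linB addrA addrAC => H.
by apply: le_trans H _; rewrite -nqs.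
Qed.

Lemma core_small_mass : (2 <= room)%N -> tau <= 4/3 -> False.
Proof.
move=> r2 t43.
have TT : T <= tau ^+ 2.
  rewrite /T expr2 {1}/tau mulr_suml; apply: ler_sum => i _; rewrite expr2 ler_wpM2l ?(ltW (th0 _)) //.
  by rewrite /tau (bigD1 i) //= lerDl sumr_ge0 // => j _; apply/ltW.
have [/existsP[i hi]|/existsPn hi] := boolP [exists i, 2/3 * tau < th i].
  have [Gn [/= G1 _ /(_ 1)]] := @two_groups_test [set i] r2.
  have e1 : \sum_(j in [set i]) th j = th i by rewrite big_set1.
  have e2 : \sum_(j in ~: [set i]) th j = tau - th i by rewrite -(group_tau [set i]) e1 addrAC subrr add0r.
  move: G1; rewrite e1 e2 !expr1n subrr mulr0 mul0r subr0 expr0n /= mul0r addr0 !mul1r => G1.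
  have := @dominant_group_neg R kap tau T (th i ^+ 2 + (tau - th i) ^+ 2) m2 om2 Xt _ (th i) kap0 kap1 taup t43 m20 T0 TT hom hXT Bse
    (ltW hi) (th1 i) _ _ erefl.
  have -> : th i <= tau by rewrite -subr_ge0 -e2 sumr_ge0 // => j _; apply/ltW.
  have -> : th i ^+ 2 <= T by rewrite /T (bigD1 i) //= lerDl sumr_ge0 // => j _; apply: sqr_ge0.
  move=> /(_ isT isT); lra.
have hi' i : th i <= 2/3 * tau by rewrite leNgt hi.
have [B hB] := balanced_split th0 (erefl tau) hi'.
have T23 : T <= 2/3 * tau ^+ 2.
  rewrite /T expr2 mulrA {2}/tau mulr_sumr; apply: ler_sum => i _.
  by rewrite expr2 ler_wpM2r // ltW.
have [Gn [/= G1 G2 /(_ (3/2))]] := @two_groups_test B r2.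
have := @balanced_groups_neg R kap tau T _ m2 om2 Xt _ kap0 kap1 taup t43 m20 T0 T23 hom hXT Bse hB.
lra.
Qed.

Let NK2 : (4/3 <= tau) || ((7/10 <= tau) && (1 <= p0%:R :> R)) ->
  2 * Gb + 3/2 * p0%:R + 17/8 * tau - N%:R <= 0 -> False.
Proof.
move=> h1 h2.
have := @many_ties_neg R kap tau p0%:R PP chi U m2 zeta Xp Xt om2 Gb N%:R T kap0 kap1 m20 chi0 (ler0n _ _) PP0 T0 Tt hU.
have -> : zeta <= p0%:R + tau - chi + U / 4 by have := @hzc 1 ltr01; rewrite mul1r mulr1.
move=> /(_ isT hom hXT bessel h1 h2); have := pipage_ineq; lra.
Qed.

Let Np : (0 : R) < N%:R. Proof. by rewrite ltr0n. Qed.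
Let Gb1 : 2 * Gb <= 1.
Proof.
have : 0 <= nq (lin (fun=> 1)) / N%:R by rewrite divr_ge0 //; apply: g_ge0.
rewrite /Gb; lra.
Qed.

(** The all-ones combination of the ties is itself [2K]-sparse. *)
Let GbK : (N <= K.*2)%N -> Gb <= (1 - kap) / 4.
Proof.
move=> NK; have := @sparse (fun=> 1).
have -> : #|[set _ : 'I_N | (1 : R) != 0]| = N.
  by rewrite -[RHS]card_ord; apply: eq_card => i; rewrite !inE oner_eq0.
move=> /(_ NK); rewrite expr1n sumr_const card_ord.
rewrite -ler_pdivlMr // /Gb; lra.
Qed.

(** With one tie too many, the sparsity bound is summed over the all-ones vectors with one entry
    deleted. This gives [nq one / N >= (N - 3) / (2 (N - 2))], which is [1/3] at [N = 5], the
    smallest value for [K >= 2]. *)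
Let GbK1 : N = K.*2.+1 -> (1 < K)%N -> 2 * Gb <= 2/3.
Proof.
move=> NK K1.
have N5 : 5 <= N%:R :> R by rewrite (ler_nat R 5) NK ltnS (leq_double 2).
have NK' : (N.-1 <= K.*2)%N by rewrite NK.
pose one := lin (fun=> 1).
have H i : (1 + kap) / 2 * (N%:R - 1) <= nq one - 2 * g one (e i) + nq (e i).
  have := @sparse (fun j => 1 - (j == i)%:R).
  have -> : [set j : 'I_N | (1 - (j == i)%:R : R) != 0] = [set~ i].
    by apply/setP => j; rewrite !inE; case: (j == i); rewrite ?subrr ?eqxx ?subr0 ?oner_eq0.
  rewrite cardsC1 card_ord => /(_ NK').
  rewrite linB lin1 nqB // -/one.
  have -> : \sum_j (1 - (j == i)%:R) ^+ 2 = N%:R - 1 :> R; last by [].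
  rewrite (bigD1 i) //= eqxx subrr expr0n add0r.
  under eq_bigr => j /negPf-> do rewrite subr0 expr1n.
  by rewrite sumr_const cardC1 card_ord -subn1 natrB.
have : \sum_(i < N) ((1 + kap) / 2 * (N%:R - 1)) <= \sum_i (nq one - 2 * g one (e i) + 1).
  by apply: ler_sum => i _; have := H i; have := ne1 i; lra.
rewrite big_split sumrB /= !sumr_const !card_ord -mulr_sumr.
have -> : \sum_i g one (e i) = nq one.
  by rewrite /nq {2}/one g_lin //; apply: eq_bigr => i _; rewrite mul1r.
rewrite -[_ *+ N]mulr_natr -[nq one *+ N]mulr_natr => HH.
rewrite /Gb -/one.
suff : 1/3 <= nq one / N%:R by lra.
rewrite ler_pdivlMr //.
have a1 : 1/2 * (N%:R - 1) * N%:R <= (1 + kap) / 2 * (N%:R - 1) * N%:R.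
  by rewrite ler_wpM2r // ler_wpM2r //; have := kap0; lra.
have HH2 : 1/2 * (N%:R - 1) * N%:R - N%:R <= nq one * (N%:R - 2) by lra.
have := @ler_pM2r R (N%:R - 2) ltac:(lra) (1/3 * N%:R) (nq one) => <-.
apply: le_trans HH2.
have : 0 <= N%:R * (N%:R - 5) :> R by rewrite mulr_ge0 //; lra.
lra.
Qed.

(** Since [p0 + tau <= K], the criterion of [NK2] holds for [N >= 2K + 2] already with
    [2 * Gb <= 1]. For [N = 2K + 1] the sharper [2/3] is needed, and for [K = 2] also [tau <= 2]. *)
Let NleK : (1 < K)%N -> (4/3 <= tau) || ((7/10 <= tau) && (1 <= p0%:R :> R)) -> tau <= 8/3 -> (N <= K.*2)%N.
Proof.
move=> K1 h1 t83; rewrite leqNgt; apply/negP => NK.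
apply: (NK2 h1).
have pk : p0%:R + tau <= K%:R.
  apply: (@le_trans _ _ (p0%:R + k%:R)); first by rewrite lerD2l.
  by rewrite -natrD ler_nat -p0r leq_add2l.
have [E|N2] : N = K.*2.+1 \/ (K.*2.+2 <= N)%N by move: NK; clear; lia.
  have G := GbK1 E K1.
  have NE : N%:R = 2 * K%:R + 1 :> R by rewrite E -addn1 -muln2 natrD natrM mulrC.
  have [E2|K3] : K = 2%N \/ (3 <= K)%N by move: K1; clear; lia.
    move: NE pk; rewrite E2 => NE pk; have : 0 <= p0%:R :> R by []. lra.
  have : 3 <= K%:R :> R by rewrite (ler_nat R 3). lra.
have N2' : 2 * K%:R + 2 <= N%:R :> R.
  by rewrite -[2 * K%:R]natrM -natrD ler_nat; move: N2; clear; lia.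
have K2 : 2 <= K%:R :> R by rewrite (ler_nat R 2).
have := Gb1; lra.
Qed.

Lemma core_large_mass : 4/3 <= tau -> False.
Proof.
move=> t43.
have k2 : (2 <= k)%N by rewrite -(ltr_nat R); have := tauk; lra.
have hG : (Gb <= (1 - kap) / 4) || ((8/3 <= tau) && (Gb <= 1/2)).
  have [t83|t83] := lerP (8/3) tau; first by apply/orP; right => /=; have := Gb1; lra.
  rewrite GbK //; apply: NleK; [exact: leq_trans k2 krK|by rewrite t43|exact: ltW].
have := @pipage_bound_neg R kap tau T m2 om2 Xt Gb _ kap0 kap1 t43 m20 T0 Tt hom hXT Bse hG.
have := pipage_ineq; lra.
Qed.

(** One stretched random tie gives the contradiction except when [kap < 3/10], [tau > 7/10] and
    [T < 2/3 * tau ^+ 2]. This remaining region is treated according to whether [P \ S] is empty. *)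
Lemma core_room_one : room = 1%N -> tau <= 1 -> False.
Proof.
move=> r1 t1.
have TT : T <= tau ^+ 2.
  rewrite /T expr2 {1}/tau mulr_suml; apply: ler_sum => i _; rewrite expr2 ler_wpM2l ?(ltW (th0 _)) //.
  by rewrite /tau (bigD1 i) //= lerDl sumr_ge0 // => j _; apply/ltW.
have gA := gainB [set: 'I_N].
have gN := @gain_nq _ _ _ _ e [set: 'I_N] th (fun i _ => th0 i) (fun i _ => ne1 i).
have eT (V : zmodType) (F : 'I_N -> V) : \sum_(i in [set: 'I_N]) F i = \sum_i F i.
  by apply: eq_bigl => i; rewrite inE.
have linT : linG e [set: 'I_N] th = lin th by apply: eT.
move: gA gN; rewrite linT !eT -/tau -/T -/rho; set Gn := gain _ _ _ _ => gA gN.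
have T1S : (1 + kap) / 2 * (PP + 9/4 * tau ^+ 2 + U) <= 
   (T - tau + zeta + Xp + Xt) + (T - tau + Xt) + rho / 4 + 9/4 * Gn.
  have gp : 0 < \sum_(i in [set: 'I_N]) th i by rewrite eT.
  have [i _] := @round1 _ _ _ gC gD gZ _ e [set: 'I_N] th (fun i _ => th0 i) (d - lin th) (3/2) gp.
  rewrite linT eT -/tau -/Gn nqs => H.
  have := @test (fun x => 3/2 * tau * (x == i)%:R).
  have -> : (#|[set x | (3 / 2 * tau * (x == i)%:R)%R != 0%R]| <= room)%N.
    rewrite r1; apply: leq_trans (_ : #|[set i]| <= 1)%N; last by rewrite cards1.
    apply: subset_leq_card; apply/subsetP => x; rewrite !inE.
    by apply: contraR => /negPf->; rewrite mulr0.
  rewrite linB linZ lin1 addrA addrAC => /(_ isT) H2.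
  have := le_trans H2 H.
  have -> : \sum_x (3 / 2 * tau * (x == i)%:R) ^+ 2 = 9/4 * tau ^+ 2.
    rewrite (bigD1 i) //= eqxx mulr1 big1 ?addr0; first by field.
    by move=> x /negPf->; rewrite mulr0 expr0n.
  lra.
have [hS|hS] := boolP [|| 3/10 <= kap, tau <= 7/10 | 2/3 * tau ^+ 2 <= T].
  have := @single_group_neg R kap tau T kap0 kap1 taup t1 T0 TT hS.
  have := @single_group_bound R kap tau T (tau ^+ 2) m2 om2 Xt _ kap0 kap1 taup m20 T0 hom hXT Bse.
  lra.
move: hS; rewrite !negb_or -!ltNge => /and3P[k3 t7 T23].
have pK : K = p0.+1 by rewrite -p0r r1 addn1.
have k1 : k = 1%N by apply/eqP; rewrite eqn_leq k0 andbT -r1.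
have [p00' | pp] := posnP p0.
  have [xp pz] := p00 p00'.
  have M1 : M = 1%N by rewrite ME p00' k1.
  have Msum (F : 'I_M -> R) : exists j, \sum_i F i = F j.
    by move: F; rewrite M1 => F; exists ord0; rewrite big_ord1.
  have chiE : chi = tau * (1 - tau).
    have [j hj] := Msum (fun j => (1 - tl j)).
    have := csum; rewrite p00' add0r.
    rewrite /chi; move: j hj tauE; clear -M1; move: tl; rewrite M1 => t' j.
    by rewrite !big_ord1 => _ _ <-; ring.
  have hU' := hU; have hz' := hz2; move: hU' hz' T1S; rewrite p00' xp pz add0r chiE => hU' hz' T1S.
  apply: (@one_sparse_false R kap tau T U m2 zeta Xt om2 rho Gn) => //; try lra.
  - exact: ltW.
  - have := single p00' k1 r1; have := nqs 0; rewrite scale0r addr0 => ->; rewrite xp; lra.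
  - have v := wcs ((2/3) *: lin th + (1/3) *: d).
    have : 2 * (3/2 * w ((2/3) *: lin th + (1/3) *: d)) <= nq ((2/3) *: lin th + (1/3) *: d) + 9/4 * om2.
      have o0 : 0 <= om2.
        have := wcs (e i0); have := sqr_ge0 (w (e i0)) => a b.
        have := le_trans a b; rewrite pmulr_lge0 //; apply: lt_le_trans (ne0 i0).
        by have := kap0; lra.
      have n0 : 0 <= nq ((2/3) *: lin th + (1/3) *: d) by apply: g_ge0.
      apply: le_amgm => //; first by lra.
      lra.
    rewrite nqD // !nqZ // gZ gZr // [g _ d]gC gdt gdd wD !wZ wd -/Xt -/rho xp; lra.
have p1 : 1 <= p0%:R :> R by rewrite (ler_nat R 1).
have NK : (N <= K.*2)%N by apply: NleK; [rewrite pK|rewrite p1 (ltW t7) orbT|lra].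
(* With at most [2K] ties, [lin th] is sparse enough for a lower bound on its energy. *)
have rT : (1 + kap) / 2 * T <= rho.
  by apply: sparse; apply: leq_trans NK; rewrite -[X in (_ <= X)%N]card_ord max_card.
have Mn : M%:R = p0%:R + 1 :> R by rewrite ME k1 natrD.
have hYs : exists B : {set 'I_N}, (\sum_(i in B) th i) ^+ 2 + (\sum_(i in ~: B) th i) ^+ 2 <= tau ^+ 2 / 2 + 5/16 * T.
  have [/existsP[i hi]|/existsPn hi] := boolP [exists i, 2/3 * tau < th i].
    exists [set i].
    have e1 : \sum_(j in [set i]) th j = th i by rewrite big_set1.
    have e2 : \sum_(j in ~: [set i]) th j = tau - th i by rewrite -(group_tau [set i]) e1 addrAC subrr add0r.
    rewrite e1 e2.
    have tT : th i ^+ 2 <= T by rewrite /T (bigD1 i) //= lerDl sumr_ge0 // => j _; apply: sqr_ge0.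
    (* [T < 2/3 * tau ^+ 2] forces [th i] below about [0.8165 tau], and the bound with [5/16] holds
       up to about [0.827 tau]; [41/50] lies in between. *)
    have t82 : th i <= (41/50) * tau.
      rewrite leNgt; apply/negP => lt.
      have : ((41/50) * tau) ^+ 2 < th i ^+ 2 by rewrite ltr_pXn2r // ?nnegrE; lra.
      have := sqr_ge0 tau; rewrite exprMn; lra.
    have a1 : 0 <= th i - 2/3 * tau by rewrite subr_ge0 ltW.
    have a2 : 0 <= 41/50 * tau - th i by rewrite subr_ge0.
    have := mulr_ge0 a1 a2; have := mulr_ge0 (ltW taup) a1; have := mulr_ge0 (ltW taup) a2.
    lra.
  have hi' i : th i <= 2/3 * tau by rewrite leNgt hi.
  by have [B hB] := balanced_split th0 (erefl tau) hi'; exists B; apply: le_trans hB _; have := T0; rewrite -/T; lra.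
have [B hB] := hYs; have [Gn2 [/= G1 G2 G3]] := two_groups B.
set Y := _ + _ in hB G1 G2 G3.
(* Summing over the deleted coordinate [j] turns the products [g d (f j)] into [zeta]. *)
have T2 : (1 + kap) / 2 * ((p0%:R + 1) * (PP + Y + U) - U) <=
     (p0%:R + 1) * (T - tau + zeta + Xp + Xt + Gn2) - 2 * zeta + U.
  have E : \sum_j ((1 + kap) / 2 * (PP + Y + U - h j ^+ 2)) <=
     \sum_j ((T - tau + zeta + Xp + Xt + Gn2) - 2 * g d (f j) + h j ^+ 2).
    apply: ler_sum => j _.
    have [y [cy q n]] := G3 (d - lin th - f j) 1.
    have := @testD j y; rewrite r1 cy q expr1n mul1r => /(_ isT) H; apply: le_trans H _.
    rewrite linB addrA addrAC [d - lin th + _ - _]addrAC.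
    apply: le_trans n _; rewrite expr1n mul1r scale1r.
    have -> : d - lin th - f j + lin th = d - f j by rewrite addrAC subrK.
    rewrite nqB // gdd; have := nf j; lra.
  rewrite -mulr_sumr sumrB sumr_const card_ord -[_ *+ M]mulr_natl Mn in E.
  by rewrite big_split sumrB /= sumr_const card_ord -[_ *+ M]mulr_natl Mn -mulr_sumr in E.
apply: (@room_one_false R p0%:R kap tau T U m2 zeta chi Xp Xt PP om2 rho Gn Gn2 Y) => //; try lra.
- exact: ltW.
- by rewrite -csum2 sumr_ge0 // => j _; apply: sqr_ge0.
Qed.

Lemma core_ties : False.
Proof.
have [t43|t43] := lerP (4/3) tau; first exact: core_large_mass.
have [r2|r1] := leqP 2 room; first exact: core_small_mass r2 (ltW t43).
have r11 : room = 1%N by apply/eqP; rewrite eqn_leq -ltnS r1 (leq_trans k0 kr).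
apply: core_room_one => //; apply: le_trans tauk _.
by rewrite (ler_nat R _ 1) -r11.
Qed.
End Core.

From mathcomp Require Import boolp classical_sets reals constructive_ereal.
From mathcomp Require Import complex.

(** * The quadratic envelope of the cardinality constraint *)

Section QTwo.
Variables (R : realType) (F : comRingType) (nrm : F -> R).
Hypothesis nrm_ge0 : forall x, 0 <= nrm x.
Hypothesis nrm_eq0 : forall x, (nrm x == 0) = (x == 0).
Variables (n K : nat).
Hypothesis K0 : (0 < K)%N.
Hypothesis Kn : (K <= n)%N.
Implicit Type x : 'cV[F]_n.
Local Notation a x i := (nrm (x i 0)).
Local Notation s x := (sorted_abs nrm x).

Lemma size_sorted x : size (s x) = n.
Proof. by rewrite size_sort size_map size_enum_ord. Qed.

Lemma sum_sorted x (G : R -> R) : \sum_(0 <= j < n) G ((s x)`_j) = \sum_i G (a x i).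
Proof.
rewrite -{1}(size_sorted x) -(big_nth 0 predT G).
rewrite (perm_big [seq a x i | i <- enum 'I_n]) /=; last by rewrite perm_sort.
by rewrite big_map big_enum.
Qed.

Lemma sorted_ge0 x j : 0 <= (s x)`_j.
Proof.
have [lt|ge] := ltnP j (size (s x)); last by rewrite nth_default.
have : (s x)`_j \in s x by apply: mem_nth.
by rewrite mem_sort => /mapP[i _ ->].
Qed.

Lemma sorted_le x i j : (i <= j)%N -> (s x)`_j <= (s x)`_i.
Proof.
move=> ij; have [lt|ge] := ltnP j n; last by rewrite [X in X <= _]nth_default ?size_sorted ?sorted_ge0.
have tr : transitive (fun u v : R => v <= u) by move=> u v t h1 h2; apply: le_trans h2 h1.
have rf : reflexive (fun u v : R => v <= u) by move=> u; exact: lexx.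
apply: (sorted_leq_nth tr rf 0) => //; rewrite ?inE ?size_sorted //; last exact: leq_ltn_trans lt.
apply: sort_sorted => u v; exact: le_total.
Qed.

Lemma sorted_pos x j : (0 < (s x)`_j) = (j < Defs.card x)%N.
Proof.
pose c := count (fun r : R => 0 < r) (s x).
have cE : c = Defs.card x.
  rewrite /c /sorted_abs count_sort count_map -size_filter /Defs.card -sum1_card -big_filter.
  rewrite sum1_size; congr size; rewrite /index_enum -enumT; apply: eq_filter => i /=.
  by rewrite inE lt_neqAle nrm_ge0 andbT eq_sym nrm_eq0.
rewrite -cE; apply/idP/idP => [p|].
  have jn : (j < size (s x))%N.
    by rewrite ltnNge; apply/negP => h; move: p; rewrite nth_default // ltxx.
  rewrite /c -(cat_take_drop j.+1 (s x)) count_cat.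
  have -> : count (fun r : R => 0 < r) (take j.+1 (s x)) = j.+1.
    have sz : size (take j.+1 (s x)) = j.+1 by rewrite size_takel.
    apply/eqP; rewrite -{2}sz -all_count; apply/(all_nthP 0) => i; rewrite size_takel // => ij.
    by rewrite nth_take //; apply: lt_le_trans p _; apply: sorted_le.
  by rewrite leq_addr.
move=> jc; rewrite ltNge; apply/negP => p.
suff : (c <= j)%N by rewrite leqNgt jc.
rewrite /c -(cat_take_drop j (s x)) count_cat.
have -> : count (fun r : R => 0 < r) (drop j (s x)) = 0%N.
  apply/eqP; rewrite -leqn0 leqNgt -has_count; apply/hasPn => r /(nthP 0)[i _ <-].
  rewrite nth_drop -leNgt; apply: le_trans p; apply: sorted_le; exact: leq_addr.
by rewrite addn0 (leq_trans (count_size _ _)) // size_take; case: ltnP => // /ltnW.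
Qed.

Lemma tail1 x : 0 <= tail_sum nrm x K 1 - 1%:R * (s x)`_(K - 1).
Proof.
rewrite /tail_sum big_ltn; last by rewrite ltn_subLR // add1n ltnS.
by rewrite mul1r addrAC subrr add0r sumr_ge0 // => j _; apply: sorted_ge0.
Qed.

Lemma kstarP x : [/\ (0 < kstar nrm x K)%N, (kstar nrm x K <= K)%N,
  (kstar nrm x K)%:R * (s x)`_(K - kstar nrm x K) <= tail_sum nrm x K (kstar nrm x K) &
  forall k, (kstar nrm x K < k <= K)%N -> tail_sum nrm x K k < k%:R * (s x)`_(K - k)].
Proof.
pose P k := 0 <= tail_sum nrm x K k - k%:R * (s x)`_(K - k).
have E : kstar nrm x K = \max_(k < K.+1 | (0 < k)%N && P k) k.
  by rewrite /kstar big_geq_mkord; apply: eq_bigl => k; rewrite andbC.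
have P1 : (0 < @Ordinal K.+1 1 K0)%N && P (@Ordinal K.+1 1 K0) by rewrite /P tail1.
have [k0 Pk0 k0E] : {k0 : 'I_K.+1 | (0 < k0)%N && P k0 & \max_(k < K.+1 | (0 < k)%N && P k) k = k0}.
  by apply: (@eq_bigmax_cond _ (fun k : 'I_K.+1 => (0 < k)%N && P k) (fun k => k : nat)); apply/card_gt0P; exists (@Ordinal K.+1 1 K0).
rewrite E k0E; case/andP: Pk0 => a1 a2; split=> //.
- by rewrite -ltnS.
- by rewrite -subr_ge0.
- move=> k /andP[h1 h2]; rewrite ltNge; apply/negP => h.
  have : (k <= \max_(k < K.+1 | (0 < k)%N && P k) k)%N.
    apply: (@leq_bigmax_cond _ (fun k : 'I_K.+1 => (0 < k)%N && P k) (fun k => k : nat) (@Ordinal K.+1 k h2)).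
    by rewrite /= (leq_trans _ h1) //= /P subr_ge0.
  by rewrite k0E leqNgt h1.
Qed.

(** When [card x <= K], only the first [k] entries of the tail can be nonzero and none exceeds the
    leading one. The inequality defining [kstar] then forces these [k] entries to be equal, and the
    two terms of [Q2] cancel. *)
Lemma Q2_sparse x : (Defs.card x <= K)%N -> Q2 nrm K x = 0.
Proof.
move=> cK; have [k0 kK h _] := kstarP x; rewrite /Q2; set k := kstar nrm x K in k0 kK h *.
have z j : (K <= j)%N -> (s x)`_j = 0.
  move=> Kj; apply/eqP; rewrite eq_le sorted_ge0 andbT leNgt sorted_pos -leqNgt.
  exact: leq_trans cK Kj.
have tl (G : R -> R) : G 0 = 0 -> \sum_((K - k)%N <= j < n) G (s x)`_j = \sum_((K - k)%N <= j < K) G (s x)`_j.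
  move=> G0; rewrite (@big_cat_nat _ _ _ K) ?leq_subr //= [X in _ + X]big_nat [X in _ + X]big1 ?addr0 // => j /andP[Kj _].
  by rewrite z.
set c := (s x)`_(K - k) in h *.
have e : forall j, (K - k <= j < K)%N -> (s x)`_j = c.
  have le j : (K - k <= j < K)%N -> 0 <= c - (s x)`_j by case/andP => h1 _; rewrite subr_ge0 sorted_le.
  have S0 : \sum_((K - k)%N <= j < K | (K - k <= j < K)%N) (c - (s x)`_j) = 0.
    apply: le_anti; rewrite sumr_ge0 // andbT.
    rewrite -big_nat sumrB sumr_const_nat subKn // subr_le0 -mulr_natl.
    by move: h; rewrite /tail_sum (tl id).
  move=> j hj; have : c - (s x)`_j = 0.
    have := psumr_eq0P (F := fun i : 'I_K => c - (s x)`_i) (P := fun i : 'I_K => (K - k <= i)%N).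
    move: S0; rewrite -big_nat big_geq_mkord => S0 /(_ _ S0).
    case/andP: (hj) => h1 h2 H; apply: (H _ (Ordinal h2)) => // i h3.
    by apply: le; rewrite h3 ltn_ord.
  by move/eqP; rewrite subr_eq0 => /eqP.
rewrite /tail_sum /tail_sum2 (tl id) // (tl (fun r => r ^+ 2)) ?expr0n //.
rewrite (@eq_big_nat _ _ _ _ _ _ (fun=> c)) // [X in _ - X](@eq_big_nat _ _ _ _ _ _ (fun=> c ^+ 2)); last by move=> j /e->.
have kn : k%:R != 0 :> R by rewrite pnatr_eq0 -lt0n.
rewrite !sumr_const_nat subKn // -[c *+ k]mulr_natl -[c ^+ 2 *+ k]mulr_natl.
by field.
Qed.

(** [xi] is [tail_sum / k] at [k = kstar]. The defining inequality puts the tail entries at or below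
    [xi], and maximality of [kstar] puts the [K - k] leading ones above it; so these get weight 1
    and the tail has total weight [k]. *)
Lemma Q2_attained x : (K < Defs.card x)%N -> exists xi, [/\ 0 < xi,
  \sum_i Num.min 1 (a x i / xi) = K%:R &
  Q2 nrm K x + \sum_i a x i ^+ 2 = \sum_i (if xi <= a x i then a x i ^+ 2 else xi * a x i)].
Proof.
move=> cK; have [k0 kK h hk] := kstarP x; rewrite /Q2; set k := kstar nrm x K in k0 kK h hk *.
set S := tail_sum nrm x K k in h *.
have kp : (0 : R) < k%:R by rewrite ltr0n.
have Kn' : (K < n)%N by apply: leq_trans cK _; rewrite /Defs.card -[X in (_ <= X)%N](card_ord n) max_card.
have S0 : 0 < S.
  rewrite /S /tail_sum big_ltn; last by apply: leq_ltn_trans Kn'; apply: leq_subr.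
  rewrite ltr_wpDr ?sumr_ge0 // => [j _|]; first exact: sorted_ge0.
  by rewrite sorted_pos; apply: leq_ltn_trans cK; apply: leq_subr.
pose xi := S / k%:R; exists xi.
have xi0 : 0 < xi by apply: divr_gt0.
have hi j : (K - k <= j)%N -> (s x)`_j <= xi.
  move=> kj; apply: le_trans (sorted_le x kj) _.
  by rewrite /xi ler_pdivlMr // mulrC.
have lo j : (j < K - k)%N -> xi < (s x)`_j.
  move=> jk; have k1 : (k < K)%N by rewrite -subn_gt0; apply: leq_ltn_trans jk.
  apply: lt_le_trans (sorted_le x (_ : j <= (K - k).-1)%N); last by rewrite -ltnS prednK //; apply: leq_ltn_trans jk.
  have := hk k.+1; rewrite leqnn k1 => /(_ isT).
  rewrite /tail_sum subnS big_ltn; last first.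
    by apply: leq_ltn_trans (leq_pred _) _; apply: leq_ltn_trans Kn'; apply: leq_subr.
  rewrite prednK ?subn_gt0 // -[X in _ + X]/(tail_sum nrm x K k) -/S -addn1 natrD mulrDl mul1r addrC ltrD2r.
  by rewrite /xi ltr_pdivrMr // mulrC.
have split (G : R -> R) : \sum_i G (a x i) = \sum_(0 <= j < (K - k)%N) G (s x)`_j + \sum_((K - k)%N <= j < n) G (s x)`_j.
  by rewrite -sum_sorted (@big_cat_nat _ _ _ (K - k)) //=; apply: ltnW; apply: leq_ltn_trans Kn'; apply: leq_subr.
split=> //.
- rewrite (split (fun r => Num.min 1 (r / xi))).
  rewrite (@eq_big_nat _ _ _ _ _ _ (fun=> 1)); last first.
    move=> j /andP[_ jk]; apply/min_idPl; rewrite ler_pdivlMr // mul1r; exact/ltW/lo.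
  rewrite [X in _ + X](@eq_big_nat _ _ _ _ _ _ (fun j => (s x)`_j / xi)); last first.
    move=> j /andP[jk _]; apply/min_idPr; rewrite ler_pdivrMr // mul1r; exact: hi.
  rewrite -mulr_suml -/(tail_sum nrm x K k) -/S sumr_const_nat subn0.
  have -> : S / xi = k%:R by rewrite /xi invf_div mulrCA divff ?mulr1 // lt0r_neq0.
  by rewrite -natrD subnK.
- rewrite (split (fun r => r ^+ 2)) (split (fun r => if xi <= r then r ^+ 2 else xi * r)) /tail_sum2.
  have -> : k%:R^-1 * S ^+ 2 = xi * S by rewrite /xi expr2; ring.
  have E (p q r : R) : p - q + (r + q) = r + p by ring.
  rewrite E; congr (_ + _).
    by apply: eq_big_nat => j /andP[_ jk]; rewrite ltW ?lo.
  rewrite /S /tail_sum mulr_sumr; apply: eq_big_nat => j /andP[jk _].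
  case: ifP => // xs; have -> : (s x)`_j = xi by apply: le_anti; rewrite xs hi.
  by rewrite expr2.
Qed.

(** Weak duality with the multiplier [xi ^+ 2] for the mass constraint: for each entry,
    [a^2 / th + xi^2 th] is minimal over [[0, 1]] at [th = min 1 (a / xi)]. *)
Lemma Q2_le x (th : 'I_n -> R) : (forall i, 0 <= th i <= 1) -> (forall i, x i 0 != 0 -> 0 < th i) ->
  \sum_i th i <= K%:R -> Q2 nrm K x + \sum_i a x i ^+ 2 <= \sum_i a x i ^+ 2 / th i.
Proof.
move=> t01 tp tK.
have [cK|cK] := leqP (Defs.card x) K.
  rewrite Q2_sparse // add0r; apply: ler_sum => i _; case/andP: (t01 i) => t0 t1.
  have [/eqP|/tp tp'] := eqVneq (x i 0) 0; first by rewrite -nrm_eq0 => /eqP->; rewrite expr0n mul0r.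
  by rewrite ler_pdivlMr // ler_piMr // sqr_ge0.
have [xi [xi0 s1 s2]] := Q2_attained cK; rewrite s2.
suff H : \sum_i ((if xi <= a x i then a x i ^+ 2 else xi * a x i) + xi ^+ 2 * (Num.min 1 (a x i / xi) - th i)) <= \sum_i a x i ^+ 2 / th i.
  apply: le_trans H; rewrite big_split /= -mulr_sumr sumrB s1 lerDl mulr_ge0 ?sqr_ge0 ?subr_ge0 //.
apply: ler_sum => i _; case/andP: (t01 i) => t0 t1.
have a0 := nrm_ge0 (x i 0); set r := nrm (x i 0) in a0 *.
have [x0|/tp tp'] := eqVneq (x i 0) 0.
  have r0 : r = 0 by apply/eqP; rewrite /r nrm_eq0 x0.
  rewrite r0 expr0n /= !mul0r mulr0 if_same [Num.min _ _]min_r ?ler01 //.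
  by rewrite add0r sub0r mulrN oppr_le0 mulr_ge0 // sqr_ge0.
rewrite ler_pdivlMr //; case: (lerP xi r) => xr.
  rewrite min_l; last by rewrite ler_pdivlMr // mul1r.
  have : 0 <= (1 - th i) * (r ^+ 2 - xi ^+ 2 * th i).
    rewrite mulr_ge0 ?subr_ge0 //; apply: (@le_trans _ _ (xi ^+ 2 * 1)).
      by rewrite ler_wpM2l ?sqr_ge0.
    by rewrite mulr1 ler_pXn2r // nnegrE // ltW.
  by lra.
rewrite min_r; last by rewrite ler_pdivrMr // mul1r ltW.
have -> : xi * r + xi ^+ 2 * (r / xi - th i) = 2 * xi * r - xi ^+ 2 * th i by field; rewrite lt0r_neq0.
by have := sqr_ge0 (r - xi * th i); lra.
Qed.
End QTwo.

(** * Continuity and compactness *)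

Section Cont.
Import topology normedtype derive numFieldNormedType.Exports.
Variables (R : realType) (p : nat).
Variant cont (f : 'rV[R]_p -> R) : Prop :=
  Cont of (forall v, {for v, continuous f}).
Implicit Types f g : 'rV[R]_p -> R.
Lemma cont_cst a : cont (fun _ : 'rV[R]_p => a).
Proof. by split=> v; apply: cst_continuous. Qed.
Lemma cont_coord i : cont (fun v : 'rV[R]_p => v 0 i).
Proof. by split=> v; apply: coord_continuous. Qed.
Lemma contD f g : cont f -> cont g -> cont (fun v => f v + g v).
Proof. by case=> hf [hg]; split=> v; apply: continuousD; [exact: hf|exact: hg]. Qed.
Lemma contM f g : cont f -> cont g -> cont (fun v => f v * g v).
Proof. by case=> hf [hg]; split=> v; apply: continuousM; [exact: hf|exact: hg]. Qed.
Lemma contB f g : cont f -> cont g -> cont (fun v => f v - g v).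
Proof. by case=> hf [hg]; split=> v; apply: continuousB; [exact: hf|exact: hg]. Qed.
Lemma cont_ext f g : f =1 g -> cont f -> cont g.
Proof. by move=> /funext->. Qed.
Lemma cont_sum (I : Type) (r : seq I) (F : I -> 'rV[R]_p -> R) :
  (forall i, cont (F i)) -> cont (fun v => \sum_(i <- r) F i v).
Proof.
move=> h; elim: r => [|i r IH].
  by refine (cont_ext _ (cont_cst 0)) => v; rewrite big_nil.
by refine (cont_ext _ (contD (h i) IH)) => v; rewrite big_cons.
Qed.
Lemma contX2 f : cont f -> cont (fun v => f v ^+ 2).
Proof. by move=> h; refine (cont_ext _ (contM h h)) => v; rewrite expr2. Qed.

(** [c1] is meant for the mass constraint. The two-sided bound on [c2] covers both a sphere, with
    [lo = hi], and a ball, with [lo = 0]. *)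
Lemma box_min (rho : 'I_p -> R) (J c1 c2 : 'rV[R]_p -> R) (k lo hi : R) :
  cont J -> cont c1 -> cont c2 ->
  let ok (v : 'rV[R]_p) := [/\ forall i, `|v 0 i| <= rho i, c1 v <= k, lo <= c2 v & c2 v <= hi] in
  (exists v, ok v) -> exists2 v, ok v & forall v', ok v' -> J v <= J v'.
Proof.
move=> [hJ] [h1] [h2] ok [v0 ok0].
pose box := [set v : 'rV[R]_p | forall i, `[- rho i, rho i]%classic (v ord0 i)]%classic.
have cb : compact box := @rV_compact R p (fun i => `[- rho i, rho i]%classic) (fun i => @segment_compact R _ _).
pose C := (box `&` ((c1 @^-1` [set x | x <= k]) `&` ((c2 @^-1` [set x | lo <= x]) `&` (c2 @^-1` [set x | x <= hi]))))%classic.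
have cC : compact C.
  apply: compact_closedI => //; apply: closedI; last apply: closedI.
  - by apply: closed_comp => [x _|]; [exact: h1|exact: closed_le].
  - by apply: closed_comp => [x _|]; [exact: h2|exact: closed_ge].
  - by apply: closed_comp => [x _|]; [exact: h2|exact: closed_le].
have okC v : ok v <-> C v.
  split=> [[b a1 a2 a3]|[b [a1 [a2 a3]]]].
    split; [move=> i; rewrite /= in_itv /= -ler_norml; exact: b|by split].
  by split => // i; have := b i; rewrite /= in_itv /= -ler_norml.
have C0 : (C !=set0)%classic by exists v0; apply/okC.
have cJ : {within C, continuous J}%classic by apply: continuous_subspaceT => v; apply: hJ.
have [c cC' cm] := compact_EVT_min C0 cC cJ.
exists c; first by apply/okC; apply: set_mem.
by move=> v' /okC v'C; apply: cm; apply: mem_set.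
Qed.
End Cont.

(** * Elementary tools for perturbation arguments *)

Lemma cauchy_schwarz (R : realFieldType) (W : lmodType R) (g : W -> W -> R) :
  (forall x y, g x y = g y x) -> (forall x y z, g (x + y) z = g x z + g y z) ->
  (forall a x z, g (a *: x) z = a * g x z) -> (forall x, 0 <= g x x) ->
  forall x y, g x y ^+ 2 <= g x x * g y y.
Proof.
move=> gC gD gZ g0 x y.
have H t : 0 <= g x x - 2 * t * g x y + t ^+ 2 * g y y.
  have := g0 (x - t *: y); rewrite -/(sqn g _) nqB // nqZ // gZr // /sqn.
  by rewrite mulrA.
have := g0 y; rewrite le_eqVlt => /predU1P[y0|yp].
  have [->|xy0] := eqVneq (g x y) 0; first by rewrite expr0n /= mulr_ge0.
  have := H ((g x x + 1) / (2 * g x y)); rewrite -y0 mulr0 addr0.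
  have -> : 2 * ((g x x + 1) / (2 * g x y)) * g x y = g x x + 1 by field.
  by lra.
have := H (g x y / g y y).
have -> : g x x - 2 * (g x y / g y y) * g x y + (g x y / g y y) ^+ 2 * g y y = (g x x * g y y - g x y ^+ 2) / g y y.
  by field; rewrite lt0r_neq0.
by rewrite pmulr_lge0 ?invr_gt0 // subr_ge0.
Qed.

Lemma first_order (R : realFieldType) (a c t0 : R) :
  0 < t0 -> (forall t, 0 < t -> t < t0 -> 0 <= a * t + c * t ^+ 2) -> 0 <= a.
Proof.
move=> t0p H; rewrite leNgt; apply/negP => an.
pose t := Num.min (t0 / 2) (- a / (2 * (`|c| + 1))).
have c1 : 0 < `|c| + 1 by rewrite ltr_wpDl.
have tp : 0 < t by rewrite lt_min !divr_gt0 ?mulr_gt0 ?oppr_gt0.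
have tt : t < t0 by rewrite gt_min; apply/orP; left; lra.
have := H t tp tt.
have t2 : t * (`|c| + 1) <= - a / 2.
  rewrite -ler_pdivlMr //; have : t <= - a / (2 * (`|c| + 1)) by rewrite ge_min lexx orbT.
  by rewrite invfM mulrA.
have : c * t ^+ 2 <= t * (t * (`|c| + 1)).
  rewrite mulrA -expr2 mulrC ler_wpM2l ?sqr_ge0 // (le_trans (ler_norm _)) // lerDl ler01 //.
have : t * (t * (`|c| + 1)) <= t * (- a / 2) by rewrite ler_wpM2l // ltW.
have : 0 < t * - a by rewrite mulr_gt0 // oppr_gt0.
lra.
Qed.

Lemma sum_upd1 (R : zmodType) (n : nat) (G G' : 'I_n -> R) i :
  (forall k, k != i -> G' k = G k) -> \sum_k G' k = \sum_k G k + (G' i - G i).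
Proof.
move=> h; rewrite (bigD1 i) //= [\sum_k G k](bigD1 i) //= (eq_bigr G) //.
by rewrite [G i + _]addrC -addrA [G i + _]addrC subrK addrC.
Qed.

Lemma sum_upd2 (R : zmodType) (n : nat) (G G' : 'I_n -> R) i j : i != j ->
  (forall k, k != i -> k != j -> G' k = G k) ->
  \sum_k G' k = \sum_k G k + (G' i - G i) + (G' j - G j).
Proof.
move=> ij h; pose H k := if k == i then G' i else G k.
rewrite (@sum_upd1 _ _ H G' j).
  rewrite (@sum_upd1 _ _ G H i) /H ?eqxx; last by move=> k /negPf->.
  by rewrite eq_sym (negPf ij).
by move=> k kj; rewrite /H; case: eqVneq => [->//|ki]; apply: h.
Qed.

(* The coordinate space over F = R or C viewed as a real vector space. *)
Definition realified (R : realType) (F : comNzRingType) (io : {rmorphism R -> F}) (n : nat) := 'cV[F]_n.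

Section Realified.
Variables (R : realType) (F : comNzRingType) (io : {rmorphism R -> F}) (n : nat).
HB.instance Definition _ := GRing.Zmodule.on (realified io n).
Definition rscale (a : R) (v : realified io n) : realified io n := io a *: (v : 'cV[F]_n).
Fact rscaleA a b v : rscale a (rscale b v) = rscale (a * b) v.
Proof. by rewrite /rscale scalerA rmorphM. Qed.
Fact rscale1 : left_id 1 rscale.
Proof. by move=> v; rewrite /rscale rmorph1 scale1r. Qed.
Fact rscaleDr : right_distributive rscale +%R.
Proof. by move=> a u v; rewrite /rscale scalerDr. Qed.
Fact rscaleDl v : {morph rscale^~ v : a b / a + b}.
Proof. by move=> a b; rewrite /rscale rmorphD scalerDl. Qed.
HB.instance Definition _ := GRing.Zmodule_isLmodule.Build R (realified io n) rscaleA rscale1 rscaleDr rscaleDl.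
End Realified.

(** * Real inner products over the scalar field *)

Section Scalars.
Variables (R : realType) (F : comNzRingType) (iota : {rmorphism R -> F}).
Variables (cj : F -> F) (nrm re : F -> R).
Hypothesis reD : forall x y, re (x + y) = re x + re y.
Hypothesis reZ : forall a x, re (iota a * x) = a * re x.
Hypothesis cjD : forall x y, cj (x + y) = cj x + cj y.
Hypothesis cjM : forall x y, cj (x * y) = cj x * cj y.
Hypothesis cjK : forall x, cj (cj x) = x.
Hypothesis cj_iota : forall a, cj (iota a) = iota a.
Hypothesis re_cj : forall x, re (cj x) = re x.
Hypothesis nrm_ge0 : forall x, 0 <= nrm x.
Hypothesis nrm_eq0 : forall x, (nrm x == 0) = (x == 0).
Hypothesis nrm2 : forall x, nrm x ^+ 2 = re (cj x * x).

Local Notation RV := (realified iota).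
Definition dot (x y : F) := re (cj x * y).
Lemma dotC x y : dot x y = dot y x.
Proof. by rewrite /dot -re_cj cjM cjK mulrC. Qed.
Lemma dotDl x y z : dot (x + y) z = dot x z + dot y z.
Proof. by rewrite /dot cjD mulrDl reD. Qed.
Lemma dotZl a x z : dot (iota a * x) z = a * dot x z.
Proof. by rewrite /dot cjM cj_iota -mulrA reZ. Qed.
Lemma dot_nrm x : dot x x = nrm x ^+ 2. Proof. by rewrite nrm2. Qed.
Lemma re0 : re 0 = 0.
Proof. by have := reZ 0 0; rewrite mulr0 mul0r. Qed.
Lemma dot0r x : dot x 0 = 0. Proof. by rewrite /dot mulr0 re0. Qed.
Lemma dot0l x : dot 0 x = 0. Proof. by rewrite dotC dot0r. Qed.
Lemma re_sum (I : Type) (r : seq I) (P : pred I) (f : I -> F) :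
  re (\sum_(i <- r | P i) f i) = \sum_(i <- r | P i) re (f i).
Proof. by elim/big_rec2: _ => [|i a b _ <-]; rewrite ?re0 // reD. Qed.
Lemma dotNr x y : dot x (- y) = - dot x y.
Proof. by apply/eqP; rewrite -addr_eq0 dotC [dot x y]dotC -dotDl addNr dot0l. Qed.
Lemma nrm0 : nrm 0 = 0. Proof. by apply/eqP; rewrite nrm_eq0. Qed.
Lemma nrmN x : nrm (- x) = nrm x.
Proof. by apply/eqP; rewrite -(@eqrXn2 _ 2) // -!dot_nrm dotNr dotC dotNr opprK. Qed.
Lemma nrm_sub x y : nrm (x - y) ^+ 2 = nrm x ^+ 2 - 2 * dot x y + nrm y ^+ 2.
Proof.
rewrite -!dot_nrm dotDl [dot x (x - y)]dotC [dot (- y) (x - y)]dotC !dotDl.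
rewrite [dot (- y) x]dotC !dotNr [dot (- y) y]dotC dotNr; ring.
Qed.
Lemma nrmZ a x : nrm (iota a * x) = `|a| * nrm x.
Proof.
apply/eqP; rewrite -(@eqrXn2 _ 2) // ?mulr_ge0 // exprMn -!dot_nrm dotZl dotC dotZl mulrA -expr2.
by rewrite real_normK // num_real.
Qed.

Definition ip k (u v : RV k) : R := \sum_i dot (u i 0) (v i 0).
Lemma ipC k (u v : RV k) : ip u v = ip v u.
Proof. by apply: eq_bigr => i _; rewrite dotC. Qed.
Lemma ipD k (u v z : RV k) : ip (u + v) z = ip u z + ip v z.
Proof. by rewrite -big_split; apply: eq_bigr => i _; rewrite mxE dotDl. Qed.
Lemma ipZ k a (u z : RV k) : ip (a *: u) z = a * ip u z.
Proof. by rewrite mulr_sumr; apply: eq_bigr => i _; rewrite mxE dotZl. Qed.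
Lemma ip_ge0 k (u : RV k) : 0 <= ip u u.
Proof. by apply: sumr_ge0 => i _; rewrite dot_nrm sqr_ge0. Qed.
Lemma ip_eq0 k (u : RV k) : ip u u = 0 -> u = 0.
Proof.
move/psumr_eq0P => h; apply/matrixP => i j; rewrite ord1 mxE; apply/eqP.
rewrite -nrm_eq0 -sqrf_eq0 -dot_nrm h // => l _.
by rewrite dot_nrm sqr_ge0.
Qed.
Lemma norm2E k (u : RV k) : norm2 nrm u ^+ 2 = ip u u.
Proof.
rewrite /norm2 sqr_sqrtr ?sumr_ge0 // => [|i _]; last by rewrite sqr_ge0.
by apply: eq_bigr => i _; rewrite dot_nrm.
Qed.
Lemma norm2_ge0 k (u : 'cV[F]_k) : 0 <= norm2 nrm u. Proof. exact: sqrtr_ge0. Qed.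
Lemma norm2Z k a (u : RV k) : norm2 nrm (a *: u) = `|a| * norm2 nrm u.
Proof.
apply/eqP; rewrite -(@eqrXn2 _ 2) // ?mulr_ge0 ?norm2_ge0 // exprMn !norm2E ipZ ipC ipZ mulrA -expr2.
by rewrite real_normK // num_real.
Qed.
Lemma ip_adj m n (A : 'M[F]_(m, n)) (u : RV n) (v : RV m) :
  ip (A *m u : RV m) v = ip u (adj cj A *m v : RV n).
Proof.
transitivity (\sum_i \sum_k re (cj (A i k) * cj (u k 0) * v i 0)).
  apply: eq_bigr => i _; rewrite mxE dotC /dot mulr_sumr re_sum; apply: eq_bigr => k _.
  by rewrite -re_cj !cjM cjK mulrC.
rewrite exchange_big; apply: eq_bigr => k _; rewrite /dot mxE mulr_sumr re_sum.
by apply: eq_bigr => i _; rewrite mxE; congr re; ring.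
Qed.

Definition sg n (i : 'I_n) (z : F) : RV n := \col_k (if k == i then z else 0).
Lemma sgE n (i : 'I_n) z k : sg i z k 0 = if k == i then z else 0.
Proof. by rewrite mxE. Qed.
Lemma ip_sg n (i : 'I_n) z (v : RV n) : ip (sg i z) v = dot z (v i 0).
Proof.
rewrite /ip (bigD1 i) //= sgE eqxx big1 ?addr0 // => k /negPf ki.
by rewrite sgE ki dot0l.
Qed.
Lemma sum_sg n (v : RV n) : \sum_i sg i (v i 0) = v.
Proof.
apply/matrixP => k j; rewrite ord1 summxE (bigD1 k) //= sgE eqxx big1 ?addr0 // => i /negPf ik.
by rewrite sgE eq_sym ik.
Qed.
Lemma sgZ n (i : 'I_n) a z : a *: sg i z = sg i (iota a * z).
Proof. by apply/matrixP => k j; rewrite ord1 mxE !sgE; case: eqP => _ //; rewrite mulr0. Qed.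
Lemma sgN n (i : 'I_n) z : sg i (- z) = - sg i z.
Proof. by apply/matrixP => k j; rewrite ord1 sgE [RHS]mxE sgE; case: eqP => _ //; rewrite oppr0. Qed.
Lemma ip_CS k (u v : RV k) : ip u v ^+ 2 <= ip u u * ip v v.
Proof. by apply: cauchy_schwarz; [exact: ipC|exact: ipD|exact: ipZ|exact: ip_ge0]. Qed.
Lemma dot_le x y : `|dot x y| <= nrm x * nrm y.
Proof.
rewrite -(@ler_pXn2r _ 2) ?nnegrE ?mulr_ge0 // real_normK ?num_real // exprMn -!dot_nrm.
by have := ip_CS (sg (0 : 'I_1) x) (sg 0 y); rewrite !ip_sg !sgE eqxx.
Qed.
Lemma mulmx_rD m n (A : 'M[F]_(m, n)) (u v : RV n) : (A *m (u + v) : RV m) = (A *m u : RV m) + (A *m v : RV m).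
Proof. exact: mulmxDr. Qed.
Lemma mulmx_rZ m n (A : 'M[F]_(m, n)) a (u : RV n) : (A *m (a *: u) : RV m) = a *: (A *m u : RV m).
Proof. exact: (esym (scalemxAr (iota a) A u)). Qed.
Lemma ipDsq k (u v : RV k) t : ip (u + t *: v) (u + t *: v) = ip u u + 2 * t * ip u v + t ^+ 2 * ip v v.
Proof. rewrite ipD [ip u _]ipC [ip (_ *: _) _]ipC !ipD !ipZ [ip v (_ *: _)]ipC [ip u (_ *: _)]ipC !ipZ [ip v u]ipC; ring. Qed.

(** * First- and second-order conditions *)

Section Local.
Variables (m n K : nat) (A : 'M[F]_(m, n)) (b : RV m) (y : RV n) (th : 'I_n -> R).
Hypothesis K0 : (0 < K)%N.
Hypothesis Kn : (K <= n)%N.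
Hypothesis lm : local_min nrm (KKreg nrm A b K) y.
Hypothesis th01 : forall i, 0 <= th i <= 1.
Hypothesis thy : forall i, y i 0 != 0 -> 0 < th i.
Hypothesis thK : \sum_i th i <= K%:R.
Hypothesis thQ : Q2 nrm K y + \sum_i nrm (y i 0) ^+ 2 = \sum_i nrm (y i 0) ^+ 2 / th i.
Let E : RV m := A *m y - b.

(** Admissible weights [th'] bound the envelope at [y + t v] from above, with equality for [th] at
    [y]. Hence local minimality passes to the objective in which the weights are free, and point and
    weights may be moved together. *)
Lemma local_path (v : RV n) : exists2 d, 0 < d & forall t th', `|t| < d ->
  (forall i, 0 <= th' i <= 1) -> (forall i, (y + t *: v) i 0 != 0 -> 0 < th' i) -> \sum_i th' i <= K%:R ->
  0 <= (\sum_i nrm ((y + t *: v) i 0) ^+ 2 / th' i - \sum_i nrm (y i 0) ^+ 2 / th i)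
    - (\sum_i nrm ((y + t *: v) i 0) ^+ 2 - \sum_i nrm (y i 0) ^+ 2)
    + (2 * t * ip E (A *m v : RV m) + t ^+ 2 * ip (A *m v : RV m) (A *m v : RV m)).
Proof.
case: lm => d d0 H; have v0 : 0 < norm2 nrm v + 1 by rewrite ltr_wpDl // norm2_ge0.
exists (d / (norm2 nrm v + 1)); first exact: divr_gt0.
move=> t th' td t01 tp tK.
have := H (y + t *: v).
have -> : (y + t *: v : 'cV_n) - y = t *: v :> RV n by rewrite addrC addKr.
rewrite norm2Z => /(_ _); have -> : `|t| * norm2 nrm v < d.
  apply: le_lt_trans (_ : `|t| * (norm2 nrm v + 1) < d); last by rewrite -ltr_pdivlMr.
  by rewrite ler_wpM2l // lerDl.
move=> /(_ isT); rewrite /KKreg !(norm2E (k := m)).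
have := Q2_le nrm_ge0 nrm_eq0 K0 Kn t01 tp tK.
have -> : (A *m (y + t *: v : RV n) - b : RV m) = E + t *: (A *m v : RV m).
  by rewrite mulmx_rD mulmx_rZ /E addrAC.
rewrite ipDsq -/E; have := thQ; lra.
Qed.

Lemma stationary_ge i z : 0 < th i -> 0 <= ip E (A *m sg i z : RV m) + ((th i)^-1 - 1) * dot (y i 0) z.
Proof.
move=> ti; have [d d0 H] := local_path (sg i z).
set v := sg i z in H *.
suff : 0 <= 2 * (ip E (A *m v : RV m) + ((th i)^-1 - 1) * dot (y i 0) z) by rewrite pmulr_rge0.
apply: (@first_order _ _ (((th i)^-1 - 1) * nrm z ^+ 2 + ip (A *m v : RV m) (A *m v : RV m)) d) => // t t0 td.
have := H t th; rewrite gtr0_norm // => /(_ td th01 _ thK).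
have yk k : k != i -> (y + t *: v) k 0 = y k 0.
  by move=> /negPf ki; rewrite mxE [(t *: v) k 0]mxE sgE ki mulr0 addr0.
have yi : nrm ((y + t *: v) i 0) ^+ 2 = nrm (y i 0) ^+ 2 + 2 * t * dot (y i 0) z + t ^+ 2 * nrm z ^+ 2.
  rewrite mxE [(t *: v) i 0]mxE sgE eqxx -!dot_nrm !dotDl ![dot _ (_ + _)]dotC !dotDl !dotZl.
  rewrite ![dot _ (iota t * z)]dotC !dotZl [dot z (y i 0)]dotC; ring.
have sp k : (y + t *: v) k 0 != 0 -> 0 < th k.
  by have [->//|ki] := eqVneq k i; rewrite yk //; apply: thy.
move=> /(_ sp).
have e1 : \sum_k nrm ((y + t *: v) k 0) ^+ 2 / th k = \sum_k nrm (y k 0) ^+ 2 / th k +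
    (nrm ((y + t *: v) i 0) ^+ 2 / th i - nrm (y i 0) ^+ 2 / th i).
  by apply: sum_upd1 => k ki; rewrite yk.
have e2 : \sum_k nrm ((y + t *: v) k 0) ^+ 2 = \sum_k nrm (y k 0) ^+ 2 +
    (nrm ((y + t *: v) i 0) ^+ 2 - nrm (y i 0) ^+ 2).
  by apply: sum_upd1 => k ki; rewrite yk.
by rewrite e1 e2 yi; lra.
Qed.

Lemma stationary i z : 0 < th i -> ip E (A *m sg i z : RV m) = - ((th i)^-1 - 1) * dot (y i 0) z.
Proof.
move=> ti; apply/eqP; rewrite mulNr -addr_eq0; apply/eqP/le_anti.
rewrite stationary_ge // andbT.
have := @stationary_ge i (- z) ti.
have -> : (A *m sg i (- z) : RV m) = - (A *m sg i z : RV m) by rewrite sgN; exact: mulmxN.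
rewrite dotNr [ip E _]ipC -scaleN1r ipZ [ip _ E]ipC; lra.
Qed.

Lemma stationary_off_ge i i0 z : y i 0 = 0 -> y i0 0 != 0 ->
  0 <= ip E (A *m sg i z : RV m) + nrm (y i0 0) / th i0 * nrm z.
Proof.
move=> yi yi0.
have [z0|z0] := eqVneq z 0.
  have -> : sg i z = 0 :> RV n by apply/matrixP => k j; rewrite ord1 sgE z0 mxE; case: eqP.
  have -> : (A *m (0 : RV n) : RV m) = 0 by exact: mulmx0.
  by rewrite z0 nrm0 mulr0 addr0 ipC -(scale0r (0 : RV m)) ipZ mul0r.
have nz : 0 < nrm z by rewrite lt_neqAle nrm_ge0 andbT eq_sym nrm_eq0.
have a0 : 0 < nrm (y i0 0) by rewrite lt_neqAle nrm_ge0 andbT eq_sym nrm_eq0.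
have t0 := thy yi0; have ii : i != i0 by apply: contraNneq yi0 => <-; rewrite yi.
case/andP: (th01 i0) => _ t1; case/andP: (th01 i) => ti0 _.
set v := sg i z; have [d d0 H] := local_path v.
set a := nrm (y i0 0) in a0 *; set T0 := th i0 in t0 t1 *.
suff : 0 <= 2 * (ip E (A *m v : RV m) + a / T0 * nrm z) by rewrite pmulr_rge0.
apply: (@first_order _ _ (2 * nrm z ^+ 2 / T0 - nrm z ^+ 2 + ip (A *m v : RV m) (A *m v : RV m)) (Num.min d (a / (2 * nrm z)))).
  by rewrite lt_min d0 divr_gt0 // mulr_gt0.
move=> t tp; rewrite lt_min => /andP[td ta].
(* The new entry takes the share [q] of the weight of [i0], in proportion to the magnitudes. To
   first order the new term and the loss at [i0] each cost [t * (a / T0 * nrm z)], whence the factor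
   2 above. *)
pose q := t * nrm z / a; have q0 : 0 < q by rewrite divr_gt0 // mulr_gt0.
have q1 : q < 1/2.
  rewrite /q ltr_pdivrMr //; move: ta; rewrite ltr_pdivlMr ?mulr_gt0 //; lra.
pose th' k := if k == i then q * T0 else if k == i0 then T0 - q * T0 else th k.
have qT0 : 0 < q * T0 by apply: mulr_gt0.
have qT1 : q * T0 < 1/2 by apply: le_lt_trans q1; rewrite ler_piMr // ltW.
have qT2 : 0 < T0 - q * T0 by rewrite -[X in X - _]mul1r -mulrBl mulr_gt0 // subr_gt0; lra.
have i0i : i0 != i by rewrite eq_sym.
have := H t th'; rewrite gtr0_norm // => /(_ td).
have -> : (forall k, 0 <= th' k <= 1) = true :> Prop.
  rewrite propeqE; split => // _ k; rewrite /th'; case: eqP => _; first by apply/andP; split; lra.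
  by case: eqP => _ //; apply/andP; split; lra.
move=> /(_ isT).
have yk k : k != i -> (y + t *: v) k 0 = y k 0.
  by move=> /negPf ki; rewrite mxE [(t *: v) k 0]mxE sgE ki mulr0 addr0.
have sp k : (y + t *: v) k 0 != 0 -> 0 < th' k.
  have [->|ki] := eqVneq k i; first by rewrite /th' eqxx.
  by rewrite yk // /th' (negPf ki); case: (k == i0) => //; apply: thy.
move=> /(_ sp).
have sK : \sum_k th' k <= K%:R.
  rewrite (@sum_upd2 _ _ th th' i i0 ii); last by move=> k /negPf ki /negPf ki0; rewrite /th' ki ki0.
  by rewrite /th' !eqxx (negPf i0i); have := thK; rewrite -/T0; lra.
move=> /(_ sK).
have ny : nrm ((y + t *: v) i 0) ^+ 2 = t ^+ 2 * nrm z ^+ 2.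
  by rewrite mxE [(t *: v) i 0]mxE sgE eqxx yi add0r nrmZ exprMn real_normK // num_real.
have e1 : \sum_k nrm ((y + t *: v) k 0) ^+ 2 / th' k = \sum_k nrm (y k 0) ^+ 2 / th k +
    t ^+ 2 * nrm z ^+ 2 / (q * T0) + (a ^+ 2 / (T0 - q * T0) - a ^+ 2 / T0).
  rewrite (@sum_upd2 _ _ (fun k => nrm (y k 0) ^+ 2 / th k) _ i i0 ii); last first.
    by move=> k ki /negPf ki0; rewrite yk // /th' (negPf ki) ki0.
  by rewrite ny yk // /th' !eqxx (negPf i0i) yi nrm0 expr0n mul0r subr0.
have e2 : \sum_k nrm ((y + t *: v) k 0) ^+ 2 = \sum_k nrm (y k 0) ^+ 2 + t ^+ 2 * nrm z ^+ 2.
  rewrite (@sum_upd1 _ _ (fun k => nrm (y k 0) ^+ 2) _ i) ?ny ?yi ?nrm0 ?expr0n ?subr0 // => k ki.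
  by rewrite yk.
rewrite e1 e2.
have -> : t ^+ 2 * nrm z ^+ 2 / (q * T0) = t * (a / T0 * nrm z).
  by rewrite /q; field; rewrite !lt0r_neq0.
have inv : (1 - q)^-1 <= 1 + q + 2 * q ^+ 2.
  rewrite -div1r ler_pdivrMr; last by lra.
  have : 0 <= q ^+ 2 * (1 - 2 * q) by rewrite mulr_ge0 ?sqr_ge0 //; lra.
  lra.
have : a ^+ 2 / (T0 - q * T0) - a ^+ 2 / T0 <= t * (a / T0 * nrm z) + t ^+ 2 * (2 * nrm z ^+ 2 / T0).
  have -> : a ^+ 2 / (T0 - q * T0) = a ^+ 2 / T0 * (1 - q)^-1.
    have n1 : 1 - q != 0 by rewrite lt0r_neq0 // subr_gt0; lra.
    by field; rewrite ?n1 ?(lt0r_neq0 t0) ?(lt0r_neq0 qT2).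
  have h : a ^+ 2 / T0 * (1 - q)^-1 <= a ^+ 2 / T0 * (1 + q + 2 * q ^+ 2).
    by rewrite ler_wpM2l // divr_ge0 ?sqr_ge0 // ltW.
  have -> : t * (a / T0 * nrm z) + t ^+ 2 * (2 * nrm z ^+ 2 / T0) = a ^+ 2 / T0 * (q + 2 * q ^+ 2).
    by rewrite /q; field; rewrite !lt0r_neq0.
  lra.
lra.
Qed.

Lemma stationary_off i i0 z : y i 0 = 0 -> y i0 0 != 0 ->
  `|ip E (A *m sg i z : RV m)| <= nrm (y i0 0) / th i0 * nrm z.
Proof.
move=> yi yi0; have h1 := stationary_off_ge z yi yi0; have := stationary_off_ge (- z) yi yi0.
have -> : (A *m sg i (- z) : RV m) = - (A *m sg i z : RV m) by rewrite sgN; exact: mulmxN.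
rewrite nrmN [ip E _]ipC -scaleN1r ipZ [ip _ E]ipC ler_norml; lra.
Qed.

(** With weights [th + r c] along [y + r v], each term with [c i != 0] becomes
    [xi^2 (th_i + r c_i)], so the weighted sum is constant when [c] has sum zero. The second-order
    terms that remain are [- xi^2 |c|^2] and [|A v|^2]. *)
Lemma local_second_order (xi : R) (c : 'I_n -> R) (v : RV n) :
  (forall i, c i != 0 -> 0 < th i < 1 /\ nrm (y i 0) = xi * th i) -> \sum_i c i = 0 ->
  (forall i, v i 0 = iota (c i / th i) * y i 0) ->
  xi ^+ 2 * (\sum_i c i ^+ 2) <= ip (A *m v : RV m) (A *m v : RV m).
Proof.
move=> cB c0 vE; have [d d0 H] := local_path v.
pose s i := if c i == 0 then 1 else Num.min (th i) (1 - th i) / (`|c i| + 1).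
have c1 i : 0 < `|c i| + 1 by rewrite ltr_wpDl.
have s0 i : 0 < s i.
  rewrite /s; have [//|/cB[/andP[h1 h2] _]] := eqVneq (c i) 0.
  by rewrite divr_gt0 // lt_min h1 subr_gt0.
pose t := Num.min d (\big[Num.min/1]_i s i) / 2.
have t0 : 0 < t.
  rewrite divr_gt0 // lt_min d0 /=; elim/big_ind: _ => // p q.
  by rewrite lt_min => -> ->.
have tm : t < Num.min d (\big[Num.min/1]_i s i) by rewrite /t ltr_pdivrMr // mulr2n mulrDr mulr1 ltrDl; move: t0; rewrite /t; lra.
have td : t < d by apply: lt_le_trans tm _; rewrite ge_min lexx.
have ts i : t < s i.
  by apply: lt_le_trans tm _; rewrite ge_min; apply/orP; right; apply: bigmin_le_cond.
have key r : `|r| = t -> 0 <= (2 * ip E (A *m v : RV m) - 2 * xi ^+ 2 * \sum_i th i * c i) * r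
    + (ip (A *m v : RV m) (A *m v : RV m) - xi ^+ 2 * \sum_i c i ^+ 2) * r ^+ 2.
  move=> rt; pose th' i := th i + r * c i.
  have rc i : c i != 0 -> `|r * c i| < th i /\ `|r * c i| < 1 - th i.
    move=> ci; have := ts i; rewrite /s (negPf ci) ltr_pdivlMr // => h.
    have : t * `|c i| < Num.min (th i) (1 - th i).
      by apply: le_lt_trans h; rewrite ler_wpM2l ?lerDl // ltW.
    by rewrite lt_min normrM rt => /andP[].
  have := H r th'; rewrite rt => /(_ td).
  have a1 i : 0 <= th' i <= 1.
    rewrite /th'; have [->|/rc[]] := eqVneq (c i) 0; first by rewrite mulr0 addr0.
    by rewrite !ltr_norml => /andP[? ?] /andP[? ?]; apply/andP; split; lra.
  have vi i : (y + r *: v) i 0 = iota (1 + r * (c i / th i)) * y i 0.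
    by rewrite mxE [(r *: v) i 0]mxE vE mulrA -rmorphM -[X in X + _]mul1r -mulrDl rmorphD rmorph1.
  have a2 i : (y + r *: v) i 0 != 0 -> 0 < th' i.
    rewrite /th'; have [c00|/rc[]] := eqVneq (c i) 0.
      by rewrite vi c00 mulr0 addr0 mul0r mulr0 addr0 rmorph1 mul1r; apply: thy.
    by rewrite !ltr_norml => /andP[? ?] _ _; lra.
  have sK : \sum_i th' i <= K%:R by rewrite big_split /= -mulr_sumr c0 mulr0 addr0.
  move=> /(_ a1 a2 sK).
  have n2 i : nrm ((y + r *: v) i 0) ^+ 2 = (1 + r * (c i / th i)) ^+ 2 * nrm (y i 0) ^+ 2.
    by rewrite vi nrmZ exprMn real_normK // num_real.
  have -> : \sum_i nrm ((y + r *: v) i 0) ^+ 2 / th' i = \sum_i nrm (y i 0) ^+ 2 / th i.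
    transitivity (\sum_i (nrm (y i 0) ^+ 2 / th i + xi ^+ 2 * r * c i)); last first.
      by rewrite big_split /= -mulr_sumr c0 mulr0 addr0.
    apply: eq_bigr => i _.
    rewrite n2 /th'; have [->|ci] := eqVneq (c i) 0.
      by rewrite mul0r !mulr0 !addr0 expr1n mul1r.
    have [/andP[h1 h2] e] := cB i ci; have [] := rc i ci; rewrite !ltr_norml => /andP[h3 h4] _.
    by rewrite e; field; rewrite lt0r_neq0 //= lt0r_neq0 //; lra.
  have -> : \sum_i nrm ((y + r *: v) i 0) ^+ 2 = \sum_i nrm (y i 0) ^+ 2 + xi ^+ 2 * (2 * r * (\sum_i th i * c i) + r ^+ 2 * \sum_i c i ^+ 2).
    transitivity (\sum_i (nrm (y i 0) ^+ 2 + xi ^+ 2 * (2 * r * (th i * c i) + r ^+ 2 * c i ^+ 2))); last first.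
      by rewrite big_split /= -mulr_sumr big_split /= -!mulr_sumr.
    apply: eq_bigr => i _.
    rewrite n2; have [->|ci] := eqVneq (c i) 0.
      by rewrite mul0r !mulr0 expr0n /= mulr0 !addr0 expr1n mul1r mulr0 addr0.
    have [/andP[h1 h2] e] := cB i ci.
    by rewrite e; field; rewrite lt0r_neq0.
  lra.
(* Adding the inequalities for the steps [t] and [- t] removes the first-order term. *)
have k1 := key t (gtr0_norm t0); have k2 := key (- t).
have {}k2 := k2 ltac:(by rewrite normrN gtr0_norm).
have : 0 <= (ip (A *m v : RV m) (A *m v : RV m) - xi ^+ 2 * \sum_i c i ^+ 2) * t ^+ 2.
  by move: k1 k2; rewrite sqrrN mulrN; lra.
by rewrite pmulr_lge0 ?exprn_gt0 // subr_ge0.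
Qed.
End Local.

(** * Uniqueness of local minimizers *)

Section Unique.
Variables (m n K : nat) (A : 'M[F]_(m, n)) (b : RV m) (S : {set 'I_n}) (u y : RV n) (kap m2 : R).
Hypothesis K0 : (0 < K)%N.
Hypothesis SK : #|S| = K.
Hypothesis uS : forall i, i \notin S -> u i 0 = 0.
Let r : RV m := b - A *m u.
Hypothesis rS : forall i z, i \in S -> ip r (A *m sg i z : RV m) = 0.
Hypothesis kap0 : 0 < kap.
Hypothesis kap1 : kap <= 1.
Hypothesis m20 : 0 < m2.
Hypothesis um : forall i, i \in S -> m2 <= nrm (u i 0) ^+ 2.
Hypothesis hom : ip r r * (1 + 2 * kap) < kap ^+ 2 * m2.
Hypothesis sparse : forall v : RV n, (#|Defs.supp v| <= K.*2)%N ->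
  (1 + kap) / 2 * ip v v <= ip (A *m v : RV m) (A *m v : RV m).
Hypothesis colA : forall i z, ip (A *m sg i z : RV m) (A *m sg i z : RV m) <= nrm z ^+ 2.
Hypothesis lm : local_min nrm (KKreg nrm A b K) y.
Let E : RV m := A *m y - b.
Let Kn : (K <= n)%N. Proof. by rewrite -SK -[X in (_ <= X)%N]card_ord max_card. Qed.

Let gA (v v' : RV n) := ip (A *m v : RV m) (A *m v' : RV m).
Let gC v v' : gA v v' = gA v' v. Proof. exact: ipC. Qed.
Let gD v v' z : gA (v + v') z = gA v z + gA v' z.
Proof. by rewrite /gA mulmx_rD ipD. Qed.
Let gZ a v z : gA (a *: v) z = a * gA v z.
Proof. by rewrite /gA mulmx_rZ ipZ. Qed.
Let g_ge0 v : 0 <= gA v v. Proof. exact: ip_ge0. Qed.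
Let wA (v : RV n) := ip r (A *m v : RV m).
Let wD v v' : wA (v + v') = wA v + wA v'.
Proof. by rewrite /wA mulmx_rD ipC ipD ![ip _ r]ipC. Qed.
Let wZ a v : wA (a *: v) = a * wA v.
Proof. by rewrite /wA mulmx_rZ ipC ipZ ipC. Qed.
Let wcs v : wA v ^+ 2 <= ip r r * gA v v. Proof. exact: ip_CS. Qed.
Let w_sum (v : RV n) : wA v = \sum_i wA (sg i (v i 0)).
Proof.
rewrite -{1}(sum_sg v); elim/big_rec2: _ => [|i a c _ <-]; last by rewrite wD.
by rewrite -(scale0r (0 : RV n)) wZ mul0r.
Qed.
Let g_sum v (v' : RV n) : gA v v' = \sum_i gA v (sg i (v' i 0)).
Proof. by rewrite -{1}(sum_sg v') (g_sumr gC gD gZ). Qed.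
Let EE v : ip E (A *m v : RV m) = gA (y - u) v - wA v.
Proof.
have -> : E = (A *m (y - u) : RV m) + (-1) *: r.
  have N : (A *m (- u : RV n) : RV m) = - (A *m u : RV m) by exact: mulmxN.
  by rewrite scaleN1r /r opprB mulmx_rD N addrA subrK.
by rewrite ipD ipZ mulN1r.
Qed.
Let om_lt : ip r r < kap ^+ 2 * m2.
Proof.
apply: le_lt_trans hom; rewrite mulrDr mulr1 lerDl mulr_ge0 ?ip_ge0 // mulr_ge0 // ltW //.
Qed.
(** Cauchy-Schwarz and the gap bound the left side strictly by [kap * nrm z] times the square root
    of [m2]; AM-GM does the rest. *)
Let w_lt i z : z != 0 -> wA (sg i z) < kap / 2 * (nrm z ^+ 2 + m2).
Proof.
move=> z0; have nz : 0 < nrm z by rewrite lt_neqAle nrm_ge0 andbT eq_sym nrm_eq0.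
have p : 0 < kap / 2 * (nrm z ^+ 2 + m2) by rewrite mulr_gt0 ?divr_gt0 // addr_gt0 // exprn_gt0.
rewrite ltNge; apply/negP => h.
have : (kap / 2 * (nrm z ^+ 2 + m2)) ^+ 2 <= wA (sg i z) ^+ 2 by rewrite ler_pXn2r // nnegrE ?ltW // (lt_le_trans p).
apply/negP; rewrite -ltNge; apply: le_lt_trans (wcs _) _.
apply: le_lt_trans (_ : ip r r * nrm z ^+ 2 < _).
  by rewrite ler_wpM2l ?ip_ge0 //; apply: colA.
apply: lt_le_trans (_ : kap ^+ 2 * m2 * nrm z ^+ 2 <= _).
  by rewrite ltr_pM2r // exprn_gt0.
have : 0 <= kap ^+ 2 * (nrm z ^+ 2 - m2) ^+ 2 by rewrite mulr_ge0 ?sqr_ge0.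
lra.
Qed.
Let w_S i z : i \in S -> wA (sg i z) = 0. Proof. exact: rS. Qed.
Let sg0 i : sg i 0 = 0 :> RV n.
Proof. by apply/matrixP => k j; rewrite ord1 sgE mxE; case: eqP. Qed.

(** Here [v = y - u] is [2K]-sparse, so [|A v|^2 - (1 + kap) / 2 |v|^2] can be estimated entry by
    entry: at most [c] on [S \ P] and below [- c] on [P \ S], with the same [c]. These sets have
    equal size when [#P = K]; otherwise [S \ P] is at least as large and [xi = 0] makes [c]
    negative. *)
Lemma unique_sparse (P : {set 'I_n}) (xi : R) : P = Defs.supp y ->
  0 <= xi -> (forall i, i \in P -> xi <= nrm (y i 0)) ->
  (forall i z, i \in P -> ip E (A *m sg i z : RV m) = 0) ->
  (forall i z, i \notin P -> `|ip E (A *m sg i z : RV m)| <= xi * nrm z) ->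
  (#|P| <= K)%N -> (xi = 0 \/ #|P| = K) -> y = u.
Proof.
move=> PE xi0 yP stP stN PK xiP.
have Py i : (i \in P) = (y i 0 != 0) by rewrite PE inE.
pose v : RV n := y - u; pose c := 1/2 * xi ^+ 2 - kap / 2 * m2.
have vE i : v i 0 = y i 0 - u i 0 by rewrite mxE [(- u) i 0]mxE.
pose D i := gA v (sg i (v i 0)) - (1 + kap) / 2 * nrm (v i 0) ^+ 2.
have D0 : 0 <= \sum_i D i.
  rewrite sumrB -g_sum -mulr_sumr subr_ge0.
  have -> : \sum_i nrm (v i 0) ^+ 2 = ip v v by apply: eq_bigr => i _; rewrite dot_nrm.
  apply: sparse; apply: leq_trans (_ : #|P :|: S| <= _)%N.
    apply: subset_leq_card; apply/fintype.subsetP => i; rewrite !inE vE Py; apply: contraR.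
    by rewrite negb_or negbK => /andP[/eqP-> /uS->]; rewrite subrr.
  by rewrite (leq_trans (leq_card_setU _ _)) // SK -addnn leq_add2r.
have gE i : gA v (sg i (v i 0)) = ip E (A *m sg i (v i 0) : RV m) + wA (sg i (v i 0)) by rewrite EE subrK.
pose B i : R := (if i \in S then if i \in P then - ((1 + kap) / 2 * nrm (v i 0) ^+ 2) else c
             else if i \in P then - c else 0).
have DB i : D i <= B i /\ (i \in P -> i \notin S -> D i < B i).
  rewrite /D /B gE; have [iS|iS] := boolP (i \in S); have [iP|iP] := boolP (i \in P).
  - by split=> //; rewrite stP // w_S // addr0 sub0r.
  - split=> //; rewrite w_S // addr0.
    have yi : y i 0 = 0 by apply/eqP; move: iP; rewrite Py negbK.
    have nv : nrm (v i 0) = nrm (u i 0) by rewrite vE yi sub0r nrmN.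
    have := ler_norm (ip E (A *m sg i (v i 0) : RV m)); have := stN i (v i 0) iP.
    have := um iS; rewrite nv /c; have := sqr_ge0 (xi - nrm (u i 0)).
    have : 0 <= kap * (nrm (u i 0) ^+ 2 - m2) by rewrite mulr_ge0 ?(ltW kap0) // subr_ge0 um.
    lra.
  - have nv : v i 0 = y i 0 by rewrite vE uS // subr0.
    have yi : y i 0 != 0 by rewrite -Py.
    have wl : ip E (A *m sg i (v i 0) : RV m) + wA (sg i (v i 0)) - (1 + kap) / 2 * nrm (v i 0) ^+ 2 < - c.
      rewrite stP // add0r nv /c; have := w_lt i yi.
      have : xi ^+ 2 <= nrm (y i 0) ^+ 2 by rewrite ler_pXn2r ?nnegrE // yP.
      lra.
    by split=> //; exact: ltW.
  - have -> : v i 0 = 0 by rewrite vE uS // subr0; apply/eqP; move: iP; rewrite Py negbK.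
    rewrite sg0 nrm0 expr0n mulr0 subr0; split=> //.
    by rewrite -(scale0r (0 : RV n)) wZ mulmx_rZ ipC ipZ !mul0r addr0.
have Bsum : \sum_i B i <= (#|S :\: P|%:R - #|P :\: S|%:R) * c - \sum_(i in P :&: S) ((1 + kap) / 2 * nrm (v i 0) ^+ 2).
  rewrite mulrBl.
  have mk (X : {set 'I_n}) (H : 'I_n -> R) : \sum_(i in X) H i = \sum_i (if i \in X then H i else 0) by rewrite big_mkcond.
  have cst (X : {set 'I_n}) : #|X|%:R * c = \sum_(i in X) c by rewrite sumr_const mulr_natl.
  rewrite [#|S :\: P|%:R * c]cst [#|P :\: S|%:R * c]cst !mk -!sumrB.
  apply: ler_sum => i _; rewrite /B !inE; case: (i \in S); case: (i \in P) => /=; lra.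
have cards : (#|P :\: S| <= #|S :\: P|)%N.
  by rewrite -(leq_add2l #|P :&: S|) cardsID [P :&: S]finset.setIC cardsID SK.
have c_le : (#|S :\: P|%:R - #|P :\: S|%:R) * c <= 0.
  case: xiP => [x0|PK'].
    apply: mulr_ge0_le0; first by rewrite subr_ge0 ler_nat.
    by rewrite /c x0 expr0n mulr0 sub0r oppr_le0 mulr_ge0 ?divr_ge0 ?ltW.
  have -> : #|S :\: P| = #|P :\: S|.
    by apply/eqP; rewrite -(eqn_add2l #|P :&: S|) cardsID [P :&: S]finset.setIC cardsID SK PK'.
  by rewrite subrr mul0r.
have V0 : 0 <= \sum_(i in P :&: S) ((1 + kap) / 2 * nrm (v i 0) ^+ 2).
  by apply: sumr_ge0 => i _; rewrite mulr_ge0 ?sqr_ge0 // divr_ge0 // addr_ge0 // ltW.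
have PS : P :\: S = finset.set0.
  apply/eqP; rewrite -finset.subset0; apply/fintype.subsetP => i; rewrite inE => /andP[iS iP].
  have : \sum_i D i < \sum_i B i.
    rewrite (bigD1 i) //= [X in _ < X](bigD1 i) //=.
    by rewrite ltr_leD ?(proj2 (DB i)) // ler_sum // => k _; case: (DB k).
  lra.
have DBs : \sum_i D i <= \sum_i B i by apply: ler_sum => i _; case: (DB i).
have SP : S :\: P = finset.set0.
  apply/eqP; rewrite -cards_eq0; apply/negPn/negP => s0.
  case: xiP => [x0|PK'].
    have : (#|S :\: P|%:R - #|P :\: S|%:R) * c < 0; last by lra.
    rewrite PS cards0 subr0 pmulr_rlt0 ?ltr0n ?lt0n //.
    by rewrite /c x0 expr0n mulr0 sub0r oppr_lt0 mulr_gt0 ?divr_gt0.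
  move: s0; have -> : #|S :\: P| = #|P :\: S|.
    by apply/eqP; rewrite -(eqn_add2l #|P :&: S|) cardsID [P :&: S]finset.setIC cardsID SK PK'.
  by rewrite PS cards0.
have PSE : P = S.
  by apply/eqP; rewrite finset.eqEsubset -!finset.setD_eq0 PS SP !eqxx.
have Vz : \sum_(i in P :&: S) ((1 + kap) / 2 * nrm (v i 0) ^+ 2) = 0 by apply: le_anti; rewrite V0 andbT; lra.
apply/matrixP => i j; rewrite ord1; apply/eqP; rewrite -subr_eq0 -vE.
have [iP|iP] := boolP (i \in P); last first.
  by rewrite vE (uS (i := i)) -?PSE // subr0; move: iP; rewrite Py negbK.
have := psumr_eq0P _ Vz; move=> /(_ _ i) X.
have {X} := X _ _.
move=> X; have : (1 + kap) / 2 * nrm (v i 0) ^+ 2 = 0.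
  apply: X => [k _|]; last by rewrite inE iP -PSE iP.
  by rewrite mulr_ge0 ?sqr_ge0 // divr_ge0 // addr_ge0 // ltW.
move/eqP; rewrite mulf_eq0 sqrf_eq0 nrm_eq0 => /orP[|//].
by rewrite gt_eqF // divr_gt0 // ltr_pwDl // ltW.
Qed.

Lemma unique_le : (Defs.card y <= K)%N -> y = u.
Proof.
move=> cK; pose P := Defs.supp y.
have Py i : (i \in P) = (y i 0 != 0) by rewrite inE.
pose th (Q : {set 'I_n}) i : R := (i \in Q)%:R.
have rep (Q : {set 'I_n}) : P \subset Q -> (#|Q| <= K)%N -> [/\ forall i, 0 <= th Q i <= 1, forall i, y i 0 != 0 -> 0 < th Q i,
    \sum_i th Q i <= K%:R & Q2 nrm K y + \sum_i nrm (y i 0) ^+ 2 = \sum_i nrm (y i 0) ^+ 2 / th Q i].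
  move=> PQ QK; split.
  - by move=> i; rewrite /th; case: (i \in Q); rewrite ?lexx ?ler01.
  - by move=> i; rewrite -Py => /(fintype.subsetP PQ); rewrite /th => ->; rewrite ltr01.
  - have -> : \sum_i th Q i = #|Q|%:R.
      rewrite -sum1_card natr_sum [RHS]big_mkcond; apply: eq_bigr => i _.
      by rewrite /th; case: (i \in Q).
    by rewrite ler_nat.
  - rewrite (Q2_sparse nrm_ge0 nrm_eq0 K0 Kn cK) add0r; apply: eq_bigr => i _.
    have [|y0] := boolP (i \in P); first by move/(fintype.subsetP PQ); rewrite /th => ->; rewrite divr1.
    have -> : y i 0 = 0 by apply/eqP; move: y0; rewrite Py negbK.
    by rewrite nrm0 expr0n mul0r.
have st (Q : {set 'I_n}) : P \subset Q -> (#|Q| <= K)%N -> forall i z, i \in Q -> ip E (A *m sg i z : RV m) = 0.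
  move=> PQ QK i z iQ; have [r1 r2 r3 r4] := rep Q PQ QK.
  have := @stationary m n K A b y (th Q) K0 Kn lm r1 r2 r3 r4 i z.
  by rewrite /th iQ ltr01 invr1 subrr oppr0 mul0r => /(_ isT).
(* With mass to spare, any zero entry can be given weight 1 at no cost, so the gradient vanishes
   everywhere and [xi = 0]. Otherwise [xi] is the smallest nonzero magnitude of [y]. *)
have [PK|PK] := ltnP #|P| K.
  apply: (@unique_sparse P 0) => //.
  - exact: st.
  - move=> i z iP; rewrite (st (i |: P)) ?normr0 ?mul0r //; first exact: finset.subsetUr.
      by rewrite cardsU1 iP add1n.
    by rewrite !inE eqxx.
  - by left.
have PK' : #|P| = K by apply/eqP; rewrite eqn_leq cK.
have [i1 i1P] : exists i, i \in P by apply/card_gt0P; rewrite PK'.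
case: (@arg_minP _ R _ i1 (mem P) (fun i => nrm (y i 0)) i1P) => i0 i0P mi.
have [r1 r2 r3 r4] := rep P (subxx _) cK.
apply: (@unique_sparse P (nrm (y i0 0))) => //.
- exact: st.
- move=> i z; rewrite Py negbK => /eqP yi.
  have yi0 : y i0 0 != 0 by rewrite -Py.
  have := @stationary_off m n K A b y (th P) K0 Kn lm r1 r2 r3 r4 i i0 z yi yi0.
  have i0P' : i0 \in P by [].
  by rewrite /th i0P' divr1.
- by right.
Qed.

Lemma unique_gt : (K < Defs.card y)%N -> False.
Proof.
move=> cK; have [xi [xi0 sK QE]] := Q2_attained nrm_ge0 nrm_eq0 K0 Kn cK.
pose a i := nrm (y i 0); pose th i := Num.min 1 (a i / xi).
have a0 i : 0 <= a i by exact: nrm_ge0.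
have ap i : y i 0 != 0 -> 0 < a i by move=> yi; rewrite lt_neqAle a0 andbT eq_sym nrm_eq0.
pose P : {set 'I_n} := [set i | xi <= a i].
have thP i : i \in P -> th i = 1.
  by rewrite inE => h; apply/min_idPl; rewrite ler_pdivlMr // mul1r.
have thN i : i \notin P -> th i = a i / xi.
  by rewrite inE -ltNge => h; apply/min_idPr; rewrite ler_pdivrMr // mul1r ltW.
have thl i : i \notin P -> th i < 1.
  by move=> iP; rewrite thN //; move: iP; rewrite inE -ltNge => h; rewrite ltr_pdivrMr // mul1r.
have th0 i : 0 <= th i by rewrite le_min ler01 divr_ge0 // ltW.
have th1 i : th i <= 1 by rewrite ge_min lexx.
have th01 i : 0 <= th i <= 1 by rewrite th0 th1.
have thp i : y i 0 != 0 -> 0 < th i by move=> yi; rewrite lt_min ltr01 divr_gt0 // ap.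
have Py i : i \in P -> y i 0 != 0.
  by rewrite inE; apply: contraTneq => yi; rewrite /a yi nrm0 -ltNge.
have thK : \sum_i th i <= K%:R by rewrite sK.
have thQ : Q2 nrm K y + \sum_i nrm (y i 0) ^+ 2 = \sum_i nrm (y i 0) ^+ 2 / th i.
  rewrite QE; apply: eq_bigr => i _; rewrite -/(a i).
  have [iP|iP] := boolP (i \in P).
    by rewrite thP // divr1; move: iP; rewrite inE => ->.
  rewrite thN //; move: iP; rewrite inE => /negPf->.
  have [z|nz] := eqVneq (a i) 0; first by rewrite z expr0n mul0r !mulr0.
  by field; rewrite nz lt0r_neq0.
have st := @stationary m n K A b y th K0 Kn lm th01 thp thK thQ.
have off := @stationary_off m n K A b y th K0 Kn lm th01 thp thK thQ.
have so := @local_second_order m n K A b y th K0 Kn lm th01 thp thK thQ xi.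
have stP i z : i \in P -> ip E (A *m sg i z : RV m) = 0.
  by move=> iP; rewrite st ?thp ?Py // thP // invr1 subrr oppr0 mul0r.
have PK : (#|P| <= K)%N.
  rewrite -(ler_nat R) -sK -sum1_card natr_sum big_mkcond; apply: ler_sum => i _.
  by case: ifP => [/thP|_]; rewrite -/(th i) // => ->.
pose nu := xi^-1; have nu0 : 0 < nu by rewrite invr_gt0.
pose d : RV n := nu *: (y - u).
have dE i : d i 0 = iota nu * (y i 0 - u i 0) by rewrite mxE mxE [(- u) i 0]mxE.
(* Ties inside [S] are not rounded; they count among the entries of [L]. *)
pose T1 : {set 'I_n} := Defs.supp y :\: P :\: S; pose L := S :\: P.
pose N := #|T1|; pose M := #|L|.
pose t (i : 'I_N) : 'I_n := enum_val i; pose l (j : 'I_M) : 'I_n := enum_val j.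
have tT i : [/\ t i \notin S, t i \notin P & y (t i) 0 != 0].
  by have := enum_valP i; rewrite /T1 !inE => /andP[h1 /andP[h2 h3]].
have lL j : l j \in S /\ l j \notin P.
  by have := enum_valP j; rewrite /L !inE => /andP[].
have eT (G : 'I_n -> R) : \sum_i G (t i) = \sum_(i in T1) G i by rewrite [RHS]big_enum_val.
have eL (G : 'I_n -> R) : \sum_j G (l j) = \sum_(i in L) G i by rewrite [RHS]big_enum_val.
have split4 (G : 'I_n -> R) : (forall i, i \notin S -> y i 0 = 0 -> G i = 0) ->
    \sum_i G i = \sum_(i in P :&: S) G i + \sum_(i in P :\: S) G i + \sum_i G (t i) + \sum_j G (l j).
  move=> G0; rewrite eT eL.
  rewrite [X in _ = X + _ + _ + _]big_mkcond [X in _ = _ + X + _ + _]big_mkcond [X in _ = _ + _ + X + _]big_mkcond [X in _ = _ + _ + _ + X]big_mkcond -!big_split.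
  apply: eq_bigr => i _ /=; rewrite /T1 /L !inE; have [yi|yi] := eqVneq (y i 0) 0.
    have -> : (xi <= a i) = false by rewrite /a yi nrm0 leNgt xi0.
    have [iS|iS] := boolP (i \in S) => /=; first by rewrite !add0r.
    by rewrite G0 // !addr0.
  by case: (i \in S); case: (xi <= a i) => /=; rewrite ?addr0 ?add0r.
pose e (i : 'I_N) : RV n := sg (t i) (iota (a (t i))^-1 * y (t i) 0).
pose f (j : 'I_M) : RV n := sg (l j) (d (l j) 0).
pose h (j : 'I_M) := nrm (d (l j) 0).
pose w (v : RV n) := nu * wA v.
have eN i : nrm (iota (a (t i))^-1 * y (t i) 0) = 1.
  have [_ _ yi] := tT i.
  by rewrite nrmZ ger0_norm ?invr_ge0 // -/(a (t i)) mulVf // lt0r_neq0 // ap.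
have gdE v : gA d v = nu * ip E (A *m v : RV m) + w v.
  by rewrite /d gZ /w -mulrDr EE subrK.
have w0S i z : i \in S -> w (sg i z) = 0 by move=> iS; rewrite /w w_S // mulr0.
have dT i : sg (t i) (d (t i) 0) = th (t i) *: e i.
  have [h1 h2 h3] := tT i.
  rewrite /e sgZ dE uS // subr0 mulrA -rmorphM; congr (sg _ (iota _ * _)).
  by rewrite thN // /nu; field; rewrite !lt0r_neq0 // ap.
have dz i : i \notin S -> y i 0 = 0 -> d i 0 = 0.
  by move=> iS yi; rewrite dE yi uS // subr0 mulr0.
have gde i : gA d (e i) = th (t i) - 1 + w (e i).
  have [h1 h2 h3] := tT i; rewrite gdE st ?thp //; congr (_ + _).
  rewrite dotC dotZl dot_nrm -/(a (t i)) thN //.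
  by rewrite /nu; field; rewrite !lt0r_neq0 // ap.
pose G i := gA d (sg i (d i 0)).
have gs0 : gA d 0 = 0 by rewrite gC -(scale0r (0 : RV n)) gZ mul0r.
have ws0 : w 0 = 0 by rewrite /w -(scale0r (0 : RV n)) wZ mul0r mulr0.
have GPS i : i \in P :&: S -> G i = 0.
  by rewrite inE => /andP[iP iS]; rewrite /G gdE stP // w0S // mulr0 addr0.
have GP i : i \in P :\: S -> G i = w (sg i (d i 0)).
  by rewrite inE => /andP[iS iP]; rewrite /G gdE stP // mulr0 add0r.
pose Xp := \sum_(i in P :\: S) w (sg i (d i 0)).
pose PP := \sum_(i in P :\: S) nrm (d i 0) ^+ 2.
pose lin := lincomb e.
have wD' x x' : w (x + x') = w x + w x' by rewrite /w wD mulrDr.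
have wZ' s x : w (s *: x) = s * w x by rewrite /w wZ mulrCA.
have wlin c : w (lin c) = \sum_i c i * w (e i).
  by rewrite /lin /lincomb; elim/big_rec2: _ => [//|i x x' _ <-]; rewrite wD' wZ'.
pose tht i := th (t i).
have gdd : sqn gA d = \sum_i tht i ^+ 2 - \sum_i tht i + w (lin tht) + \sum_j gA d (f j) + Xp.
  rewrite /sqn g_sum -/G (split4 G); last by move=> i iS yi; rewrite /G dz // sg0.
  rewrite big1 // add0r (eq_bigr _ GP) -/Xp.
  have -> : \sum_i G (t i) = \sum_i tht i ^+ 2 - \sum_i tht i + w (lin tht).
    rewrite wlin -sumrB -big_split; apply: eq_bigr => i _ /=.
    rewrite /G dT gC gZ gC gde /tht; ring.
  have -> : \sum_j G (l j) = \sum_j gA d (f j) by [].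
  ring.
have wd : w d = Xp + w (lin tht).
  rewrite {1}/w w_sum mulr_sumr (split4 (fun i => nu * wA (sg i (d i 0)))); last first.
    by move=> i iS yi; rewrite dz // sg0 -/(w 0).
  rewrite big1 ?add0r; last by move=> i; rewrite inE => /andP[_ iS]; rewrite w_S // mulr0.
  rewrite [X in _ + X]big1 ?addr0; last by move=> j _; rewrite w_S ?mulr0 //; case: (lL j).
  by rewrite wlin; congr (_ + _); apply: eq_bigr => i _; rewrite dT -wZ'.
have dP i : i \in P :\: S -> 1 <= nrm (d i 0).
  rewrite inE => /andP[iS iP]; rewrite dE uS // subr0 nrmZ gtr0_norm // mulrC ler_pdivlMr // mul1r.
  by move: iP; rewrite inE.
have m2' : 0 < nu ^+ 2 * m2 by rewrite mulr_gt0 // exprn_gt0.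
have Xpl i : i \in P :\: S -> w (sg i (d i 0)) < kap / 2 * (nrm (d i 0) ^+ 2 + nu ^+ 2 * m2).
  move=> iPS; move: (iPS); rewrite inE => /andP[iS iP].
  have nd : nrm (d i 0) = nu * a i by rewrite dE uS // subr0 nrmZ gtr0_norm.
  have X : nu ^+ 2 * wA (sg i (y i 0)) < nu ^+ 2 * (kap / 2 * (a i ^+ 2 + m2)).
    by rewrite ltr_pM2l ?exprn_gt0 //; apply: w_lt (Py i iP).
  rewrite nd exprMn /w; have -> : sg i (d i 0) = nu *: sg i (y i 0) by rewrite sgZ dE uS // subr0.
  rewrite wZ; move: X; set ww := wA _; lra.
(* [k] is the mass left outside [P]. [room] is the number of ties that fit into [2K] places once [S]
   and [P \ S] have taken [K + p0] of them. *)
pose p0 := #|P :\: S|; pose k := (K - #|P|)%N; pose room := (k + #|P :&: S|)%N.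
have cPS : (p0 + #|P :&: S| = #|P|)%N by rewrite addnC cardsID.
have cSP : (M + #|P :&: S| = K)%N by rewrite /M /L [P :&: S]finset.setIC addnC cardsID.
have p0r : (p0 + room)%N = K by rewrite /room addnCA cPS subnK.
have ME : M = (p0 + k)%N by apply/eqP; rewrite -(eqn_add2r #|P :&: S|) cSP -addnA -/room p0r.
have PP0 : p0%:R <= PP.
  rewrite /p0 -sum1_card natr_sum; apply: ler_sum => i iPS.
  by rewrite expr_ge1 ?dP.
have XpS : kap / 2 * (PP + p0%:R * (nu ^+ 2 * m2)) = \sum_(i in P :\: S) kap / 2 * (nrm (d i 0) ^+ 2 + nu ^+ 2 * m2).
  by rewrite -mulr_sumr big_split /= sumr_const mulr_natl.
have XpE : Xp <= kap / 2 * (PP + p0%:R * (nu ^+ 2 * m2)).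
  by rewrite XpS; apply: ler_sum => i /Xpl/ltW.
have Xp1 : (0 < p0)%N -> Xp < kap / 2 * (PP + p0%:R * (nu ^+ 2 * m2)).
  move=> /card_gt0P[i iPS]; rewrite XpS /Xp (bigD1 i) //= [X in _ < X](bigD1 i) //=.
  by rewrite ltr_leD ?Xpl // ler_sum // => x /andP[/Xpl/ltW].
have p00 : p0 = 0%N -> Xp = 0 /\ PP = 0.
  by move/cards0_eq => z; rewrite /Xp /PP z !big_set0.
have tauE : \sum_j th (l j) + \sum_i tht i = k%:R.
  have := split4 th; rewrite sK.
  have c1 (X : {set 'I_n}) : (forall i, i \in X -> i \in P) -> \sum_(i in X) th i = #|X|%:R.
    move=> XP; rewrite -sum1_card natr_sum; apply: eq_bigr => i /XP/thP; by [].
  rewrite !c1; try by move=> i; rewrite !inE => /andP[].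
  rewrite /k natrB // -cPS natrD /tht => -> //; first by ring.
  move=> i iS yi; have iP : i \notin P by apply/negP => /Py; rewrite yi eqxx.
  by rewrite thN // /a yi nrm0 mul0r.
have [i0 [yi0 i0P]] : exists i0, y i0 0 != 0 /\ i0 \notin P.
  have : ~~ (Defs.supp y \subset P).
    apply/negP => /subset_leq_card; rewrite leqNgt; move/negP; apply.
    exact: leq_ltn_trans PK cK.
  by case/fintype.subsetPn => i; rewrite inE => h1 h2; exists i.
have gdf j : `|gA d (f j)| <= (1 - th (l j)) * h j.
  have [jS jP] := lL j; rewrite gdE w0S // addr0 normrM (gtr0_norm nu0) /f.
  have nx : nu * xi = 1 by rewrite mulVf // lt0r_neq0.
  have [y0|yj] := eqVneq (y (l j) 0) 0.
    rewrite thN // /a y0 nrm0 mul0r subr0 mul1r.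
    have := off (l j) i0 (d (l j) 0) y0 yi0; rewrite thN // -/(a i0) -/(h j).
    have -> : a i0 / (a i0 / xi) = xi by field; rewrite !lt0r_neq0 // ap.
    by rewrite -(ler_pM2l nu0) mulrA nx mul1r.
  rewrite st ?thp // normrM normrN thN // -/(a (l j)).
  have aj := ap _ yj; have ax : a (l j) < xi by move: jP; rewrite inE -ltNge.
  have p : 0 <= (a (l j) / xi)^-1 - 1.
    by rewrite subr_ge0 invf_div ler_pdivlMr // mul1r ltW.
  rewrite (ger0_norm p).
  have := dot_le (y (l j) 0) (d (l j) 0); rewrite -/(h j) -/(a (l j)) => dl.
  apply: le_trans (_ : nu * (((a (l j) / xi)^-1 - 1) * (a (l j) * h j)) <= _).
    by rewrite ler_pM2l // ler_wpM2l.
  by rewrite le_eqVlt; apply/orP; left; apply/eqP; rewrite /nu; field; rewrite !lt0r_neq0.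
(* [h j >= |T - q|] by Cauchy-Schwarz, and [(T - q)^2 = (1 - T) q^2 - T (1 - T) + T (q - 1)^2]. *)
have hm j : (1 - th (l j)) * (nu ^+ 2 * m2) - th (l j) * (1 - th (l j)) <= h j ^+ 2.
  have [jS jP] := lL j; set T := th (l j); set q := nu * nrm (u (l j) 0).
  have Ta : T = nu * a (l j) by rewrite /T thN // mulrC.
  have q2 : nu ^+ 2 * m2 <= q ^+ 2 by rewrite exprMn ler_wpM2l ?sqr_ge0 // um.
  have hq : (T - q) ^+ 2 <= h j ^+ 2.
    rewrite /h dE nrmZ exprMn real_normK ?num_real // Ta -mulrBr exprMn ler_wpM2l ?sqr_ge0 //.
    rewrite nrm_sub.
    have := dot_le (y (l j) 0) (u (l j) 0); have := ler_norm (dot (y (l j) 0) (u (l j) 0)).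
    rewrite -/(a (l j)); lra.
  have t1 : 0 <= 1 - T by rewrite subr_ge0 th1.
  have := ler_wpM2l t1 q2; have : 0 <= T * (q - 1) ^+ 2 by rewrite mulr_ge0 ?sqr_ge0 // th0.
  lra.
have ne1 i : sqn gA (e i) <= 1.
  by have := colA (t i) (iota (a (t i))^-1 * y (t i) 0); rewrite eN expr1n.
have nf j : sqn gA (f j) <= h j ^+ 2 by exact: colA.
have lt_ (c : 'I_N -> R) i : lin c (t i) 0 = iota (c i) * (iota (a (t i))^-1 * y (t i) 0).
  rewrite /lin /lincomb summxE (bigD1 i) //= big1 ?addr0; last first.
    by move=> j ji; rewrite /e sgZ sgE (inj_eq enum_val_inj) eq_sym (negPf ji).
  by rewrite /e sgZ sgE eqxx.
have lo (c : 'I_N -> R) x : x \notin T1 -> lin c x 0 = 0.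
  move=> xT; rewrite /lin /lincomb summxE big1 // => i _; rewrite /e sgZ sgE.
  by case: eqP => // xt; move: xT; rewrite xt enum_valP.
have inT x : x \in T1 -> exists i, x = t i.
  by move=> xT; exists (enum_rank_in xT x); rewrite /t enum_rankK_in.
have yl (c : 'I_N -> R) i : nrm (lin c (t i) 0) = `|c i| by rewrite lt_ nrmZ eN mulr1.
have supp_lin (c : 'I_N -> R) x : lin c x 0 != 0 -> x \in t @: [set i | c i != 0%R].
  have [/inT[i ->]|/lo->] := boolP (x \in T1); last by rewrite eqxx.
  move=> h0; apply: imset_f; rewrite inE; apply: contraNneq h0 => ci.
  by rewrite lt_ ci rmorph0 mul0r.
have tcard (c : 'I_N -> R) : (#|t @: [set i | c i != 0%R]| <= #|[set i | c i != 0%R]|)%N by exact: leq_imset_card.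
have normsq (v : RV n) : (forall x, x \notin T1 -> v x 0 = 0) -> ip v v = \sum_i nrm (v (t i) 0) ^+ 2.
  move=> v0; rewrite (eT (fun x => nrm (v x 0) ^+ 2)) big_mkcond; apply: eq_bigr => x _.
  by rewrite dot_nrm; case: ifPn => // /v0->; rewrite nrm0 expr0n.
have so' (c : 'I_N -> R) : \sum_i c i = 0 -> \sum_i c i ^+ 2 <= sqn gA (lin c).
  move=> c0; pose ext x := \sum_i (if x == t i then c i else 0).
  have ext_t i : ext (t i) = c i.
    rewrite /ext (bigD1 i) //= eqxx big1 ?addr0 // => j ji.
    by rewrite (inj_eq enum_val_inj) eq_sym (negPf ji).
  have ext_o x : x \notin T1 -> ext x = 0.
    move=> xT; rewrite /ext big1 // => i _; case: eqP => // xt; move: xT; rewrite xt enum_valP //.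
  have sumE (H : R -> R) : H 0 = 0 -> \sum_x H (ext x) = \sum_i H (c i).
    move=> H0; transitivity (\sum_i H (ext (t i))); last by apply: eq_bigr => i _; rewrite ext_t.
    rewrite (eT (fun x => H (ext x))) [RHS]big_mkcond; apply: eq_bigr => x _.
    by case: ifPn => // /ext_o->.
  have := so ext (xi *: lin c); rewrite (sumE id) // c0 (sumE (fun x => x ^+ 2)) ?expr0n //.
  have -> : ip (A *m (xi *: lin c : RV n) : RV m) (A *m (xi *: lin c : RV n) : RV m) = xi ^+ 2 * sqn gA (lin c).
    by rewrite -/(gA _ _) -/(sqn gA _) nqZ.
  rewrite ler_pM2l ?exprn_gt0 //; apply => //.
    move=> x; have [/inT[i ->] _|/ext_o->] := boolP (x \in T1); last by rewrite eqxx.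
    have [h1 h2 h3] := tT i; rewrite thp // thl // thN // -/(a (t i)); split=> //.
    by rewrite mulrC divfK // lt0r_neq0.
  move=> x; rewrite mxE; have [/inT[i ->]|xT] := boolP (x \in T1); last by rewrite lo // ext_o // mul0r rmorph0 mulr0 mul0r.
  have [h1 h2 h3] := tT i; rewrite lt_ ext_t !mulrA -!rmorphM thN //.
  by congr (iota _ * _); field; rewrite !lt0r_neq0 // ap.
pose q (c : 'I_N -> R) : RV n := d + lin (fun i => (c i - tht i)%R).
have qo (c : 'I_N -> R) x : x \notin T1 -> q c x 0 = d x 0.
  by move=> xT; rewrite mxE lo // addr0.
have qt (c : 'I_N -> R) i : q c (t i) 0 = iota (c i) * (iota (a (t i))^-1 * y (t i) 0).
  have [h1 h2 h3] := tT i; rewrite mxE lt_.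
  have -> : d (t i) 0 = iota (tht i) * (iota (a (t i))^-1 * y (t i) 0).
    rewrite dE uS // subr0 mulrA -rmorphM /tht thN //; congr (iota _ * _).
    by rewrite /nu; field; rewrite !lt0r_neq0 // ap.
  by rewrite -mulrDl -rmorphD addrC subrK.
have PST x : x \in P -> x \notin T1 by rewrite /T1 !inE => ->; rewrite andbF.
have ST x : x \in S -> x \notin T1 by rewrite /T1 !inE => ->.
have qnorm (c : 'I_N -> R) : PP + \sum_i c i ^+ 2 + \sum_j h j ^+ 2 + \sum_(i in P :&: S) nrm (d i 0) ^+ 2 = ip (q c) (q c).
  have -> : ip (q c) (q c) = \sum_x nrm (q c x 0) ^+ 2 by apply: eq_bigr => x _; rewrite dot_nrm.
  rewrite (split4 (fun x => nrm (q c x 0) ^+ 2)); last first.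
    move=> x xS yx; rewrite qo ?dz ?nrm0 ?expr0n //.
    by rewrite /T1 !inE yx eqxx /= !andbF.
  have -> : \sum_(x in P :&: S) nrm (q c x 0) ^+ 2 = \sum_(x in P :&: S) nrm (d x 0) ^+ 2.
    by apply: eq_bigr => x; rewrite inE => /andP[xP _]; rewrite qo ?PST.
  have -> : \sum_(x in P :\: S) nrm (q c x 0) ^+ 2 = PP.
    by apply: eq_bigr => x; rewrite inE => /andP[_ xP]; rewrite qo ?PST.
  have -> : \sum_i nrm (q c (t i) 0) ^+ 2 = \sum_i c i ^+ 2.
    by apply: eq_bigr => i _; rewrite qt nrmZ eN mulr1 real_normK // num_real.
  have -> : \sum_j nrm (q c (l j) 0) ^+ 2 = \sum_j h j ^+ 2.
    by apply: eq_bigr => j _; rewrite qo // ST //; case: (lL j).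
  ring.
have qsupp (c : 'I_N -> R) x : q c x 0 != 0 -> [|| x \in S, x \in P :\: S | x \in t @: [set i | c i != 0%R]].
  have [/inT[i ->]|xT] := boolP (x \in T1).
    rewrite qt => h0; apply/orP; right; apply/orP; right; apply: imset_f; rewrite inE.
    by apply: contraNneq h0 => ->; rewrite rmorph0 mul0r.
  rewrite qo // => dx; move: xT; rewrite /T1 !inE; case: (boolP (x \in S)) => //= xS.
  have -> : y x 0 != 0 by apply: contraNneq dx => /(dz _ xS)->.
  by rewrite andbT negbK => ->.
have kp : 0 <= (1 + kap) / 2 by rewrite divr_ge0 // addr_ge0 // ltW.
have test (c : 'I_N -> R) : (#|[set i | c i != 0%R]| <= room)%N ->
    (1 + kap) / 2 * (PP + \sum_i c i ^+ 2 + \sum_j h j ^+ 2) <= sqn gA (q c).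
  move=> cr; apply: le_trans (sparse (v := q c) _).
    by rewrite -qnorm ler_wpM2l // lerDl sumr_ge0 // => x _; rewrite sqr_ge0.
  apply: leq_trans (_ : #|S :|: (P :\: S) :|: t @: [set i | c i != 0%R]| <= _)%N.
    by apply: subset_leq_card; apply/fintype.subsetP => x; rewrite inE => /qsupp; rewrite !finset.in_setU orbA.
  rewrite (leq_trans (leq_card_setU _ _)) // (leq_trans (leq_add (leq_card_setU _ _) (tcard c))) //.
  by rewrite SK -/p0 -addnn -addnA leq_add2l -p0r leq_add2l.
have testD j (c : 'I_N -> R) : (#|[set i | c i != 0%R]| <= room.+1)%N ->
    (1 + kap) / 2 * (PP + \sum_i c i ^+ 2 + \sum_j h j ^+ 2 - h j ^+ 2) <= sqn gA (q c - f j).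
  move=> cr; have [jS jP] := lL j; pose v : RV n := q c - f j.
  have vE x : v x 0 = if x == l j then 0 else q c x 0.
    rewrite mxE [(- f j) x 0]mxE /f sgE; case: eqP => [->|_]; last by rewrite subr0.
    by rewrite qo ?subrr // ST.
  have vn : ip v v = ip (q c) (q c) - h j ^+ 2.
    have sE (z : RV n) : ip z z = \sum_x nrm (z x 0) ^+ 2 by apply: eq_bigr => x _; rewrite dot_nrm.
    rewrite !sE (@sum_upd1 _ _ (fun x => nrm (q c x 0) ^+ 2) _ (l j)).
      by rewrite vE eqxx nrm0 expr0n sub0r qo // ST.
    by move=> x /negPf xl; rewrite vE xl.
  apply: le_trans (sparse (v := v) _).
    rewrite vn -qnorm ler_wpM2l // lerD2r lerDl sumr_ge0 // => x _; rewrite sqr_ge0 //.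
  apply: leq_trans (_ : #|(S :\ l j) :|: (P :\: S) :|: t @: [set i | c i != 0%R]| <= _)%N.
    apply: subset_leq_card; apply/fintype.subsetP => x; rewrite inE vE.
    by case: (eqVneq x (l j)) => [|xl]; rewrite ?eqxx // => /qsupp; rewrite !finset.in_setU finset.in_setD1 xl orbA.
  rewrite (leq_trans (leq_card_setU _ _)) // (leq_trans (leq_add (leq_card_setU _ _) (tcard c))) //.
  have := cardsD1 (l j) S; rewrite jS SK add1n => KE.
  apply: leq_trans (leq_add (leqnn _) cr) _.
  by rewrite -/p0 addnS -addSn -addSn -KE -addnA p0r addnn.
have sparse' (c : 'I_N -> R) : (#|[set i | c i != 0%R]| <= K.*2)%N ->
    (1 + kap) / 2 * (\sum_i c i ^+ 2) <= sqn gA (lin c).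
  move=> cr; apply: le_trans (sparse (v := lin c) _).
    rewrite normsq; last by move=> x; apply: lo.
    by rewrite ler_wpM2l // ler_sum // => i _; rewrite yl real_normK ?num_real.
  apply: leq_trans cr; apply: leq_trans (tcard c).
  by apply: subset_leq_card; apply/fintype.subsetP => x; rewrite inE => /supp_lin.
(* These equations mean that [P] is empty and [K = 1]: without its ties, [d] is supported on the
   single index of [S]. *)
have single : p0 = 0%N -> k = 1%N -> room = 1%N -> sqn gA (d - lin tht) <= \sum_j h j ^+ 2.
  move=> z1 z2 z3.
  have PS0 : P :&: S = finset.set0 by apply: cards0_eq; move: z3; rewrite /room z2; case: #|_|.
  have PD0 : P :\: S = finset.set0 by apply: cards0_eq.
  have M1 : M = 1%N by rewrite ME z1 z2.
  have M0 : (0 < M)%N by rewrite M1.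
  pose j0 := Ordinal M0.
  have Mj (j : 'I_M) : j = j0.
    by apply/val_inj; have := ltn_ord j; rewrite [X in (_ < X)%N]M1 ltnS leqn0 => /eqP.
  have -> : d - lin tht = f j0.
    apply/matrixP => x i; rewrite ord1 mxE [(- lin tht) x 0]mxE /f sgE.
    have [/inT[i' ->]|xT] := boolP (x \in T1).
      have [h1 h2 h3] := tT i'; have [jS jP] := lL j0.
      have -> : (t i' == l j0) = false by apply: contraNF h1 => /eqP->.
      have := qt (fun=> 0) i'; rewrite rmorph0 mul0r mxE => <-; congr (_ + _).
      by rewrite !lt_ sub0r rmorphN mulNr.
    rewrite lo // subr0; have [xS|xS] := boolP (x \in S).
      have xL : x \in L.
        rewrite /L inE xS andbT; apply/negP => xP.
        by have : x \in P :&: S; [rewrite inE xP xS|rewrite PS0 inE].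
      have -> : x = l j0 by rewrite -(Mj (enum_rank_in xL x)) /l enum_rankK_in.
      by rewrite eqxx.
    have -> : (x == l j0) = false by apply: contraNF xS => /eqP->; case: (lL j0).
    apply: dz => //; apply/eqP; apply: contraNT xT => yx; rewrite /T1 !inE xS yx andbT /=.
    rewrite -ltNge ltNge; apply/negP => xP.
    by have : x \in P :\: S; [rewrite !inE xS|rewrite PD0 inE].
  apply: le_trans (nf j0) _; rewrite (bigD1 j0) //= lerDl sumr_ge0 // => j _; exact: sqr_ge0.
have nontriv : (0 < N)%N \/ (0 < p0)%N.
  have : ~~ (Defs.supp y \subset S).
    by apply/negP => /subset_leq_card; rewrite leqNgt SK; move/negP; apply.
  case/fintype.subsetPn => i; rewrite inE => yi iS.
  have [iP|iP] := boolP (i \in P); [right|left]; apply/card_gt0P; exists i.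
    by rewrite inE iP iS.
  by rewrite /T1 !inE iS yi andbT /=; move: iP; rewrite inE.
have hom' : nu ^+ 2 * ip r r * (1 + 2 * kap) <= kap ^+ 2 * (nu ^+ 2 * m2).
  by rewrite -mulrA [kap ^+ 2 * (_ * _)]mulrCA ler_pM2l ?exprn_gt0 // ltW.
have wcs' v : w v ^+ 2 <= nu ^+ 2 * ip r r * sqn gA v.
  by rewrite exprMn -mulrA ler_pM2l ?exprn_gt0 //; apply: wcs.
have tht0 i : 0 < tht i by apply: thp; case: (tT i).
have tht1 i : tht i <= 1 by exact: th1.
have thl01 j : 0 <= th (l j) <= 1 by exact: th01.
have kr : (k <= room)%N by exact: leq_addr.
have h0 j : 0 <= h j by exact: nrm_ge0.
have [z|p] := posnP N.
  by apply: (@core_no_ties R (RV n) gA w wZ' N M e f d tht (th \o l) h kap (nu ^+ 2 * m2) PP Xp p0 k room) => //.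
by apply: (@core_ties R (RV n) gA w gC gD gZ g_ge0 wD' wZ' N M e f d tht (th \o l) h kap (nu ^+ 2 * ip r r) (nu ^+ 2 * m2) PP Xp p0 k room K) => //.
Qed.

Theorem local_min_unique : y = u.
Proof. by case: (leqP (Defs.card y) K) => [/unique_le|/unique_gt]. Qed.
End Unique.

Lemma Q2_rep (n K : nat) (z : RV n) : (0 < K)%N -> (K <= n)%N -> exists th : 'I_n -> R,
  [/\ forall i, 0 <= th i <= 1, forall i, z i 0 != 0 -> 0 < th i, \sum_i th i <= K%:R &
    Q2 nrm K z + \sum_i nrm (z i 0) ^+ 2 = \sum_i nrm (z i 0) ^+ 2 / th i].
Proof.
move=> K0 Kn; have [cK|cK] := leqP (Defs.card z) K.
  exists (fun i => (z i 0 != 0)%:R); split.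
  - by move=> i; case: (z i 0 != 0); rewrite ?lexx ?ler01.
  - by move=> i ->; rewrite ltr01.
  - apply: le_trans (_ : #|Defs.supp z|%:R <= _); last by rewrite ler_nat.
    rewrite -sum1_card natr_sum [X in _ <= X]big_mkcond; apply: ler_sum => i _.
    by rewrite inE; case: (z i 0 != 0).
  - rewrite (Q2_sparse nrm_ge0 nrm_eq0 K0 Kn cK) add0r; apply: eq_bigr => i _.
    by have [->|_] := eqVneq (z i 0) 0; rewrite ?divr1 // nrm0 expr0n mul0r.
have [xi [xi0 sK QE]] := Q2_attained nrm_ge0 nrm_eq0 K0 Kn cK.
exists (fun i => Num.min 1 (nrm (z i 0) / xi)); split; rewrite ?sK //.
- by move=> i; rewrite le_min ler01 divr_ge0 ?nrm_ge0 ?(ltW xi0) //= ge_min lexx.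
- by move=> i zi; rewrite lt_min ltr01 divr_gt0 // lt_neqAle nrm_ge0 andbT eq_sym nrm_eq0.
- rewrite QE; apply: eq_bigr => i _; case: (lerP xi (nrm (z i 0))) => h.
    by rewrite min_l ?divr1 // ler_pdivlMr // mul1r.
  rewrite min_r; last by rewrite ler_pdivrMr // mul1r ltW.
  have [e|nz] := eqVneq (nrm (z i 0)) 0; first by rewrite e expr0n mul0r !mulr0.
  by field; rewrite nz lt0r_neq0.
Qed.

(** * Existence of a global minimizer *)

Section Exists.
Variables (im : F -> R) (jj : F).
Hypothesis imD : forall x y, im (x + y) = im x + im y.
Hypothesis imZ : forall a x, im (iota a * x) = a * im x.
Hypothesis decomp : forall x, x = iota (re x) + iota (im x) * jj.
Hypothesis re_le : forall x, `|re x| <= nrm x.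
Hypothesis im_le : forall x, `|im x| <= nrm x.

(** [jj] completes 1 to a real spanning set of the scalars: the imaginary unit over the complex
    numbers, and 0, with [im = 0], over the reals. *)
Definition fcont p (f : 'rV[R]_p -> F) := cont (fun v => re (f v)) /\ cont (fun v => im (f v)).
Lemma fcont_cst p c : fcont (fun _ : 'rV[R]_p => c).
Proof. by split; apply: cont_cst. Qed.
Lemma fcont_scale p (f : 'rV[R]_p -> R) h : cont f -> fcont h -> fcont (fun v => iota (f v) * h v).
Proof.
move=> hf [h1 h2]; split.
  by refine (cont_ext _ (contM hf h1)) => v; rewrite reZ.
by refine (cont_ext _ (contM hf h2)) => v; rewrite imZ.
Qed.
Lemma fcontD p (f h : 'rV[R]_p -> F) : fcont f -> fcont h -> fcont (fun v => f v + h v).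
Proof.
move=> [f1 f2] [h1 h2]; split.
  by refine (cont_ext _ (contD f1 h1)) => v; rewrite reD.
by refine (cont_ext _ (contD f2 h2)) => v; rewrite imD.
Qed.
Lemma fcont_ext p (f h : 'rV[R]_p -> F) : f =1 h -> fcont f -> fcont h.
Proof. by move=> /funext->. Qed.
Lemma fcont_mull p c (f : 'rV[R]_p -> F) : fcont f -> fcont (fun v => c * f v).
Proof.
move=> [f1 f2].
refine (fcont_ext _ (fcontD (fcont_scale f1 (fcont_cst p c)) (fcont_scale f2 (fcont_cst p (c * jj))))) => v.
by rewrite {3}(decomp (f v)) mulrDr mulrC mulrCA.
Qed.
Lemma fcont_sum p (I : Type) (r : seq I) (f : I -> 'rV[R]_p -> F) :
  (forall i, fcont (f i)) -> fcont (fun v => \sum_(i <- r) f i v).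
Proof.
move=> h; elim: r => [|i r IH].
  by refine (fcont_ext _ (fcont_cst p 0)) => v; rewrite big_nil.
by refine (fcont_ext _ (fcontD (h i) IH)) => v; rewrite big_cons.
Qed.
Lemma cont_nrm2 p (f : 'rV[R]_p -> F) : fcont f -> cont (fun v => nrm (f v) ^+ 2).
Proof.
move=> [f1 f2].
have c0 a : cont (fun _ : 'rV[R]_p => a) by apply: cont_cst.
refine (cont_ext _ (contD (contD (contM (c0 (dot 1 1)) (contX2 f1)) (contM (c0 (2 * dot 1 jj)) (contM f1 f2)))
  (contM (c0 (dot jj jj)) (contX2 f2)))) => v.
rewrite -dot_nrm {5 6}(decomp (f v)) -[iota (re (f v))]mulr1 dotDl ![dot (iota _ * _) (_ + _)]dotC !dotDl !dotZl.
rewrite ![dot _ (iota _ * _)]dotC !dotZl [dot jj 1]dotC; ring.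
Qed.

Section Min.
Variables (m n K : nat) (A : 'M[F]_(m, n)) (b : RV m).
Hypothesis K0 : (0 < K)%N.
Hypothesis Kn : (K <= n)%N.
Hypothesis injA : forall v : RV n, (Defs.card v <= K)%N -> (A *m v : RV m) = 0 -> v = 0.
Let p := (n + (n + n))%N.
(* x_i = s_i y_i with s_i^2 the weight of x_i makes the objective polynomial:
   K_reg(x) is the minimum of [J b] over the parametrizations of x. *)
Let si i (v : 'rV[R]_p) := v 0 (lshift (n + n) i).
Let yi i (v : 'rV[R]_p) := iota (v 0 (rshift n (lshift n i))) + iota (v 0 (rshift n (rshift n i))) * jj.
Let xv (v : 'rV[R]_p) : RV n := \col_i (iota (si i v) * yi i v).
Let N2 v := \sum_i nrm (yi i v) ^+ 2.
Let S2 v := \sum_i si i v ^+ 2.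
Let J (b0 : RV m) v := N2 v - \sum_i si i v ^+ 2 * nrm (yi i v) ^+ 2
  + \sum_k nrm ((A *m xv v - b0) k 0) ^+ 2.
Let si_cont i : cont (si i). Proof. exact: cont_coord. Qed.
Let yi_cont i : fcont (yi i).
Proof.
refine (fcont_ext _ (fcontD (fcont_scale (cont_coord _ (rshift n (lshift n i))) (fcont_cst p 1)) (fcont_scale (cont_coord _ (rshift n (rshift n i))) (fcont_cst p jj)))).
by move=> v; rewrite mulr1.
Qed.
Let N2_cont : cont N2.
Proof. by apply: cont_sum => i; exact: (cont_nrm2 (yi_cont i)). Qed.
Let S2_cont : cont S2.
Proof. by apply: cont_sum => i; apply: contX2. Qed.
Let J_cont b0 : cont (J b0).
Proof.
apply: contD; first (apply: contB => //; apply: cont_sum => i; apply: contM; [exact: (contX2 (si_cont i))|exact: (cont_nrm2 (yi_cont i))]).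
apply: cont_sum => k; apply: cont_nrm2.
have H : fcont (fun v => \sum_i A k i * (iota (si i v) * yi i v)).
  by apply: fcont_sum => i; apply: fcont_mull; apply: fcont_scale.
refine (fcont_ext _ (fcontD H (fcont_cst p (- b0 k 0)))) => v.
rewrite [RHS]mxE [(- b0) k 0]mxE; congr (_ + _); rewrite mxE; apply: eq_bigr => i _.
by rewrite mxE.
Qed.
Let mk (s : 'I_n -> R) (y : RV n) : 'rV[R]_p :=
  row_mx (\row_i s i) (row_mx (\row_i re (y i 0)) (\row_i im (y i 0))).
Let si_mk s y i : si i (mk s y) = s i.
Proof. by rewrite /si /mk row_mxEl mxE. Qed.
Let yi_mk s y i : yi i (mk s y) = y i 0.
Proof. by rewrite /yi /mk !row_mxEr row_mxEl !mxE -decomp. Qed.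
Let ysv (v : 'rV[R]_p) : RV n := \col_i yi i v.
(** The first [n] of the [p] coordinates are the roots [s_i] of the weights; the others are real and
    imaginary parts of [y]. *)
Let ok rho lo hi (v : 'rV[R]_p) := [/\ forall i : 'I_p, `|v 0 i| <= (if (i < n)%N then 1 else rho), S2 v <= K%:R, lo <= N2 v & N2 v <= hi].
Let ok_si rho lo hi v i : ok rho lo hi v -> si i v ^+ 2 <= 1.
Proof.
case=> h _ _ _; have := h (lshift (n + n) i); rewrite /= ltn_ord => h1.
by rewrite -[_ ^+ 2]ger0_norm ?sqr_ge0 // normrX exprn_ile1.
Qed.
Let ok_mk rho lo hi s y : 0 <= rho -> (forall i, `|s i| <= 1) -> \sum_i s i ^+ 2 <= K%:R ->
  lo <= ip y y -> ip y y <= hi -> ip y y <= rho ^+ 2 -> ok rho lo hi (mk s y).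
Proof.
move=> r0 s1 sK l1 l2 l3.
have NE : N2 (mk s y) = ip y y by apply: eq_bigr => i _; rewrite yi_mk dot_nrm.
split; rewrite ?NE //; last first.
  by apply: le_trans sK; apply: ler_sum => i _; rewrite si_mk.
have ny j : nrm (y j 0) <= rho.
  rewrite -(@ler_pXn2r _ 2) ?nnegrE // -dot_nrm; apply: le_trans l3.
  by rewrite /ip (bigD1 j) //= lerDl sumr_ge0 // => i _; rewrite dot_nrm sqr_ge0.
move=> i; rewrite -(splitK i); case: (split i) => j /=.
  by rewrite ltn_ord /mk row_mxEl mxE.
rewrite ltnNge leq_addr /= /mk row_mxEr -(splitK j); case: (split j) => l /=.
  by rewrite row_mxEl mxE (le_trans (re_le _)).
by rewrite row_mxEr mxE (le_trans (im_le _)).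
Qed.
Let sqs v : (forall i, si i v ^+ 2 <= 1) -> 0 <= N2 v - \sum_i si i v ^+ 2 * nrm (yi i v) ^+ 2.
Proof.
by move=> s1; rewrite -sumrB sumr_ge0 // => i _; rewrite subr_ge0 ler_piMl ?sqr_ge0.
Qed.
Let JE b0 v : J b0 v = (N2 v - \sum_i si i v ^+ 2 * nrm (yi i v) ^+ 2) + ip (A *m xv v - b0 : RV m) (A *m xv v - b0).
Proof. by congr (_ + _); apply: eq_bigr => k _; rewrite dot_nrm. Qed.

(** Compactness on [|y| = 1]: if [J 0] vanished there, every nonzero [y_i] would have [s_i^2 = 1],
    so [x] would have at most [K] nonzero entries and [A x = 0], which forces [x = 0] and [y = 0].
    Homogeneity of degree 2 in [y] gives the rest. *)
Let coercive : exists2 c, 0 < c & forall s y, (forall i, `|s i| <= 1) -> \sum_i s i ^+ 2 <= K%:R ->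
  c * ip y y <= J 0 (mk s y).
Proof.
have n0 : (0 < n)%N by exact: leq_trans Kn.
pose i0 := Ordinal n0.
have n1 : nrm 1 != 0 by rewrite nrm_eq0 oner_eq0.
have ex : exists v, ok 1 1 1 v.
  pose y0 : RV n := sg i0 (iota (nrm 1)^-1 * 1).
  have y1 : ip y0 y0 = 1.
    by rewrite ip_sg sgE eqxx dot_nrm nrmZ ger0_norm ?invr_ge0 // mulVf // expr1n.
  exists (mk (fun=> 0) y0); apply: ok_mk => //; rewrite ?y1 ?expr1n //.
    by move=> i; rewrite normr0.
  by rewrite big1 // => i _; rewrite expr0n.
have [v okv minv] := box_min (J_cont 0) S2_cont N2_cont ex.
have v1 := fun i => ok_si i okv.
have c0 : 0 < J 0 v.
  rewrite lt_neqAle eq_sym; apply/andP; split; last by rewrite JE addr_ge0 ?sqs ?ip_ge0.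
  apply/negP => /eqP Jz; move: Jz; rewrite JE subr0 => Jz.
  have a1 := sqs v1; have a2 := ip_ge0 (A *m xv v : RV m).
  have z1 : N2 v - \sum_i si i v ^+ 2 * nrm (yi i v) ^+ 2 = 0 by lra.
  have z2 : (A *m xv v : RV m) = 0 by apply: ip_eq0; lra.
  have z3 i : (1 - si i v ^+ 2) * nrm (yi i v) ^+ 2 = 0.
    have : \sum_i (1 - si i v ^+ 2) * nrm (yi i v) ^+ 2 = 0.
      by rewrite -[RHS]z1 /N2 -sumrB; apply: eq_bigr => k _; rewrite mulrBl mul1r.
    move/psumr_eq0P; apply => // k _; by rewrite mulr_ge0 ?sqr_ge0 // subr_ge0.
  have s1 i : yi i v != 0 -> si i v ^+ 2 = 1.
    move=> y0; have /eqP := z3 i; rewrite mulf_eq0 sqrf_eq0 nrm_eq0 (negPf y0) orbF subr_eq0.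
    by move/eqP.
  case: okv => _ sK l1 _.
  have xz : xv v = 0.
    apply: injA => //; rewrite -(ler_nat R); apply: le_trans sK.
    rewrite /Defs.card -sum1_card natr_sum big_mkcond; apply: ler_sum => i _.
    rewrite inE mxE; case: ifP => [h|_]; last exact: sqr_ge0.
    by rewrite s1 //; apply: contraTneq h => ->; rewrite mulr0 eqxx.
  have yz i : nrm (yi i v) = 0.
    apply/eqP; rewrite nrm_eq0; apply/negPn/negP => y0; have := s1 i y0 => s2.
    have := congr1 (fun z : RV n => nrm (z i 0) ^+ 2) xz.
    rewrite !mxE nrmZ exprMn real_normK ?num_real // s2 mul1r nrm0 expr0n => /eqP.
    by rewrite sqrf_eq0 nrm_eq0 (negPf y0).
  by move: l1; rewrite /N2 big1 ?ler10 // => i _; rewrite yz expr0n.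
exists (J 0 v) => // s y s1 sK.
have [->|y0] := eqVneq y 0.
  have ip00 : ip (0 : RV n) 0 = 0 by rewrite -[X in ip X _](scale0r (0 : RV n)) ipZ mul0r.
  rewrite ip00 mulr0 JE addr_ge0 ?ip_ge0 // sqs // => i.
  by rewrite si_mk -[_ ^+ 2]ger0_norm ?sqr_ge0 // normrX exprn_ile1.
have yp : 0 < ip y y.
  by rewrite lt_neqAle ip_ge0 andbT eq_sym; apply: contraNneq y0 => /ip_eq0->.
pose c := (Num.sqrt (ip y y))^-1.
have c2 : c ^+ 2 * ip y y = 1 by rewrite /c exprVn sqr_sqrtr ?ltW // mulVf // lt0r_neq0.
have cy : ip (c *: y) (c *: y) = 1 by rewrite ipZ ipC ipZ mulrA -expr2.
have := minv (mk s (c *: y)).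
have -> : J 0 (mk s (c *: y)) = c ^+ 2 * J 0 (mk s y).
  have e i : yi i (mk s (c *: y)) = iota c * yi i (mk s y) by rewrite !yi_mk mxE.
  have ex' : xv (mk s (c *: y)) = c *: xv (mk s y).
    by apply/matrixP => i j; rewrite !mxE !si_mk e; ring.
  rewrite !JE !subr0 ex' mulmx_rZ ipZ [ip _ (_ *: _)]ipC ipZ mulrDr mulrBr [c * (c * _)]mulrA -expr2.
  rewrite /N2 !mulr_sumr; congr (_ - _ + _); apply: eq_bigr => i _; rewrite e nrmZ exprMn real_normK ?num_real //.
  by rewrite !si_mk; ring.
have okc : ok 1 1 1 (mk s (c *: y)) by apply: ok_mk; rewrite ?cy ?expr1n.
move=> /(_ okc) => h.
have := ler_wpM2r (ltW yp) h.
by rewrite mulrAC c2 mul1r.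
Qed.

Lemma exists_global_min : exists y : RV n, forall z : RV n, KKreg nrm A b K y <= KKreg nrm A b K z.
Proof.
have [c c0 co] := coercive.
(* A point with [J b <= |b|^2] satisfies [J 0 <= 2 <A x, b>], and since [|A x|^2 <= J 0] this gives
   [c |y|^2 <= J 0 <= 4 |b|^2]. All other points lose to [z0], where [J b] is [|b|^2]. *)
pose h := 4 * ip b b / c; have h0 : 0 <= h by rewrite divr_ge0 ?mulr_ge0 ?ip_ge0 // ltW.
pose rho := 1 + h; have r0 : 0 <= rho by rewrite addr_ge0.
have hr : h <= rho ^+ 2 by rewrite /rho; have := sqr_ge0 h; lra.
pose z0 := mk (fun=> 0) 0.
have ip00 : ip (0 : RV n) 0 = 0 by rewrite -[X in ip X _](scale0r (0 : RV n)) ipZ mul0r.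
have ok0 : ok rho 0 h z0.
  apply: ok_mk; rewrite ?ip00 ?sqr_ge0 //; first by move=> i; rewrite normr0 ler01.
  by rewrite big1 // => i _; rewrite expr0n.
have [v okv minv] := box_min (J_cont b) S2_cont N2_cont (ex_intro _ z0 ok0).
have J0 : J b z0 = ip b b.
  have x0 : xv z0 = 0 by apply/matrixP => i j; rewrite !mxE si_mk rmorph0 mul0r.
  have A0 : (A *m (0 : RV n) : RV m) = 0 by exact: mulmx0.
  have nb : ip (- b) (- b) = ip b b by rewrite -scaleN1r ipZ [ip b _]ipC ipZ; ring.
  rewrite JE x0 A0 sub0r nb /N2 -sumrB big1 ?add0r // => i _.
  by rewrite si_mk yi_mk mxE nrm0 expr0n mulr0 subrr.
exists (xv v) => z.
have [th [t01 tp tK tQ]] := Q2_rep z K0 Kn.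
pose s i := Num.sqrt (th i); pose y : RV n := \col_i (iota (s i)^-1 * z i 0).
have th0 i : 0 <= th i by case/andP: (t01 i).
have s2 i : s i ^+ 2 = th i by rewrite sqr_sqrtr.
have s0 i : z i 0 != 0 -> s i != 0 by move=> /tp h1; rewrite lt0r_neq0 // sqrtr_gt0.
have s1 i : `|s i| <= 1.
  by rewrite -(@ler_pXn2r _ 2) ?nnegrE // real_normK ?num_real // s2 expr1n; case/andP: (t01 i).
have xz : xv (mk s y) = z.
  apply/matrixP => i j; rewrite ord1 mxE si_mk yi_mk mxE mulrA -rmorphM.
  have [->|zi] := eqVneq (z i 0) 0; first by rewrite mulr0.
  by rewrite mulfV ?s0 // rmorph1 mul1r.
have JK : J b (mk s y) = KKreg nrm A b K z.
  rewrite JE xz /KKreg norm2E; congr (_ + _); apply/eqP; rewrite subr_eq; apply/eqP.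
  have -> : \sum_i si i (mk s y) ^+ 2 * nrm (yi i (mk s y)) ^+ 2 = \sum_i nrm (z i 0) ^+ 2.
    apply: eq_bigr => i _; rewrite si_mk yi_mk mxE nrmZ exprMn real_normK ?num_real //.
    have [->|zi] := eqVneq (z i 0) 0; first by rewrite nrm0 expr0n !mulr0.
    by rewrite mulrA -exprMn mulfV ?s0 // expr1n mul1r.
  rewrite tQ; apply: eq_bigr => i _.
  by rewrite yi_mk mxE nrmZ exprMn real_normK ?num_real // exprVn s2 mulrC.
have sK : \sum_i s i ^+ 2 <= K%:R by apply: le_trans tK; apply: ler_sum => i _; rewrite s2.
have Jmin : J b v <= J b (mk s y).
  have [big|small] := ltP (ip b b) (J b (mk s y)).
    by apply: le_trans (minv _ ok0) _; rewrite J0 ltW.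
  have yb : ip y y <= h.
    have ssq i : si i (mk s y) ^+ 2 <= 1 by rewrite si_mk s2; case/andP: (t01 i).
    have q0 := sqs ssq; have cs := ip_CS (A *m xv (mk s y) : RV m) b.
    have E0 := JE 0 (mk s y); rewrite subr0 in E0.
    have E1 := JE b (mk s y); move: E1; rewrite -scaleN1r ipDsq => E1.
    have cy := co s y s1 sK.
    set P := ip (A *m xv (mk s y) : RV m) b in cs E1; set Q := ip (A *m xv (mk s y) : RV m) (A *m xv (mk s y) : RV m) in cs E0 E1.
    have b0 := ip_ge0 b; have Q0 : 0 <= Q := ip_ge0 _.
    set J0' := J 0 (mk s y) in E0 cy; have J2 : J0' <= 2 * P by move: small; rewrite E1 E0; lra.
    have Jp : 0 <= J0' by rewrite E0 addr_ge0.
    have QJ : Q <= J0' by rewrite E0 lerDr.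
    have : J0' ^+ 2 <= 4 * (J0' * ip b b).
      apply: le_trans (_ : (2 * P) ^+ 2 <= _); first by rewrite ler_pXn2r // nnegrE // (le_trans Jp).
      rewrite exprMn -natrX ler_wpM2l // (le_trans cs) // ler_wpM2r //.
    move=> sq; have J4 : J0' <= 4 * ip b b.
      move: Jp; rewrite le_eqVlt => /predU1P[<-|Jp]; first by rewrite mulr_ge0.
      by rewrite -(ler_pM2l Jp) -expr2 mulrCA.
    by rewrite /h ler_pdivlMr // mulrC (le_trans cy).
  by apply: minv; apply: ok_mk => //; [exact: ip_ge0|exact: le_trans hr].
rewrite -JK; apply: le_trans Jmin.
have v1 := fun i => ok_si i okv; case: okv => _ vK _ _.
have w01 i : 0 <= si i v ^+ 2 <= 1 by rewrite sqr_ge0 v1.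
have wp i : xv v i 0 != 0 -> 0 < si i v ^+ 2.
  rewrite mxE => h1; rewrite exprn_even_gt0 //; apply: contraNneq h1 => ->.
  by rewrite rmorph0 mul0r.
have := Q2_le nrm_ge0 nrm_eq0 K0 Kn w01 wp vK.
have nx i : nrm (xv v i 0) ^+ 2 = si i v ^+ 2 * nrm (yi i v) ^+ 2.
  by rewrite mxE nrmZ exprMn real_normK ?num_real.
have : \sum_i nrm (xv v i 0) ^+ 2 / si i v ^+ 2 <= N2 v.
  apply: ler_sum => i _; rewrite nx; have [->|s00] := eqVneq (si i v ^+ 2) 0.
    by rewrite mul0r mul0r sqr_ge0.
  by rewrite mulrAC mulfV // mul1r.
have -> : \sum_i nrm (xv v i 0) ^+ 2 = \sum_i si i v ^+ 2 * nrm (yi i v) ^+ 2 by apply: eq_bigr.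
rewrite /KKreg norm2E JE; lra.
Qed.
End Min.

(** * The oracle solution *)

Section Recovery.
Hypothesis nrmM : forall x y, nrm (x * y) = nrm x * nrm y.

Let cj0 : cj 0 = 0. Proof. by rewrite -(rmorph0 iota) cj_iota. Qed.
Let cjN x : cj (- x) = - cj x.
Proof. by apply/eqP; rewrite -addr_eq0 -cjD addNr cj0. Qed.
Let cj_sum (I : Type) (r : seq I) (f : I -> F) : cj (\sum_(i <- r) f i) = \sum_(i <- r) cj (f i).
Proof. by elim: r => [|i r IH]; rewrite ?big_nil ?cj0 // !big_cons cjD IH. Qed.

Lemma adjM m n p (C : 'M[F]_(m, n)) (D : 'M[F]_(n, p)) : adj cj (C *m D) = adj cj D *m adj cj C.
Proof.
apply/matrixP => i j; rewrite !mxE cj_sum; apply: eq_bigr => k _.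
by rewrite !mxE cjM mulrC.
Qed.
Lemma adjK m n (C : 'M[F]_(m, n)) : adj cj (adj cj C) = C.
Proof. by apply/matrixP => i j; rewrite !mxE cjK. Qed.
Lemma adjB m n (C D : 'M[F]_(m, n)) : adj cj (C - D) = adj cj C - adj cj D.
Proof. by apply/matrixP => i j; rewrite !mxE cjD cjN. Qed.

Lemma pinv_normal_eq m n (C : 'M[F]_(m, n)) (X : 'M[F]_n) (z : 'cV[F]_m) :
  is_pinv cj (adj cj C *m C) X ->
  adj cj C *m C *m (X *m adj cj C *m z) = adj cj C *m z.
Proof.
case=> p1 _ p3 _; set M := adj cj C *m C in p1 p3 *; set Bm := adj cj C.
(* [D] satisfies [D D^* = 0], hence vanishes. *)
pose D := Bm - M *m X *m Bm.
have DC : D *m C = 0.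
  by rewrite mulmxBl -(mulmxA (M *m X)) -/M p1 subrr.
have aD : adj cj D = C - C *m (M *m X).
  by rewrite adjB adjM p3 /Bm adjK.
have DD (v : 'cV[F]_n) : D *m (adj cj D *m v) = 0.
  by rewrite mulmxA aD mulmxBr [D *m (C *m _)]mulmxA DC mul0mx subrr mul0mx.
have ip0r k (v : RV k) : ip v 0 = 0 by rewrite ipC -(scale0r (0 : RV k)) ipZ mul0r.
have aD0 (v : RV n) : (adj cj D *m v : RV m) = 0.
  by apply: ip_eq0; rewrite ip_adj adjK DD ip0r.
have Dz : (D *m z : RV n) = 0 by apply: ip_eq0; rewrite ip_adj aD0 ip0r.
apply/eqP; rewrite eq_sym -subr_eq0; apply/eqP; rewrite -[RHS]Dz /D mulmxBl.
by rewrite !mulmxA.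
Qed.

Lemma nrm_sub_le x y : nrm (x - y) <= nrm x + nrm y.
Proof.
rewrite -(@ler_pXn2r _ 2) ?nnegrE ?addr_ge0 // nrm_sub.
have := dot_le x y; rewrite ler_norml => /andP[h _].
rewrite sqrrD -mulr_natl; lra.
Qed.

(* (1/kap + c) ne - c q is at least sqrt(1/kap^2 + 2c/kap) om when ne^2 = q^2 + om^2. *)
Lemma noise_gap (kap c ne q om v : R) : 0 < kap -> 1 <= c -> 0 <= ne -> 0 <= q ->
  ne ^+ 2 = q ^+ 2 + om ^+ 2 -> (kap^-1 + c) * ne - c * q < v ->
  om ^+ 2 * (1 + 2 * kap) < kap ^+ 2 * v ^+ 2.
Proof.
move=> k0 c1 n0 q0 nE hv; set i := kap^-1 in hv.
have i0 : 0 < i by rewrite invr_gt0.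
have ik : kap * i = 1 by rewrite mulfV // lt0r_neq0.
have qn : q <= ne by rewrite -(@ler_pXn2r _ 2) ?nnegrE // nE lerDl sqr_ge0.
set V := (i + c) * ne - c * q in hv.
have V0 : 0 <= V.
  have : 0 <= c * (ne - q) by rewrite mulr_ge0 ?subr_ge0 // (le_trans ler01).
  have : 0 <= i * ne by rewrite mulr_ge0 // ltW.
  rewrite /V; lra.
have Vv : V ^+ 2 < v ^+ 2 by rewrite ltr_pXn2r // nnegrE // ltW // (le_lt_trans V0).
have E : V ^+ 2 = (i ^+ 2 + 2 * i * c) * om ^+ 2 + (c * ne - (i + c) * q) ^+ 2.
  have -> : om ^+ 2 = ne ^+ 2 - q ^+ 2 by rewrite nE addrAC subrr add0r.
  rewrite /V; ring.
have h : kap ^+ 2 * V ^+ 2 < kap ^+ 2 * v ^+ 2 by rewrite ltr_pM2l // exprn_gt0.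
apply: le_lt_trans h.
have -> : om ^+ 2 * (1 + 2 * kap) = kap ^+ 2 * ((i ^+ 2 + 2 * i) * om ^+ 2).
  have -> : kap ^+ 2 * ((i ^+ 2 + 2 * i) * om ^+ 2) = ((kap * i) ^+ 2 + 2 * kap * (kap * i)) * om ^+ 2 by ring.
  rewrite ik; ring.
rewrite ler_wpM2l ?sqr_ge0 // E.
have : 0 <= i * (c - 1) * om ^+ 2 by rewrite mulr_ge0 ?sqr_ge0 // mulr_ge0 ?subr_ge0 ?(ltW i0).
have := sqr_ge0 (c * ne - (i + c) * q); lra.
Qed.

Lemma beta_le m n (A : 'M[F]_(m, n)) k (x : RV n) : (Defs.card x <= k)%N ->
  beta nrm A k * norm2 nrm x <= norm2 nrm (A *m x).
Proof.
have [->|x0] := eqVneq x 0.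
  move=> _; have -> : norm2 nrm (0 : RV n) = 0; last by rewrite mulr0 norm2_ge0.
  by rewrite -(scale0r (0 : RV n)) norm2Z normr0 mul0r.
move=> xk; have np : 0 < norm2 nrm x.
  rewrite lt_neqAle norm2_ge0 andbT eq_sym; apply: contraNneq x0 => n0.
  by apply/eqP/ip_eq0; rewrite -norm2E n0 expr0n.
rewrite -ler_pdivlMr //; apply: ge_inf; last by exists x.
by exists 0 => r [z [_ _ ->]]; rewrite divr_ge0 ?norm2_ge0.
Qed.

Theorem recovery : thm57_statement nrm cj.
Proof.
move=> m n K A x0 S eps b SE SK bE [col1 _] bet gap X; set C := restr_cols A S; move=> pinv x'.
have b2p : 0 < beta nrm A K.*2 by apply: lt_trans bet; rewrite invr_gt0 sqrtr_gt0.
(* For [K = 0] the set defining [beta] is empty, and the infimum of the empty set is 0. *)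
have K0 : (0 < K)%N.
  rewrite lt0n; apply/negP => /eqP Kz; move: b2p; rewrite Kz /beta.
  rewrite (_ : [set r | _]%classic = classical_sets.set0) ?inf0 ?ltxx //.
  rewrite predeqE => r; split => // -[z [z0 cz _]].
  move: cz; rewrite leqn0 /Defs.card cards_eq0 => /eqP s0; apply/negP: z0; rewrite negbK.
  apply/eqP/matrixP => i j; rewrite ord1 mxE; apply/eqP/negPn/negP => zi.
  by have : i \in Defs.supp z; [rewrite inE|rewrite s0 inE].
have Kn : (K <= n)%N by rewrite -SK -[X in (_ <= X)%N]card_ord max_card.
have n0 : (0 < n)%N by exact: leq_trans Kn.
have colA (i : 'I_n) z : ip (A *m sg i z : RV m) (A *m sg i z : RV m) <= nrm z ^+ 2.
  have -> : ip (A *m sg i z : RV m) (A *m sg i z : RV m) = norm2 nrm (col i A) ^+ 2 * nrm z ^+ 2.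
    rewrite norm2E mulr_suml; apply: eq_bigr => k _.
    have -> : (A *m sg i z) k 0 = A k i * z.
      by rewrite mxE (bigD1 i) //= sgE eqxx big1 ?addr0 // => j /negPf ji; rewrite sgE ji mulr0.
    by rewrite !dot_nrm nrmM exprMn mxE.
  rewrite ler_piMl ?sqr_ge0 // exprn_ile1 ?norm2_ge0 //.
  by apply: le_trans col1; apply: le_bigmax.
have ball1 (v : RV n) k : (Defs.card v <= k)%N -> beta nrm A k ^+ 2 * ip v v <= ip (A *m v : RV m) (A *m v : RV m) \/ beta nrm A k < 0.
  move=> vk; have [b0|b0] := lerP 0 (beta nrm A k); [left|by right].
  rewrite -!norm2E -exprMn ler_pXn2r ?nnegrE ?norm2_ge0 ?mulr_ge0 ?norm2_ge0 //.
  exact: beta_le.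
pose i0 := Ordinal n0; pose d0 : RV n := sg i0 1.
have n1 : nrm 1 = 1.
  have := nrmM 1 1; rewrite mulr1 => h; apply: (@mulfI _ (nrm 1)); first by rewrite nrm_eq0 oner_eq0.
  by rewrite -h mulr1.
have dd : ip d0 d0 = 1 by rewrite ip_sg sgE eqxx dot_nrm n1 expr1n.
have d0n : d0 != 0.
  by apply/negP => /eqP dz; have := dd; rewrite dz -(scale0r (0 : RV n)) ipZ mul0r => /eqP; rewrite eq_sym oner_eq0.
have cd k : (0 < k)%N -> (Defs.card d0 <= k)%N.
  move=> k0; apply: leq_trans (_ : #|[set i0]| <= _)%N; last by rewrite cards1.
  apply: subset_leq_card; apply/fintype.subsetP => j; rewrite !inE sgE.
  by case: (j == i0); rewrite ?eqxx.
have bK1 : beta nrm A K <= 1.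
  have := beta_le A (cd K K0).
  have nd : norm2 nrm d0 = 1 by apply/eqP; rewrite -(@eqrXn2 _ 2) ?norm2_ge0 // norm2E dd expr1n.
  rewrite nd mulr1 => h; apply: le_trans h _.
  by rewrite -(@ler_pXn2r _ 2) ?nnegrE ?norm2_ge0 // norm2E expr1n (le_trans (colA _ _)) // n1 expr1n.
have b2K : beta nrm A K.*2 <= beta nrm A K.
  apply: lb_le_inf; first by exists (norm2 nrm (A *m d0) / norm2 nrm d0), d0; split=> //; apply: cd.
  move=> r [z [z0 zK ->]]; have zp : 0 < norm2 nrm z.
    rewrite lt_neqAle norm2_ge0 andbT eq_sym; apply: contraNneq z0 => nz.
    by apply/eqP/(@ip_eq0 _ (z : RV n)); rewrite -norm2E nz expr0n.
  rewrite ler_pdivlMr //; apply: beta_le; apply: leq_trans zK _.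
  by rewrite -addnn leq_addr.
have bKp : 0 < beta nrm A K by apply: lt_le_trans b2K.
set kap := 2 * beta nrm A K.*2 ^+ 2 - 1 in gap.
have bsq : beta nrm A K.*2 ^+ 2 = (1 + kap) / 2 by rewrite /kap; field.
have kap0 : 0 < kap.
  rewrite /kap subr_gt0; have s2 : 0 < (Num.sqrt 2)^-1 :> R by rewrite invr_gt0 sqrtr_gt0.
  have : (Num.sqrt 2)^-1 ^+ 2 < beta nrm A K.*2 ^+ 2 by rewrite ltr_pXn2r // nnegrE ltW.
  rewrite exprVn sqr_sqrtr //; lra.
have kap1 : kap <= 1.
  have : beta nrm A K.*2 ^+ 2 <= 1 by rewrite exprn_ile1 ?(ltW b2p) // (le_trans b2K bK1).
  rewrite /kap; lra.
have sparse (v : RV n) : (#|Defs.supp v| <= K.*2)%N -> (1 + kap) / 2 * ip v v <= ip (A *m v : RV m) (A *m v : RV m).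
  move=> h; rewrite -bsq; case: (ball1 v _ h) => // h'.
  by have := lt_trans h' b2p; rewrite ltxx.
have kp : 0 < (1 + kap) / 2 by rewrite divr_gt0 // addr_gt0.
have injA (v : RV n) : (Defs.card v <= K)%N -> (A *m v : RV m) = 0 -> v = 0.
  move=> vK Av; apply: ip_eq0; apply: le_anti; rewrite ip_ge0 andbT.
  have := sparse v (leq_trans vK _); rewrite Av -[X in _ <= ip X _](scale0r (0 : RV m)) ipZ mul0r -addnn leq_addr.
  by move=> /(_ isT); rewrite pmulr_rle0.
have Cv (v : RV n) : (forall i, i \notin S -> v i 0 = 0) -> (C *m v : RV m) = A *m v.
  move=> vS; apply/matrixP => k j; rewrite ord1 !mxE; apply: eq_bigr => i _.
  by rewrite mxE; case: ifPn => // /vS->; rewrite !mulr0.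
pose u : RV n := x'.
have uS i : i \notin S -> u i 0 = 0.
  move=> iS; case: pinv => _ p2 _ p4.
  (* With [M = C^* C], [X = X M X = (X M)^* X = M X^* X]; this puts [u] in the range of [C^*], whose
     rows outside [S] vanish. *)
  have -> : u = adj cj C *m (C *m (adj cj X *m (X *m adj cj C *m b))).
    rewrite /u /x' -{1}p2 -{1}p4 adjM !adjM adjK !mulmxA //.
  by rewrite mxE big1 // => k _; rewrite !mxE (negPf iS) cj0 mul0r.
pose r : RV m := b - A *m u.
have Cr : adj cj C *m r = 0.
  have := pinv_normal_eq b pinv; rewrite -/x' -mulmxA => h.
  by rewrite mulmxBr -(Cv u uS) h subrr.
have rC (v : RV n) : (forall i, i \notin S -> v i 0 = 0) -> ip r (A *m v : RV m) = 0.
  move=> vS; rewrite -(Cv v vS) ipC ip_adj Cr ipC.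
  by rewrite -(scale0r (0 : RV n)) ipZ mul0r.
have rS i z : i \in S -> ip r (A *m sg i z : RV m) = 0.
  by move=> iS; apply: rC => k kS; rewrite sgE; case: eqP kS => // ->; rewrite iS.
pose e : RV n := u - x0.
have x0S i : i \notin S -> x0 i 0 = 0 by rewrite SE inE negbK => /eqP.
have eS i : i \notin S -> e i 0 = 0.
  by move=> iS; rewrite mxE [(- x0) i 0]mxE uS // x0S // subr0.
(* An orthogonal decomposition, since [r] is orthogonal to the columns in [S]:
   [|eps|^2 = |r|^2 + |A e|^2]. The part [A e] moves [u_j] away from [x0_j] by at most
   [|A e| / beta_K], so both effects of the noise cannot be extreme at once, which [noise_gap]
   exploits. *)
have epsE : eps = r + 1 *: (A *m e : RV m) :> RV m.
  by rewrite scale1r /r /e mulmxBr bE addrA subrK addrAC subrr add0r.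
have ce : (Defs.card e <= K)%N.
  rewrite -SK; apply: subset_leq_card; apply/fintype.subsetP => i; rewrite inE.
  by apply: contraR => /eS->.
have key j : j \in S -> ip r r * (1 + 2 * kap) < kap ^+ 2 * nrm (u j 0) ^+ 2.
  move=> jS; have := gap j jS; set ne := norm2 nrm eps => hg.
  pose q := norm2 nrm (A *m e : RV m).
  rewrite -norm2E; apply: (@noise_gap kap (beta nrm A K)^-1 ne q) => //.
  - by rewrite invf_ge1.
  - exact: norm2_ge0.
  - exact: norm2_ge0.
  - rewrite /ne /q !norm2E epsE ipDsq rC // expr1n; ring.
  have ej : nrm (e j 0) <= (beta nrm A K)^-1 * q.
    rewrite mulrC ler_pdivlMr // mulrC; apply: le_trans (beta_le A ce).
    rewrite ler_wpM2l ?(ltW bKp) // -(@ler_pXn2r _ 2) ?nnegrE ?norm2_ge0 // norm2E -dot_nrm /ip (bigD1 j) //=.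
    by rewrite lerDl sumr_ge0 // => k _; rewrite dot_nrm sqr_ge0.
  have := nrm_sub_le (u j 0) (e j 0).
  have -> : u j 0 - e j 0 = x0 j 0 by rewrite [e j 0]mxE [(- x0) j 0]mxE opprB addrCA subrr addr0.
  lra.
have [j1 j1S] : exists j, j \in S by apply/card_gt0P; rewrite SK.
case: (@arg_minP _ R _ j1 (mem S) (fun j => nrm (u j 0) ^+ 2) j1S) => j j2 jmin.
have jS : j \in S by [].
pose m2 := nrm (u j 0) ^+ 2.
have hom : ip r r * (1 + 2 * kap) < kap ^+ 2 * m2 by exact: key.
have m20 : 0 < m2.
  have : 0 < kap ^+ 2 * m2.
    by apply: le_lt_trans hom; rewrite mulr_ge0 ?ip_ge0 // addr_ge0 // mulr_ge0 // ltW.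
  by rewrite pmulr_rgt0 // exprn_gt0.
have uniq (y : RV n) : local_min nrm (KKreg nrm A b K) y -> y = x'.
  move=> lm.
  exact: (@local_min_unique m n K A b S u y kap m2 K0 SK uS rS kap0 kap1 m20 jmin hom sparse colA lm).
have glob : global_min (KKreg nrm A b K) x'.
  have [y ymin] := exists_global_min b K0 Kn injA.
  by rewrite -(uniq y) //; exists 1 => // z _; apply: ymin.
have cx : (Defs.card x' <= K)%N.
  rewrite -SK; apply: subset_leq_card; apply/fintype.subsetP => i; rewrite inE.
  by apply: contraR => /uS->.
split=> // y.
rewrite /KK cx; case: ifPn => [cy|_]; last exact: leey.
have := glob y; rewrite /KKreg !(Q2_sparse nrm_ge0 nrm_eq0 K0 Kn) // !add0r.
by rewrite lee_fin.
Qed.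
End Recovery.

End Exists.
End Scalars.

Import Normc.

(* F = R (modulus |.|, trivial conjugation) and F = C = R[i]
   (modulus normc, conjugation conjc). *)
Theorem theorem5p7 :
  (forall R : realType, thm57_statement (F:=R) (@Num.norm _ R) id) /\
  (forall R : realType,
     thm57_statement (F:=R[i]) (@Normc.normc R) (@conjc R)).
Proof.
split=> R.
  apply: (@recovery R R idfun id (@Num.norm _ R) id _ _ _ _ _ _ _ _ _ _ (fun=> 0) 0) => //=.
  - exact: normr_eq0.
  - by move=> x; rewrite real_normK ?num_real // expr2.
  - by rewrite addr0.
  - by move=> a x; rewrite mulr0.
  - by move=> x; rewrite mulr0 addr0.
  - by move=> x; rewrite normr0.
  - exact: normrM.
apply: (@recovery R R[i] (real_complex R) (@conjc R) (@normc R) (@complex.Re R) _ _ _ _ _ _ _ _ _ _ (@complex.Im R) 'i%C).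
- by case=> a b [c d].
- by move=> a [c d] /=; rewrite mul0r subr0.
- exact: rmorphD.
- exact: rmorphM.
- exact: conjcK.
- exact: conjc_real.
- by case.
- by case=> a b; apply: sqrtr_ge0.
- by move=> x; apply/eqP/eqP => [/eq0_normc|->]; rewrite ?normc0.
- by case=> a b /=; rewrite sqr_sqrtr ?addr_ge0 ?sqr_ge0 //; ring.
- by case=> a b [c d].
- by move=> a [c d] /=; rewrite mul0r addr0.
- by case=> a b; apply/eqP; rewrite eq_complex /=; apply/andP; split; apply/eqP; ring.
- by case=> a b /=; rewrite -sqrtr_sqr ler_wsqrtr // lerDl sqr_ge0.
- by case=> a b /=; rewrite -sqrtr_sqr ler_wsqrtr // lerDr sqr_ge0.
- exact: normcM.
Qed.
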